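(* Let $k \geq 7$. Let $\mathcal{M}$ be the set of perfect matchings of the complete graph $K_{2k}$. For an even partition $\lambda$ of $2k$, let $A_\lambda$ be the $\mathcal{M}\times\mathcal{M}$ matrix whose $(P,Q)$-entry is $1$ if the union $P\cup Q$ has shape $\lambda$ and $0$ otherwise. Define \[ \hat{B}_{2}(2k) = \frac{k}{3(2k-4)!!}A_{[2k]}+\frac{2k-6}{3(2k-4)!!}A_{[2k-2,2]}. \] Then $\hat{B}_{2}(2k)$ has constant row sum $\frac{(2k-1)(2k-3)}{3}-1$ and least eigenvalue $-1$. Furthermore, the only modules on which $\hat{B}_{2}(2k)$ has eigenvalue $-1$ are the modules $[2k-2,2]$ and $[2k-4,4]$, and on every module other than $[2k]$, $[2k-2,2]$ and $[2k-4,4]$ the eigenvalue of $\hat{B}_{2}(2k)$ lies in the open interval $\left(-1,\frac{(2k-1)(2k-3)}{3}-1\right)$.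
   Context: For an even positive integer $2m$, $(2m)!! = (2m)(2m-2)\cdots 2$ (with $0!!=1$), and for odd $2m-1$, $(2m-1)!!=(2m-1)(2m-3)\cdots 1$; the number of perfect matchings of $K_{2k}$ is $(2k-1)!!$. The union of two perfect matchings $P,Q$ of $K_{2k}$ (as a multigraph, a common edge counting as a cycle of length $2$) is a disjoint union of even cycles; the multiset of their lengths, written as a partition of $2k$ with nonincreasing parts, is the shape of $P\cup Q$. An even partition of $2k$ is one all of whose parts are even. The matrices $A_\lambda$, $\lambda$ ranging over even partitions of $2k$, form a symmetric (commutative) association scheme (the perfect matching association scheme). The space $\mathbb{C}^{\mathcal{M}}$, as a $\mathrm{Sym}(2k)$-module (with $\mathrm{Sym}(2k)$ acting on vertices of $K_{2k}$), decomposes multiplicity-freely into the irreducible $\mathrm{Sym}(2k)$-modules indexed by the even partitions $\mu$ of $2k$; these are the common eigenspaces of all $A_\lambda$, and ''the eigenvalue on module $\mu$'' means the scalar by which the matrix acts on the irreducible constituent indexed by $\mu$. The module $[2k]$ is the span of the all-ones vector. *)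

(* Defs.v *)
From mathcomp Require Import all_boot all_order all_algebra all_fingroup.
From mathcomp Require Import mxrepresentation.

Set Implicit Arguments.
Unset Strict Implicit.
Unset Printing Implicit Defensive.

Import Order.TTheory GRing.Theory Num.Theory.
Local Open Scope ring_scope.

Fixpoint double_factorial (n : nat) : nat :=
  if n is m.+2 then (n * double_factorial m)%N else 1%N.

(* Partitions are nonincreasing sequences of positive parts. *)
Definition even_partition (n : nat) (mu : seq nat) : bool :=
  [&& sorted geq mu, all (fun p => (0 < p)%N && ~~ odd p) mu & sumn mu == n].

Section PerfectMatchings.

Variable n : nat.

Definition is_perfect_matching (P : {set {set 'I_n}}) : bool :=
  partition P [set: 'I_n] && [forall e in P, #|e| == 2%N].

Definition pmatching := {P : {set {set 'I_n}} | is_perfect_matching P}.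

Definition union_adj (P Q : pmatching) : rel 'I_n :=
  fun x y => [exists e in val P :|: val Q, (x \in e) && (y \in e)].

Definition union_components (P Q : pmatching) : {set {set 'I_n}} :=
  equivalence_partition (connect (union_adj P Q)) [set: 'I_n].

(* Each component is an even cycle, whose length is its number of vertices
   (a common edge is a 2-cycle on two vertices). *)
Definition shape (P Q : pmatching) : seq nat :=
  sort geq [seq #|c| | c : {set 'I_n} <- enum (union_components P Q)].

Definition pm_image (P : pmatching) (s : 'S_n) : {set {set 'I_n}} :=
  [set [set s x | x in e] | e : {set 'I_n} in val P].

Lemma pm_imageP (P : pmatching) (s : 'S_n) :
  is_perfect_matching (pm_image P s).
Proof.
have inj_s := @perm_inj _ s.
have inj_S : injective (fun e : {set 'I_n} => [set s x | x in e]).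
  exact: imset_inj.
case/andP: (valP P) => /and3P[/eqP covP trivP P0] /forall_inP cardP.
apply/andP; split; last first.
  apply/forall_inP => _ /imsetP[e Pe ->].
  by rewrite card_imset // cardP.
apply/and3P; split.
- rewrite eqEsubset subsetT /=; apply/subsetP => x _.
  have: (s^-1)%g x \in cover (val P) by rewrite covP inE.
  case/bigcupP => e Pe ex; apply/bigcupP.
  exists [set s y | y in e]; first exact: imset_f.
  by apply/imsetP; exists ((s^-1)%g x); rewrite ?permKV.
- apply/trivIsetP => _ _ /imsetP[e Pe ->] /imsetP[f Pf ->] neq.
  rewrite imset_disjoint //.
  by apply: (trivIsetP trivP) => //; apply: contraNneq neq => ->.
- apply/imsetP => -[e Pe /esym/eqP]; rewrite imset_eq0 => /eqP e0.
  by rewrite -e0 Pe in P0.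
Qed.

Definition pm_act (P : pmatching) (s : 'S_n) : pmatching :=
  exist _ (pm_image P s) (pm_imageP P s).

Lemma pm_act_is_action : is_action [set: 'S_n] pm_act.
Proof.
apply: is_total_action => [P | P s t]; apply: val_inj => /=.
  rewrite /pm_image -[RHS]imset_id; apply: eq_imset => e /=.
  by rewrite -[RHS]imset_id; apply: eq_imset => x; rewrite perm1.
rewrite /pm_image -imset_comp; apply: eq_imset => e /=.
by rewrite -imset_comp; apply: eq_imset => x; rewrite /= permM.
Qed.

Canonical pm_action := Action pm_act_is_action.

(* Entry x of a tableau lies in position f x; renaming every entry x to s x
   gives the following right action on fillings. *)
Definition relabel (R : finType) (f : {ffun 'I_n -> R}) (s : 'S_n) :
  {ffun 'I_n -> R} := [ffun x => f ((s^-1)%g x)].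

Lemma relabel_is_action (R : finType) : is_action [set: 'S_n] (@relabel R).
Proof.
apply: is_total_action => [f | f s t]; apply/ffunP => x.
  by rewrite ffunE invg1 perm1.
by rewrite !ffunE invMg permM.
Qed.

Canonical relabel_action (R : finType) := Action (@relabel_is_action R).

End PerfectMatchings.

Section PermutationModule.

Variables (C : fieldType) (aT : finGroupType) (T : finType).
Variable to : {action aT &-> T}.

(* The basis row vector e_x is sent to e_(to x g). *)
Definition permutation_mx (g : aT) : 'M[C]_#|T| :=
  \matrix_(i, j) (to (enum_val i) g == enum_val j)%:R.

Lemma delta_permutation_mx (x : T) (g : aT) :
  delta_mx 0 (enum_rank x) *m permutation_mx g
  = delta_mx 0 (enum_rank (to x g)) :> 'rV[C]_#|T|.
Proof.
rewrite -rowE; apply/rowP => j; rewrite !mxE enum_rankK eqxx /=.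
by rewrite -[j == _](inj_eq enum_val_inj) enum_rankK eq_sym.
Qed.

Lemma permutation_mx_repr : mx_repr [set: aT] permutation_mx.
Proof.
split=> [|g h _ _]; apply/row_matrixP => i.
  by rewrite rowE -(enum_valK i) delta_permutation_mx act1 row1.
rewrite row_mul !rowE -(enum_valK i) !delta_permutation_mx.
by rewrite actM.
Qed.

Definition permutation_repr : mx_representation C [set: aT] #|T| :=
  MxRepresentation permutation_mx_repr.

End PermutationModule.

Section SpechtModule.

Variables (C : fieldType) (n : nat).

(* A tableau gives the (row, column) position of each entry.  When mu is a
   partition of n, an injective filling of the diagram of mu is bijective. *)
Definition is_tableau (mu : seq nat) (t : {ffun 'I_n -> 'I_n * 'I_n}) : bool :=
  injectiveb t && [forall x, ((t x).2 < nth 0%N mu (t x).1)%N].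

Definition tableau_rows (t : {ffun 'I_n -> 'I_n * 'I_n}) : {ffun 'I_n -> 'I_n} :=
  [ffun x => (t x).1].

Definition tableau_cols (t : {ffun 'I_n -> 'I_n * 'I_n}) : {ffun 'I_n -> 'I_n} :=
  [ffun x => (t x).2].

(* A tabloid is identified with its row function, so tabloids of every shape
   are basis vectors of the single permutation module on {ffun 'I_n -> 'I_n}. *)
Definition polytabloid (t : {ffun 'I_n -> 'I_n * 'I_n}) :
  'rV[C]_#|{ffun 'I_n -> 'I_n}| :=
  \sum_(s : 'S_n | relabel (tableau_cols t) s == tableau_cols t)
     (-1) ^+ odd_perm s *: delta_mx 0 (enum_rank (relabel (tableau_rows t) s)).

Definition tabloid_repr :
  mx_representation C [set: 'S_n] #|{ffun 'I_n -> 'I_n}| :=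
  permutation_repr C (@relabel_action n 'I_n).

Definition specht_mx (mu : seq nat) : 'M[C]_#|{ffun 'I_n -> 'I_n}| :=
  (\sum_(t | is_tableau mu t) <<polytabloid t>>)%MS.

Lemma polytabloid_relabel (t : {ffun 'I_n -> 'I_n * 'I_n}) (g : 'S_n) :
  polytabloid t *m tabloid_repr g = polytabloid (relabel t g).
Proof.
have rowsE : tableau_rows (relabel t g) = relabel (tableau_rows t) g.
  by apply/ffunP => x; rewrite !ffunE.
have colsE : tableau_cols (relabel t g) = relabel (tableau_cols t) g.
  by apply/ffunP => x; rewrite !ffunE.
have relM (R : finType) (f : {ffun 'I_n -> R}) a b :
    relabel (relabel f a) b = relabel f (a * b)%g.
  exact/esym/(actM (relabel_action n R)).
have relI (R : finType) a : injective (fun f : {ffun 'I_n -> R} => relabel f a).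
  exact: (act_inj (relabel_action n R) a).
rewrite /polytabloid rowsE colsE mulmx_suml.
rewrite [RHS](reindex_inj (conjg_inj g)) /=; apply: eq_big => s.
  by rewrite relM -conjgC -relM (inj_eq (relI _ g)).
move=> _; rewrite -scalemxAl odd_permJ.
by rewrite delta_permutation_mx /= !relM -conjgC.
Qed.

Lemma specht_mxmodule (mu : seq nat) : mxmodule tabloid_repr (specht_mx mu).
Proof.
apply/mxmoduleP => g _; rewrite sumsmxMr; apply/sumsmx_subP => t /andP[tI tmu].
rewrite (eqmxMr _ (genmxE _)) polytabloid_relabel.
apply: (sumsmx_sup (relabel t g)); last by rewrite genmxE.
apply/andP; split.
  apply/injectiveP => x y; rewrite !ffunE => /(injectiveP _ tI).
  exact: perm_inj.
by apply/forallP => x; rewrite ffunE (forallP tmu).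
Qed.

Definition specht_repr (mu : seq nat) :
  mx_representation C [set: 'S_n] (\rank (specht_mx mu)) :=
  submod_repr (specht_mxmodule mu).

End SpechtModule.

Section MatchingScheme.

Variables (C : numClosedFieldType) (n : nat).

Definition matching_mx (lambda : seq nat) : 'M[C]_#|{: pmatching n}| :=
  \matrix_(i, j) (shape (enum_val i) (enum_val j) == lambda)%:R.

Definition matching_repr :
  mx_representation C [set: 'S_n] #|{: pmatching n}| :=
  permutation_repr C (pm_action n).

(* The row space of U is a submodule of C^M isomorphic to the irreducible
   Sym(n)-module indexed by mu. *)
Definition is_constituent (mu : seq nat) (U : 'M[C]_#|{: pmatching n}|) : Prop :=
  exists modU : mxmodule matching_repr U,
    mx_rsim (submod_repr modU) (specht_repr C n mu).

Definition module_eigenvalue (B : 'M[C]_#|{: pmatching n}|) (mu : seq nat)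
    (theta : C) : Prop :=
  (exists U, is_constituent mu U)
  /\ forall U, is_constituent mu U -> U *m B = theta *: U.

Definition least_eigenvalue (B : 'M[C]_#|{: pmatching n}|) (a : C) : Prop :=
  eigenvalue B a /\ forall b : C, eigenvalue B b -> a <= b.

End MatchingScheme.

Definition Bhat2 (C : numClosedFieldType) (k : nat) :
  'M[C]_#|{: pmatching (2 * k)}| :=
  (k%:R / (3 * double_factorial (2 * k - 4))%:R)
    *: matching_mx C (2 * k) [:: (2 * k)%N]
  + ((2 * k - 6)%:R / (3 * double_factorial (2 * k - 4))%:R)
    *: matching_mx C (2 * k) [:: (2 * k - 2)%N; 2%N].

(* Main.v *)
(* For a tableau [t] of even shape [mu], antisymmetrizing over the column
   stabilizer of [t] the indicator of the matchings that pair equal rows gives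
   functions [xt t] on matchings.  James's submodule argument shows that every
   invariant kernel acts on them by a scalar depending only on [mu], and a
   highest-weight argument shows that together they are complete, so these
   scalars are all the eigenvalues.  The Garnir relations, in the manner of
   Jucys-Murphy elements, give the eigenvalue of [A_[2k]] as the product of
   [2j - i] over the cells [(i, j) <> (0, 0)] of the half diagram [mu / 2].
   Restricting to an edge writes the eigenvalue of [A_[2k-2,2]] as an average of
   such products over the half diagrams with one cell less.  The mean content of
   this average is known from the sum of all transpositions, which is enough to
   evaluate the combination when the first row of [mu / 2] has at least [k - 2]
   cells; otherwise the products are too small to matter. *)

Require Import Defs.
From mathcomp Require Import all_boot all_order all_algebra all_fingroup.
From mathcomp Require Import mxrepresentation.
From mathcomp Require Import zify ring.

Set Implicit Arguments.
Unset Strict Implicit.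
Unset Printing Implicit Defensive.

Import Order.TTheory GRing.Theory Num.Theory.
Local Open Scope ring_scope.

(** Shapes are compared by one number instead of the dominance order: the weight [wt], the sum of
    all row indices. Distinct entries of a column weigh least when they occupy the top rows, so a
    tableau has least weight among the fillings without repetition in its columns. Weights are
    totally ordered, and a symmetric kernel may be moved to either side, so two shapes can always be
    compared. Restriction to an edge is measured by quadratic forms. For real [z], [dot (app K z) z]
    is a sum of eigenvalues of [K] weighted by squared norms of components. Summed over all edges
    for the identity, the Hamiltonian kernel and the transpositions, the same weights give the total
    mass, the wanted eigenvalue and the mean content. A half diagram receives weight only if its
    first row is that of [mu / 2] or one shorter, and it has no more rows. For [[k-1,1]] and
    [[k-2,2]] two candidates remain, so two linear equations fix the weights, and the coefficients
    of the matrix turn both eigenvalues into [-1]. For [[k-2,1,1]] one weight stays free and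
    inequalities result. *)

(** * Matchings as fixed-point-free involutions *)

Section Mate.
Variable n : nat.
Implicit Types (P Q : pmatching n) (s : 'S_n) (x y : 'I_n).

(** The default [x] is never returned, since every vertex lies on an edge ([mate_edge]). *)
Definition mate P x : 'I_n :=
  odflt x [pick y | (y != x) && ([set x; y] \in val P)].

Lemma mate_edge P x : (mate P x != x) && ([set x; mate P x] \in val P).
Proof.
rewrite /mate; case: pickP => [y //|none] /=.
case/andP: (valP P) => /and3P[/eqP covP _ _] /forall_inP cardP.
have: x \in cover (val P) by rewrite covP inE.
case/bigcupP => e Pe ex; have := cardP e Pe.
rewrite (cardsD1 x) ex => /cards1P[y ey].
have ye : y \in e :\ x by rewrite ey set11.
have eE : e = [set x; y] by rewrite -(setD1K ex) ey.
have := none y; rewrite -eE Pe andbT.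
by move: ye; rewrite !inE => /andP[-> _].
Qed.

Lemma mate_neq P x : mate P x != x.
Proof. by case/andP: (mate_edge P x). Qed.

Lemma mate_mem P x : [set x; mate P x] \in val P.
Proof. by case/andP: (mate_edge P x). Qed.

Lemma edge_mate P (e : {set 'I_n}) x : e \in val P -> x \in e -> e = [set x; mate P x].
Proof.
move=> Pe ex; case/andP: (valP P) => /and3P[_ trivP _] _.
apply/eqP; apply: contraT => neq.
have := trivIsetP trivP _ _ Pe (mate_mem P x) neq.
by move/pred0P/(_ x); rewrite /= ex set21.
Qed.

Lemma mate_uniq P x y : y != x -> [set x; y] \in val P -> mate P x = y.
Proof.
move=> nyx Pxy; have := edge_mate Pxy (set21 x y).
move/setP/(_ y); rewrite !inE eqxx orbT (negPf nyx) /= => /esym/eqP->//.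
Qed.

Lemma mateK P : involutive (mate P).
Proof.
move=> x; apply: mate_uniq; first by rewrite eq_sym mate_neq.
by rewrite setUC mate_mem.
Qed.

Lemma mate_inj P : injective (mate P).
Proof. exact: inv_inj (mateK P). Qed.

Lemma val_mate P : val P = [set [set x; mate P x] | x in 'I_n].
Proof.
apply/setP => e; apply/idP/imsetP => [Pe|[x _ ->]]; last exact: mate_mem.
case/andP: (valP P) => _ /forall_inP/(_ e Pe) /eqP ce.
have /card_gt0P[x ex] : (0 < #|e|)%N by rewrite ce.
by exists x => //; apply: edge_mate.
Qed.

Lemma eq_mate P Q : mate P =1 mate Q -> P = Q.
Proof.
move=> eqm; apply: val_inj; rewrite !val_mate.
by apply: eq_imset => x; rewrite eqm.
Qed.

Lemma of_mate_proof (p : 'I_n -> 'I_n) :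
  involutive p -> (forall x, p x != x) ->
  is_perfect_matching [set [set x; p x] | x in 'I_n].
Proof.
move=> pK pn; apply/andP; split; last first.
  apply/forall_inP => _ /imsetP[x _ ->].
  by have := pn x; rewrite cards2 eq_sym => ->.
apply/and3P; split.
- rewrite eqEsubset subsetT /=; apply/subsetP => x _.
  apply/bigcupP; exists [set x; p x]; last exact: set21.
  by apply/imsetP; exists x.
- apply/trivIsetP => _ _ /imsetP[x _ ->] /imsetP[y _ ->] neq.
  apply/pred0P => z /=; apply: contraNF neq; rewrite !inE.
  have eqp u : [set p u; p (p u)] = [set u; p u] by rewrite pK setUC.
  by case/andP => /orP[] /eqP-> /orP[] /eqP; [move->|move->|move<-|move/(inv_inj pK)->];
    rewrite ?eqp.
- by apply/imsetP => -[x _ /setP/(_ x)]; rewrite !inE eqxx.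
Qed.

(** A sigma type rather than an existential, because [ext] extracts its matching from it. *)
Lemma of_mate (p : 'I_n -> 'I_n) :
  involutive p -> (forall x, p x != x) -> {P : pmatching n | mate P =1 p}.
Proof.
move=> pK pn.
exists (exist (fun E => is_true (is_perfect_matching E)) _ (of_mate_proof pK pn)) => x.
by apply: mate_uniq => //; apply/imsetP; exists x.
Qed.

Lemma mate_act P s x : mate (pm_act P s) (s x) = s (mate P x).
Proof.
apply: mate_uniq; first by rewrite (inj_eq perm_inj) mate_neq.
apply/imsetP; exists [set x; mate P x]; first exact: mate_mem.
by rewrite imsetU1 imset_set1.
Qed.

Lemma mate_actE P s x : mate (pm_act P s) x = s (mate P ((s^-1)%g x)).
Proof. by rewrite -mate_act permKV. Qed.

Lemma union_adjE P Q x y :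
  union_adj P Q x y = [|| y == x, y == mate P x | y == mate Q x].
Proof.
apply/existsP/idP => [[e /andP[]]|].
  rewrite inE => /orP[] Pe /andP[xe ye]; move: ye;
  by rewrite (edge_mate Pe xe) !inE => /orP[] ->; rewrite ?orbT.
case/or3P => /eqP->; first exists [set x; mate P x]; last first.
- by exists [set x; mate Q x]; rewrite !inE mate_mem !eqxx !orbT.
- by exists [set x; mate P x]; rewrite !inE mate_mem !eqxx !orbT.
- by rewrite !inE mate_mem !eqxx.
Qed.

Lemma pm_actM P s s' : pm_act (pm_act P s) s' = pm_act P (s * s')%g.
Proof. exact/esym/(actM (pm_action n)). Qed.

Lemma pm_act1 P : pm_act P 1%g = P.
Proof. exact: (act1 (pm_action n)). Qed.

Lemma pm_actK s : cancel (@pm_act n ^~ s) (@pm_act n ^~ s^-1%g).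
Proof. by move=> P; rewrite pm_actM mulgV pm_act1. Qed.

Lemma pm_actKV s : cancel (@pm_act n ^~ s^-1%g) (@pm_act n ^~ s).
Proof. by move=> P; rewrite pm_actM mulVg pm_act1. Qed.

Lemma pm_act_inj s : injective (@pm_act n ^~ s).
Proof. exact: can_inj (pm_actK s). Qed.

Lemma act_tperm_mate P x : pm_act P (tperm x (mate P x)) = P.
Proof.
apply: eq_mate => y; rewrite mate_actE tpermV.
case: tpermP => [->|->|/eqP h1 /eqP h2].
- by rewrite mateK tpermL.
- by rewrite tpermR mateK.
- rewrite tpermD // eq_sym; last by rewrite (inj_eq (@mate_inj P)).
  by apply: contraNneq h2 => <-; rewrite mateK.
Qed.

Lemma relabelE (T : finType) (f : {ffun 'I_n -> T}) s x : relabel f s (s x) = f x.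
Proof. by rewrite ffunE permK. Qed.

Lemma relabelM (T : finType) (f : {ffun 'I_n -> T}) s s' :
  relabel (relabel f s) s' = relabel f (s * s')%g.
Proof. exact/esym/(actM (relabel_action n T)). Qed.

Lemma relabel1 (T : finType) (f : {ffun 'I_n -> T}) : relabel f 1%g = f.
Proof. exact: (act1 (relabel_action n T)). Qed.

End Mate.

(** * Sums of distinct natural numbers *)

(** Among [m.+1] distinct entries one is at least [m]. Induction applies once it is removed, and
    equality forces it to be [m]. This extremal property lets the weight recognize column
    rearrangements. *)
Lemma big_iota_le (s : seq nat) : uniq s ->
  (\sum_(i <- iota 0 (size s)) i <= \sum_(i <- s) i)%N
  /\ (\sum_(i <- s) i = \sum_(i <- iota 0 (size s)) i ->
      all (fun i => i < size s) s)%N.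
Proof.
elim: {s}(size s) {-2}s (erefl (size s)) => [|m IHm] s sz us.
  by rewrite (size0nil sz) !big_nil.
have /hasP[x xs mx] : has (fun i => m <= i)%N s.
  apply: contraT => /hasPn hs; have := @uniq_leq_size _ s (iota 0 m) us.
  rewrite size_iota sz ltnn => ->// i /hs.
  by rewrite mem_iota -ltnNge.
have szr : size (rem x s) = m by rewrite size_rem // sz.
have [le1 eq1] := IHm _ szr (rem_uniq x us); rewrite szr in le1 eq1.
rewrite sz (perm_big _ (perm_to_rem xs)) big_cons -addn1 iotaD big_cat /= big_seq1 add0n.
split=> [|eqs]; first by rewrite addnC leq_add.
have mE : x = m.
  by apply/eqP; rewrite eqn_leq mx andbT -(leq_add2r (\sum_(i <- iota 0 m) i)) [leqRHS]addnC -eqs leq_add2l.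
rewrite (perm_all _ (perm_to_rem xs)) /= addn1 {1}mE ltnSn /=.
have /allP lt1 : all (fun i => i < m)%N (rem x s).
  by apply: eq1; apply/eqP; rewrite -(eqn_add2l x) eqs addnC mE.
by apply/allP => i /lt1 /ltnW.
Qed.

Section InjOn.
Variables (T : finType) (A : {set T}) (f : T -> nat).
Hypothesis f_inj : {in A &, injective f}.

Let us : uniq [seq f x | x <- enum A].
Proof.
rewrite map_inj_in_uniq ?enum_uniq // => x y; rewrite !mem_enum; exact: f_inj.
Qed.

Let sz : size [seq f x | x <- enum A] = #|A|.
Proof. by rewrite size_map -cardE. Qed.

Let sumE : \sum_(i <- [seq f x | x <- enum A]) i = (\sum_(x in A) f x)%N.
Proof. by rewrite big_map big_enum. Qed.

Lemma sum_inj_ge : (\sum_(i <- iota 0 #|A|) i <= \sum_(x in A) f x)%N.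
Proof. by rewrite -sumE -sz; case: (big_iota_le us). Qed.

Lemma sum_inj_eq : (\sum_(x in A) f x = \sum_(i <- iota 0 #|A|) i)%N ->
  {in A, forall x, f x < #|A|}%N.
Proof.
rewrite -sumE -sz => /(proj2 (big_iota_le us))/allP h x xA.
by apply: h; apply: map_f; rewrite mem_enum.
Qed.

Hypothesis f_lt : {in A, forall x, f x < #|A|}%N.

Lemma perm_inj_lt : perm_eq [seq f x | x <- enum A] (iota 0 #|A|).
Proof.
apply: uniq_perm => //; first exact: iota_uniq.
have [] // := @uniq_min_size _ [seq f x | x <- enum A] (iota 0 #|A|).
  by move=> _ /mapP[x xA ->]; rewrite mem_iota /= f_lt // -mem_enum.
by rewrite sz size_iota.
Qed.

Lemma sum_inj_lt : (\sum_(x in A) f x = \sum_(i <- iota 0 #|A|) i)%N.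
Proof. by rewrite -sumE (perm_big _ perm_inj_lt). Qed.

Lemma onto_inj_lt i : (i < #|A|)%N -> exists2 x, x \in A & f x = i.
Proof.
move=> iA; have : i \in iota 0 #|A| by rewrite mem_iota.
rewrite -(perm_mem perm_inj_lt) => /mapP[x]; rewrite mem_enum => xA ->.
by exists x.
Qed.

End InjOn.

(** * Column antisymmetrization *)

Section Filling.
Variables (C : numClosedFieldType) (n : nat).
Local Notation filling := {ffun 'I_n -> 'I_n}.
Local Notation tableau := {ffun 'I_n -> 'I_n * 'I_n}.
Implicit Types (P Q : pmatching n) (s : 'S_n) (x y : 'I_n) (f : filling).
Implicit Types (t : tableau) (z : pmatching n -> C) (G : filling -> C).

Definition aligned f P := [forall x, f (mate P x) == f x].

Lemma alignedP f P : reflect (forall x, f (mate P x) = f x) (aligned f P).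
Proof. by apply: (iffP forallP) => h x; apply/eqP. Qed.

Lemma aligned_act f P s : aligned (relabel f s) (pm_act P s) = aligned f P.
Proof.
apply/alignedP/alignedP => h x.
  by have := h (s x); rewrite mate_act !relabelE.
by rewrite -(permKV s x) mate_act !relabelE.
Qed.

Definition rowsum z f : C := \sum_(P | aligned f P) z P.

Lemma rowsum_act z f s :
  rowsum z (relabel f s) = rowsum (fun P => z (pm_act P s)) f.
Proof.
rewrite /rowsum (reindex_inj (@pm_act_inj n s)) /=.
by apply: eq_bigl => P; rewrite aligned_act.
Qed.

Definition colstab t s := relabel (tableau_cols t) s == tableau_cols t.

Lemma colstabP t s : reflect (forall x, (t (s x)).2 = (t x).2) (colstab t s).
Proof.
apply: (iffP eqP) => [/ffunP h x|h]; last first.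
  by apply/ffunP => x; rewrite !ffunE -h permKV.
by have := h (s x); rewrite relabelE !ffunE.
Qed.

Lemma colstab1 t : colstab t 1.
Proof. by apply/colstabP => x; rewrite perm1. Qed.

Lemma colstabM t s s' : colstab t s -> colstab t s' -> colstab t (s * s')%g.
Proof. by move=> /colstabP h /colstabP h'; apply/colstabP => x; rewrite permM h' h. Qed.

Lemma colstabV t s : colstab t s -> colstab t s^-1%g.
Proof. by move=> /colstabP h; apply/colstabP => x; rewrite -[in RHS](permKV s x) h. Qed.

Lemma colstabMr t s s' : colstab t s' -> colstab t (s * s')%g = colstab t s.
Proof.
move=> h; apply/idP/idP => [h'|h']; last exact: colstabM.
by rewrite -(mulgK s' s) colstabM // colstabV.
Qed.

Lemma colstab_tperm t x y : (t x).2 = (t y).2 -> colstab t (tperm x y).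
Proof. by move=> h; apply/colstabP => u; case: tpermP => [->|->|]. Qed.

(** The linear extension of [G] from tabloids, evaluated at the polytabloid of [t]. *)
Definition pol G t : C :=
  \sum_(s | colstab t s) (-1) ^+ odd_perm s * G (relabel (tableau_rows t) s).

Lemma eq_pol G G' t : G =1 G' -> pol G t = pol G' t.
Proof. by move=> h; apply: eq_bigr => s _; rewrite h. Qed.

Lemma pol_act G t s : colstab t s ->
  pol (fun f => G (relabel f s)) t = (-1) ^+ odd_perm s * pol G t.
Proof.
move=> ts; rewrite /pol mulr_sumr [RHS](reindex_inj (mulIg s)) /=.
apply: eq_big => [s'|s' _]; first by rewrite colstabMr.
by rewrite mulrA -signr_addb odd_permM addbC -addbA addbb addbF relabelM.
Qed.

Lemma rows_relabel t s : tableau_rows (relabel t s) = relabel (tableau_rows t) s.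
Proof. by apply/ffunP => x; rewrite !ffunE. Qed.

Lemma cols_relabel t s : tableau_cols (relabel t s) = relabel (tableau_cols t) s.
Proof. by apply/ffunP => x; rewrite !ffunE. Qed.

Lemma colstab_relabel t s s' : colstab (relabel t s) (s' ^ s)%g = colstab t s'.
Proof.
rewrite /colstab cols_relabel !relabelM -conjgC -relabelM.
by rewrite (inj_eq (act_inj (relabel_action n _) s)).
Qed.

Lemma pol_relabel G t s : pol G (relabel t s) = pol (fun f => G (relabel f s)) t.
Proof.
rewrite /pol (reindex_inj (conjg_inj s)) /=.
apply: eq_big => [s'|s' _]; first by rewrite colstab_relabel.
by rewrite odd_permJ rows_relabel !relabelM -conjgC.
Qed.

Definition xt t P : C := pol (fun f => (aligned f P)%:R) t.

Lemma xt_relabel t s P : xt (relabel t s) P = xt t (pm_act P s^-1).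
Proof.
rewrite /xt pol_relabel; apply: eq_pol => f.
by rewrite -{1}(pm_actKV s P) aligned_act.
Qed.

Definition antisym t z :=
  forall s P, colstab t s -> z (pm_act P s) = (-1) ^+ odd_perm s * z P.

Lemma xt_antisym t : antisym t (xt t).
Proof.
move=> s P ts; rewrite /xt -odd_permV -pol_act ?colstabV //; apply: eq_pol => f.
by rewrite -{2}(pm_actK s P) aligned_act.
Qed.

(** The form is bilinear; positivity is available for real functions, such as the [xt]
    ([conj_xt]). *)
Definition dot z z' : C := \sum_P z P * z' P.

Lemma dotC z z' : dot z z' = dot z' z.
Proof. by apply: eq_bigr => P _; rewrite mulrC. Qed.

(** [rowsum] is adjoint to the map sending a filling to the indicator of its aligned matchings.
    Orthogonality to [xt] thus becomes a statement about [rowsum z]. *)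
Lemma dot_xt z t : dot z (xt t) = pol (rowsum z) t.
Proof.
rewrite /dot /xt /pol; under eq_bigr do rewrite mulr_sumr.
rewrite exchange_big /=; apply: eq_bigr => s _.
rewrite /rowsum mulr_sumr [RHS]big_mkcond /=; apply: eq_bigr => P _.
by case: aligned; rewrite ?mulr1 ?mulr0 // mulrC.
Qed.

Lemma conj_xt t P : (xt t P)^* = xt t P.
Proof.
rewrite /xt /pol rmorph_sum; apply: eq_bigr => s _.
by rewrite rmorphM rmorph_sign rmorph_nat.
Qed.

Definition antisymG t G :=
  forall s f, colstab t s -> G (relabel f s) = (-1) ^+ odd_perm s * G f.

Lemma antisym_rowsum t z : antisym t z -> antisymG t (rowsum z).
Proof.
move=> az s f ts; rewrite rowsum_act /rowsum mulr_sumr.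
by apply: eq_bigr => P _; rewrite az.
Qed.

(** The transposition of [x] and [y] fixes [f] but reverses the sign. *)
Lemma antisym_eq0 t G f x y : antisymG t G -> x != y -> (t x).2 = (t y).2 ->
  f x = f y -> G f = 0.
Proof.
move=> aG nxy txy fxy; have := aG (tperm x y) f (colstab_tperm txy).
rewrite odd_tperm nxy expr1 mulN1r.
have -> : relabel f (tperm x y) = f.
  by apply/ffunP => u; rewrite ffunE tpermV; case: tpermP => [->|->|].
by move/esym/eqP; rewrite eqNr => /eqP.
Qed.

Definition wt f := (\sum_x f x)%N.

Lemma wt_relabel f s : wt (relabel f s) = wt f.
Proof.
rewrite /wt (reindex_inj (@perm_inj _ s)) /=.
by apply: eq_bigr => x _; rewrite relabelE.
Qed.

End Filling.

Lemma sorted_geq_nth (mu : seq nat) i j :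
  sorted geq mu -> (i <= j)%N -> (nth 0 mu j <= nth 0 mu i)%N.
Proof.
move=> smu ij; have [szj|szj] := leqP (size mu) j; first by rewrite nth_default.
apply: (sorted_leq_nth _ _ 0%N smu) => //.
- by move=> y x z /= h1 h2; apply: leq_trans h2 h1.
- by move=> x /=.
- by rewrite inE (leq_ltn_trans ij).
Qed.

Lemma sum_nth_le (mu : seq nat) m : (\sum_(0 <= i < m) nth 0 mu i <= sumn mu)%N.
Proof.
rewrite sumnE; elim: mu m => [|a mu IH] m.
  by rewrite big1_seq // => i _; rewrite nth_nil.
case: m => [|m]; first by rewrite big_geq.
by rewrite big_nat_recl // big_cons leq_add2l.
Qed.

(** * Tableaux and column rearrangements *)

Section TableauTheory.
Variables (n : nat).
Local Notation filling := {ffun 'I_n -> 'I_n}.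
Local Notation tableau := {ffun 'I_n -> 'I_n * 'I_n}.
Implicit Types (s : 'S_n) (x y : 'I_n) (f : filling) (t : tableau).

Definition is_partition (mu : seq nat) := sorted geq mu && (sumn mu == n).

Variables (mu : seq nat) (t : tableau).
Hypotheses (mu_part : is_partition mu) (t_tab : is_tableau mu t).

Lemma tab_inj : injective t.
Proof. by case/andP: t_tab => /injectiveP. Qed.

Lemma tab_lt x : ((t x).2 < nth 0 mu (t x).1)%N.
Proof. by case/andP: t_tab => _ /forallP. Qed.

Lemma part_nth i j : (i <= j)%N -> (nth 0 mu j <= nth 0 mu i)%N.
Proof. by case/andP: mu_part => smu _; apply: sorted_geq_nth. Qed.

Lemma part_sum m : (\sum_(0 <= i < m) nth 0 mu i <= n)%N.
Proof. by case/andP: mu_part => _ /eqP e; rewrite -[leqRHS]e sum_nth_le. Qed.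

Lemma part_nth_le i : (nth 0 mu i <= n)%N.
Proof.
apply: leq_trans (part_sum i.+1); rewrite big_nat_recr //=; exact: leq_addl.
Qed.

Lemma part_size i : (0 < nth 0 mu i)%N -> (i < n)%N.
Proof.
move=> mui; apply: leq_trans (part_sum i.+1).
apply: (@leq_trans (\sum_(0 <= j < i.+1) 1)%N).
  by rewrite sum_nat_const_nat subn0 muln1.
rewrite big_nat [leqRHS]big_nat; apply: leq_sum => j /andP[_ ji].
by apply: leq_trans mui _; apply: part_nth.
Qed.

(** [t] maps [n] entries injectively into a diagram with at most [n] cells, so every cell is hit. *)
Lemma tab_onto (i j : nat) : (j < nth 0 mu i)%N ->
  exists x, (t x).1 = i :> nat /\ (t x).2 = j :> nat.
Proof.
move=> jmu.
have i_lt : (i < n)%N by apply: part_size; apply: leq_ltn_trans jmu.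
have j_lt : (j < n)%N by apply: leq_trans jmu (part_nth_le i).
pose D := [set p : 'I_n * 'I_n | (p.2 < nth 0 mu p.1)%N].
have cardD : (#|D| <= n)%N.
  apply: leq_trans (part_sum n); rewrite big_mkord.
  rewrite -sum1dep_card -(pair_big_dep xpredT (fun i j : 'I_n => (j < nth 0 mu i)%N) (fun _ _ => 1%N)) /=.
  apply: leq_sum => a _; rewrite sum1dep_card.
  rewrite cardE -(size_map val) -[leqRHS](size_iota 0).
  apply: uniq_leq_size; first by rewrite (map_inj_uniq val_inj) enum_uniq.
  by move=> c /mapP[b]; rewrite mem_enum inE => lb ->; rewrite mem_iota.
have imD : [set t x | x : 'I_n] = D.
  apply/eqP; rewrite eqEcard; apply/andP; split.
    by apply/subsetP => _ /imsetP[x _ ->]; rewrite inE tab_lt.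
  by rewrite card_imset ?card_ord //; apply: tab_inj.
have : (Ordinal i_lt, Ordinal j_lt) \in D by rewrite inE.
by rewrite -imD => /imsetP[x _ tx]; exists x; rewrite -tx.
Qed.

Definition column (c : 'I_n) := [set x | (t x).2 == c].

Lemma tab_row_inj (c : 'I_n) : {in column c &, injective (fun x => (t x).1 : nat)}.
Proof.
move=> x y; rewrite !inE => /eqP xc /eqP yc /val_inj e; apply: tab_inj.
by rewrite [t x]surjective_pairing [t y]surjective_pairing e xc yc.
Qed.

Lemma tab_row_up x i : (i <= (t x).1)%N ->
  exists2 y, (t y).2 = (t x).2 & (t y).1 = i :> nat.
Proof.
move=> ix; have /tab_onto[y [y1 y2]] : ((t x).2 < nth 0 mu i)%N.
  by apply: leq_trans (tab_lt x) (part_nth ix).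
by exists y => //; apply: val_inj.
Qed.

Lemma tab_row_lt (c : 'I_n) : {in column c, forall x, (t x).1 < #|column c|}%N.
Proof.
move=> x; rewrite inE => /eqP xc.
rewrite -[leqLHS](size_iota 0) cardE -(size_map (fun y => (t y).1 : nat)).
apply: uniq_leq_size (iota_uniq _ _) _ => i.
rewrite mem_iota /= add0n ltnS => /tab_row_up[y ycx yi].
by apply/mapP; exists y => //; rewrite mem_enum inE ycx xc.
Qed.

Lemma wt_column f : wt f = (\sum_(c < n) \sum_(x in column c) f x)%N.
Proof.
rewrite /wt (partition_big (fun x => (t x).2) xpredT) //=.
by apply: eq_bigr => c _; apply: eq_bigl => x; rewrite inE.
Qed.

Lemma wt_rows : wt (tableau_rows t) =
  (\sum_(c < n) \sum_(i <- iota 0 #|column c|) i)%N.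
Proof.
rewrite wt_column; apply: eq_bigr => c _.
under eq_bigr do rewrite ffunE.
exact/sum_inj_lt/tab_row_lt/tab_row_inj.
Qed.

(** Distinct entries of a column weigh at least [0 + 1 + ...], and [t] attains this bound in all
    columns at once. The weight hypothesis is therefore an equality in each column, so each column
    of [f] contains the same rows as in [t], once each. *)
Lemma column_rearrange f : (wt f <= wt (tableau_rows t))%N ->
  (forall x y, (t x).2 = (t y).2 -> f x = f y -> x = y) ->
  exists2 s, colstab t s & f = relabel (tableau_rows t) s.
Proof.
move=> wf finj.
have finjc c : {in column c &, injective (fun x => f x : nat)}.
  by move=> x y; rewrite !inE => /eqP xc /eqP yc /val_inj; apply: finj; rewrite xc yc.
have le_c c := sum_inj_ge (finjc c).
have eq_c c : (\sum_(x in column c) f x = \sum_(i <- iota 0 #|column c|) i)%N.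
  apply/eqP; rewrite eqn_leq le_c andbT; move: wf; rewrite wt_rows wt_column.
  rewrite (bigD1 c) //= [leqRHS](bigD1 c) //= => wf.
  rewrite -(leq_add2r (\sum_(i < n | i != c) \sum_(x in column i) f x)%N).
  by apply: leq_trans wf _; rewrite leq_add2l leq_sum.
have f_lt c := sum_inj_eq (finjc c) (eq_c c).
have ex x : exists y, ((t y).2 == (t x).2) && (f y == (t x).1).
  have [|y] := onto_inj_lt (finjc (t x).2) (f_lt (t x).2) (i := (t x).1).
    by apply: tab_row_lt; rewrite inE.
  by rewrite inE => yx /val_inj fy; exists y; rewrite yx fy eqxx.
pose h x := xchoose (ex x).
have hP x : (t (h x)).2 = (t x).2 /\ f (h x) = (t x).1.
  by have /andP[/eqP ? /eqP] := xchooseP (ex x).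
have h_inj : injective h.
  move=> x y e; apply: tab_inj.
  rewrite [t x]surjective_pairing [t y]surjective_pairing.
  by have [<- <-] := hP x; have [<- <-] := hP y; rewrite e.
exists (perm h_inj); first by apply/colstabP => x; rewrite permE; case: (hP x).
apply/ffunP => x; rewrite -(permKV (perm h_inj) x) relabelE permE ffunE.
by case: (hP ((perm h_inj)^-1%g x)).
Qed.

End TableauTheory.

Section James.
Variables (C : numClosedFieldType) (n : nat).
Local Notation filling := {ffun 'I_n -> 'I_n}.
Local Notation tableau := {ffun 'I_n -> 'I_n * 'I_n}.
Implicit Types (s : 'S_n) (x y : 'I_n) (f : filling) (t : tableau) (G : filling -> C).

(** Coordinate of the polytabloid of [t] at the tabloid [f]; see [polytabloidE]. *)
Definition tabcoef t f : C := pol (fun f' => (f' == f)%:R) t.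

Lemma tabcoef_rearrange mu t s : is_tableau mu t -> colstab t s ->
  tabcoef t (relabel (tableau_rows t) s) = (-1) ^+ odd_perm s.
Proof.
move=> tt ts; rewrite /tabcoef /pol (bigD1 s) //= eqxx mulr1 big1 ?addr0 // => s'.
case/andP => ts' ns; case: eqP; rewrite ?mulr0 // => e; case/eqP: ns.
apply/permP => x; have [y ->] : exists y, x = s^-1%g y by exists (s x); rewrite permK.
rewrite permKV; apply: (@perm_inj _ s'^-1%g).
rewrite permK; apply: (tab_inj tt).
have /ffunP/(_ y) := e; rewrite !ffunE => e1.
have /colstabP e2 := colstabV ts; have /colstabP e3 := colstabV ts'.
by rewrite [t _]surjective_pairing [RHS]surjective_pairing e1 e2 e3.
Qed.

Lemma tabcoef_eq0 t f : (forall s, colstab t s -> f <> relabel (tableau_rows t) s) ->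
  tabcoef t f = 0.
Proof.
move=> h; rewrite /tabcoef /pol big1 // => s ts.
by case: eqP => [e|_]; [case: (h s ts)|rewrite mulr0].
Qed.

(* The key step of James's submodule theorem. *)
Lemma antisymG_tabcoef mu t G f : is_partition n mu -> is_tableau mu t ->
  antisymG t G -> (wt f <= wt (tableau_rows t))%N ->
  G f = G (tableau_rows t) * tabcoef t f.
Proof.
move=> pmu tt aG wf.
have [/forallP finj|] := boolP [forall x, forall y, ((t x).2 == (t y).2) && (f x == f y) ==> (x == y)].
  have [x y txy fxy|s ts fE] := column_rearrange pmu tt wf.
    by have /forallP/(_ y)/implyP := finj x; rewrite txy fxy !eqxx => /(_ isT)/eqP.
  by rewrite fE aG // (tabcoef_rearrange tt ts) mulrC.
rewrite negb_forall => /existsP[x]; rewrite negb_forall => /existsP[y].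
rewrite negb_imply => /andP[/andP[/eqP txy /eqP fxy] nxy].
rewrite (antisym_eq0 aG nxy txy fxy) tabcoef_eq0 ?mulr0 // => s ts fE.
have /colstabP e2 := colstabV ts; case/eqP: nxy; apply: (@perm_inj _ s^-1%g).
apply: (tab_inj tt); rewrite [t _]surjective_pairing [RHS]surjective_pairing.
by rewrite !e2 txy; move: fxy; rewrite fE !ffunE => ->.
Qed.

Definition rowcount f (i : 'I_n) := #|[set x | f x == i]|.

Lemma rowcount_relabel f s i : rowcount (relabel f s) i = rowcount f i.
Proof.
rewrite /rowcount -(card_imset [set x | f x == i] (@perm_inj _ s)); apply: eq_card => x.
rewrite !inE; apply/idP/imsetP => [fx|[y yf ->]]; last by rewrite relabelE; rewrite inE in yf.
by exists (s^-1%g x); rewrite ?permKV // inE -(relabelE f s) permKV.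
Qed.

Lemma rowcount_tab mu t i : is_partition n mu -> is_tableau mu t ->
  rowcount (tableau_rows t) i = nth 0%N mu i.
Proof.
move=> pmu tt; rewrite /rowcount cardE -(size_map (fun x => (t x).2 : nat)).
rewrite -[RHS](size_iota 0); apply: perm_size; apply: uniq_perm (iota_uniq _ _) _.
  rewrite map_inj_in_uniq ?enum_uniq // => x y; rewrite !mem_enum !inE !ffunE.
  move=> /eqP xi /eqP yi /val_inj e; apply: (tab_inj tt).
  by rewrite [t x]surjective_pairing [RHS]surjective_pairing xi yi e.
move=> j; rewrite mem_iota /= add0n; apply/mapP/idP => [[x]|].
  by rewrite mem_enum inE ffunE => /eqP <- ->; apply: tab_lt.
case/(tab_onto pmu tt) => x [x1 x2]; exists x => //.
by rewrite mem_enum inE ffunE; apply/eqP/val_inj.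
Qed.

Lemma part_eq mu la : is_partition n mu -> is_partition n la ->
  all (leq 1) mu -> all (leq 1) la ->
  (forall i : 'I_n, nth 0%N mu i = nth 0%N la i) -> mu = la.
Proof.
move=> pmu pla mu0 la0 e.
have sub nu rho : is_partition n nu -> is_partition n rho ->
    (forall i : 'I_n, nth 0%N nu i = nth 0%N rho i) -> all (leq 1) nu ->
    (size nu <= size rho)%N.
  move=> pnu prho enr nu0; rewrite leqNgt; apply/negP => lt.
  have pos : (0 < nth 0%N nu (size rho))%N by apply: (allP nu0); apply: mem_nth.
  by have := enr (Ordinal (part_size pnu pos)); rewrite /= [RHS]nth_default // => h;
    rewrite h in pos.
have sz : size mu = size la by apply/eqP; rewrite eqn_leq !sub.
apply: (eq_from_nth sz) => i imu.
have pos : (0 < nth 0%N mu i)%N by apply: (allP mu0); apply: mem_nth.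
exact: e (Ordinal (part_size pmu pos)).
Qed.

End James.

(** * Completeness *)

Section HighestWeight.
Variables (C : numClosedFieldType) (n : nat) (z : pmatching n -> C).
Local Notation filling := {ffun 'I_n -> 'I_n}.
Local Notation tableau := {ffun 'I_n -> 'I_n * 'I_n}.
Implicit Types (P : pmatching n) (s : 'S_n) (x y a b : 'I_n) (f g : filling).
Local Notation G := (rowsum z).

Definition upd f a j : filling := [ffun x => if x == a then j else f x].

Lemma aligned_upd f a j P : aligned (upd f a j) P =
  (f (mate P a) == j) && [forall x, (x != a) && (x != mate P a) ==> (f (mate P x) == f x)].
Proof.
apply/alignedP/andP => [h|[/eqP ha /forallP h] x].
  split; first by have := h a; rewrite !ffunE eqxx (negPf (mate_neq P a)) => ->.
  apply/forallP => x; apply/implyP => /andP[xa xma]; have := h x.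
  rewrite !ffunE (negPf xa); case: eqP => [e|_ ->//].
  by case/eqP: xma; rewrite -e mateK.
rewrite !ffunE; case: eqP => [e|/eqP e]; case: eqP => [e'|/eqP e'].
- by have := mate_neq P x; rewrite e e' eqxx.
- by rewrite -ha -e mateK.
- by rewrite e' ha.
- apply/eqP; have := h x; rewrite e' /=; case: eqP => //= xma.
  by case/eqP: e; rewrite xma mateK.
Qed.

(** For a fixed [P], both sides count the edges with end values [i] and [j] when all other edges are
    aligned: either end can be corrected, and [mate P] exchanges the two ends. *)
Lemma row_exchange f (i j : 'I_n) : i != j ->
  \sum_(a | f a == i) G (upd f a j) = \sum_(b | f b == j) G (upd f b i).
Proof.
move=> nij.
have rE k l : \sum_(a | f a == k) G (upd f a l)
    = \sum_P z P * \sum_a ((f a == k) && aligned (upd f a l) P)%:R.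
  under [RHS]eq_bigr do rewrite mulr_sumr.
  rewrite exchange_big big_mkcond; apply: eq_bigr => a _.
  case: eqP => _ /=; last by rewrite big1 // => P _; rewrite mulr0.
  by rewrite /rowsum big_mkcond; apply: eq_bigr => P _; case: aligned; rewrite ?mulr1 ?mulr0.
rewrite !rE; apply: eq_bigr => P _; congr (_ * _).
rewrite (reindex_inj (@mate_inj n P)); apply: eq_bigr => a _; congr (_%:R).
rewrite !aligned_upd mateK; do 2!case: eqP => //= _; congr (nat_of_bool _).
by apply: eq_forallb => x; rewrite andbC.
Qed.

Lemma wt_upd f a j : (wt (upd f a j) + f a = wt f + j)%N.
Proof.
rewrite /wt (bigD1 a) //= [in RHS](bigD1 a) //= ffunE eqxx.
rewrite (eq_bigr (fun x => f x : nat)) => [|x xa]; last by rewrite ffunE (negPf xa).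
lia.
Qed.

Variable w : nat.
Hypothesis minG : forall f, (wt f < w)%N -> G f = 0.

(** Apply [row_exchange] to [f] with [b] moved up to row [i]. The term [a = b] restores [f], the
    other terms on that side swap [b] with an entry of row [i], and the opposite side involves only
    fillings of smaller weight, where [G] vanishes. So [G] behaves like a vector annihilated by the
    raising operators. *)
Lemma highest_weight f b (i : 'I_n) : wt f = w -> (i < f b)%N ->
  \sum_(a | f a == i) G (relabel f (tperm a b)) = - G f.
Proof.
move=> wf ib; pose f' := upd f b i.
have nib : i != f b by apply: contraTneq ib => ->; rewrite ltnn.
have := @row_exchange f' i (f b) nib; rewrite (bigD1 b) /=; last by rewrite ffunE eqxx.
have -> : upd f' b (f b) = f by apply/ffunP => x; rewrite !ffunE; case: eqP => [->|].
rewrite [RHS]big1 => [|b']; last first.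
  rewrite ffunE; case: (b' =P b) => [_ /eqP e|nb' /eqP fb']; first by rewrite e eqxx in nib.
  apply: minG; have := wt_upd f b i; have := wt_upd f' b' i.
  rewrite -/f' [f' b']ffunE; case: (b' =P b) => // _; rewrite fb' -wf; lia.
move/eqP; rewrite addr_eq0 => /eqP ->; rewrite opprK; apply: eq_big => a.
  rewrite ffunE; case: (a =P b) => [->|_]; last by rewrite andbT.
  by rewrite eqxx eq_sym (negPf nib).
move=> fa; have nab : a != b by apply: contraNneq nib => <-; rewrite eq_sym.
congr (G _); apply/ffunP => x; rewrite !ffunE tpermV.
case: tpermP => [->|->|/eqP xa /eqP xb]; first by rewrite eqxx.
  by rewrite eq_sym (negPf nab) eqxx (eqP fa).
by rewrite (negPf xa) (negPf xb).
Qed.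

Implicit Type kap : 'I_n -> nat + 'I_n.

Definition kstab kap s := [forall x, kap (s x) == kap x].

Lemma kstabP kap s : reflect (forall x, kap (s x) = kap x) (kstab kap s).
Proof. by apply: (iffP forallP) => h x; apply/eqP. Qed.

(** Interpolates between [rowsum z], when all entries have different colours, and
    [pol (rowsum z) t], when colours are the columns of [t]. The tableau can thus be grown one cell
    at a time. *)
Definition kpol kap f : C := \sum_(s | kstab kap s) (-1) ^+ odd_perm s * G (relabel f s).

Lemma highest_weight_kpol kap f b (i : 'I_n) : wt f = w -> (i < f b)%N ->
  \sum_(a | f a == i) kpol kap (relabel f (tperm a b)) = - kpol kap f.
Proof.
move=> wf ib; rewrite /kpol exchange_big /= -sumrN; apply: eq_bigr => s _.
rewrite -mulr_sumr -mulrN; congr (_ * _).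
rewrite -(@highest_weight _ (s b) i) ?wt_relabel ?relabelE //.
rewrite [RHS](reindex_inj (@perm_inj _ s)) /=; apply: eq_big => a.
  by rewrite relabelE.
by move=> _; rewrite !relabelM -tpermJ conjgE !mulgA mulgV mul1g.
Qed.

Lemma kpol_eq0 kap f x y : x != y -> kap x = kap y -> f x = f y -> kpol kap f = 0.
Proof.
move=> nxy kxy fxy; apply/eqP; rewrite -eqNr; apply/eqP.
rewrite {2}/kpol (reindex_inj (mulgI (tperm x y))) /= -sumrN.
apply: eq_big => s.
  have tk u : kap (tperm x y u) = kap u by case: tpermP => [->|->|].
  apply/kstabP/kstabP => h u; first by rewrite permM h tk.
  by have := h (tperm x y u); rewrite permM tpermK tk.
move=> _; rewrite odd_permM odd_tperm nxy signr_addb expr1 mulN1r mulNr -relabelM.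
congr (- (_ * G (relabel _ _))); apply/ffunP => u; rewrite ffunE tpermV.
by case: tpermP => [->|->|].
Qed.

Definition recolor kap a (m : nat) : 'I_n -> nat + 'I_n :=
  fun x => if x == a then inl m else kap x.

(** Coset decomposition: when the singleton [a] joins class [m], the new stabilizer has coset
    representatives over the old one given by [1] and the transpositions of [a] with the members of
    the class. *)
Lemma kpol_recolor kap a m f : (forall x, kap x = kap a -> x = a) -> kap a != inl m ->
  kpol (recolor kap a m) f =
  kpol kap f - \sum_(x | kap x == inl m) kpol kap (relabel f (tperm a x)).
Proof.
move=> single nam.
have stab_a s : kstab (recolor kap a m) s && (s^-1%g a == a) = kstab kap s.
  apply/andP/kstabP => [[/kstabP h /eqP sa] x|h].
    have sa' : s a = a by rewrite -{1}sa permKV.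
    have [->|xa] := eqVneq x a; first by rewrite sa'.
    have := h x; rewrite /recolor (negPf xa); case: eqP => // e.
    by case/eqP: xa; apply: (@perm_inj _ s); rewrite e sa'.
  have sa : s a = a by apply: single; rewrite h.
  split; last by rewrite -{1}sa permK.
  apply/kstabP => x; rewrite /recolor h; case: eqP => [e|ne]; case: eqP => // e'.
    by case: e'; apply: (@perm_inj _ s); rewrite e sa.
  by case: ne; rewrite e' sa.
have caE : kpol (recolor kap a m) f =
    \sum_x \sum_(s | kstab (recolor kap a m) s && (s^-1%g a == x))
      (-1) ^+ odd_perm s * G (relabel f s).
  exact: partition_big.
rewrite caE (bigD1 a) //=; congr (_ + _).
  by apply: eq_bigl => s; rewrite stab_a.
rewrite -sumrN (bigID (fun x => kap x == inl m)) /= addrC big1 ?add0r.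
  apply: eq_big => [x|x /andP[nxa kx]].
    by case: (x =P a) => [->|]; rewrite ?andbT // (negPf nam).
  rewrite -sumrN (reindex_inj (mulgI (tperm a x))) /=; apply: eq_big => s.
    rewrite -stab_a; congr (_ && _).
      have tk u : recolor kap a m (tperm a x u) = recolor kap a m u.
        by rewrite /recolor; case: tpermP => [->|->|//]; rewrite eqxx (negPf nxa) (eqP kx).
      apply/kstabP/kstabP => h u; last by rewrite permM h tk.
      by have := h (tperm a x u); rewrite permM tpermK tk.
    by rewrite invMg tpermV permM -[X in _ == X](tpermL a x) (inj_eq perm_inj).
  by move=> _; rewrite odd_permM odd_tperm eq_sym nxa signr_addb expr1 mulN1r mulNr relabelM.
move=> x /andP[nxa kx]; rewrite big1 // => s /andP[/kstabP h /eqP sx].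
have := h x; rewrite -sx permKV /recolor eqxx sx (negPf nxa) => /esym/eqP.
by rewrite (negPf kx).
Qed.

(** Sum [kpol_recolor] over the free entries of row [r]. The swaps of [x] with all entries of that
    row add up to [- kpol kap f]; swaps with an entry already placed elsewhere vanish, because they
    repeat a value in its column. The two minus signs cancel, so the coefficient is a sum of
    cardinalities and cannot vanish by cancellation. *)
Lemma sum_kpol_recolor kap m f (r : 'I_n) : wt f = w ->
  (forall x y, kap x = inr y -> y = x) ->
  (forall x, kap x = inl m -> r < f x)%N ->
  (forall a x (j : nat), kap a = inl j -> j != m -> f a = r -> kap x = inl m ->
     exists2 y, kap y = inl j & f y = f x) ->
  \sum_(a | (kap a == inr a) && (f a == r)) kpol (recolor kap a m) f
  = (#|[set a | (kap a == inr a) && (f a == r)]| + #|[set x | kap x == inl m]|)%:R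
    * kpol kap f.
Proof.
move=> wf k1 k2 k3.
rewrite (eq_bigr (fun a => kpol kap f
    - \sum_(x | kap x == inl m) kpol kap (relabel f (tperm a x)))); last first.
  by move=> a /andP[/eqP ka _]; rewrite kpol_recolor ?ka // => x /k1.
rewrite sumrB sumr_const exchange_big /= natrD mulrDl; congr (_ + _).
  by rewrite mulr_natl; congr (_ *+ _); apply: eq_card => a; rewrite inE.
rewrite mulr_natl -sumr_const -sumrN; apply: eq_big => [x|x /eqP kx]; first by rewrite inE.
have := @highest_weight_kpol kap f x r wf (k2 x kx).
rewrite (bigID (fun a => kap a == inr a)) /= addrC big1 ?add0r.
  move=> e; rewrite -[RHS]opprK -e; congr (- _).
  by apply: eq_bigl => a; rewrite andbC.
move=> a /andP[/eqP fa na]; case ka: (kap a) na => [j|y]; last first.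
  by rewrite (k1 _ _ ka) eqxx.
move=> _; have njm : j != m.
  by apply: contraTneq (erefl true) => jm; have := k2 a; rewrite ka jm fa ltnn => /(_ erefl).
have [y ky fy] := k3 a x j ka njm fa kx.
have nya : y != a.
  by apply: contraTneq (k2 x kx) => ya; rewrite -fy ya fa ltnn.
have nyx : y != x.
  by apply: contraNneq njm => yx; move: ky; rewrite yx kx => -[->].
apply: (@kpol_eq0 _ _ a y); rewrite 1?eq_sym // ?ka ?ky //.
rewrite !ffunE !tpermV tpermL tpermD ?fy //; by rewrite eq_sym.
Qed.

(* Colour [inl j] means "placed in column j", [inr x] "not yet placed".  The
   columns before [m] are complete and column [m] occupies the rows [r..l-1]. *)
Record partial_columns kap f (m r l : nat) : Prop := PartialColumns {
  pc_single : forall x y, kap x = inr y -> y = x;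
  pc_le : forall x j, kap x = inl j -> (j <= m)%N;
  pc_inj : forall x y, kap x = kap y -> f x = f y -> x = y;
  pc_left : forall x j j', kap x = inl j -> (j' < j)%N ->
    exists2 y, kap y = inl j' & f y = f x;
  pc_free : forall x j, kap x = inr x -> (j < m)%N ->
    exists2 y, kap y = inl j & f y = f x;
  pc_kpol : kpol kap f != 0;
  pc_cur : forall x, kap x = inl m -> (r <= f x < l)%N;
  pc_full : forall i : 'I_n, (r <= i < l)%N -> exists2 y, kap y = inl m & f y = i;
  pc_bound : forall x, kap x = inr x -> (f x < l)%N;
  pc_up : forall x j (i : 'I_n), kap x = inl j -> (j < m)%N -> (i < f x)%N ->
    exists2 y, kap y = inl j & f y = i }.

Lemma pc_add kap f m r l a : partial_columns kap f m r.+1 l ->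
  kap a = inr a -> f a = r :> nat -> (r < l)%N ->
  kpol (recolor kap a m) f != 0 ->
  partial_columns (recolor kap a m) f m r l.
Proof.
case=> h1 h2 h3 h4 h5 h6 h7 h8 h9 h10 ka fa rl nz.
have old y j : kap y = inl j -> recolor kap a m y = inl j.
  by move=> ky; rewrite /recolor; case: eqP => // e; move: ky; rewrite e ka.
have lt_cur x : kap x = inl m -> (r < f x)%N by case/h7/andP.
split=> //.
- by move=> x y; rewrite /recolor; case: eqP => // _; apply: h1.
- by move=> x j; rewrite /recolor; case: eqP => [_ [<-]//|_]; apply: h2.
- move=> x y; rewrite /recolor; case: eqP => [->|_]; case: eqP => [->|_] //.
  + by move=> /esym/lt_cur lt e; move: lt; rewrite -e fa ltnn.
  + by move=> /lt_cur lt e; move: lt; rewrite e fa ltnn.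
  + exact: h3.
- move=> x j j' kx jj'; have [y ky fy] : exists2 y, kap y = inl j' & f y = f x.
    move: kx; rewrite /recolor; case: eqP => [-> [e]|_ kx]; last exact: h4 kx jj'.
    by apply: h5 => //; rewrite e.
  by exists y => //; apply: old.
- move=> x j; rewrite /recolor; case: eqP => // nxa kx jm.
  by have [y ky fy] := h5 x j kx jm; exists y => //; apply: old.
- move=> x; rewrite /recolor; case: eqP => [-> _|_ /h7/andP[/ltnW-> ->]//].
  by rewrite fa leqnn.
- move=> i /andP[]; rewrite leq_eqVlt => /orP[/eqP e il|ri il].
    by exists a; rewrite /recolor ?eqxx //; apply: val_inj; rewrite /= fa.
  have [|y ky fy] := h8 i; first by rewrite ri.
  by exists y => //; apply: old.
- by move=> x; rewrite /recolor; case: eqP => // _; apply: h9.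
- move=> x j i kx jm ix; have [y ky fy] : exists2 y, kap y = inl j & f y = i.
    move: kx; rewrite /recolor; case: eqP => [_ [e]|_ kx]; first by rewrite e ltnn in jm.
    exact: h10 kx jm ix.
  by exists y => //; apply: old.
Qed.

Definition unplaced kap := [set x | kap x == inr x].

Lemma unplaced_recolor kap a m : kap a = inr a ->
  (#|unplaced (recolor kap a m)| < #|unplaced kap|)%N.
Proof.
move=> ka; apply/proper_card/properP; split.
  by apply/subsetP => x; rewrite !inE /recolor; case: (x =P a) => // ->.
exists a; first by rewrite inE ka.
  by rewrite inE /recolor eqxx.
Qed.

(** The column starts at a free entry of largest row index. Class [m] is still empty, so recolouring
    leaves [kpol] unchanged. *)
Lemma pc_start kap f m : partial_columns kap f m n n ->
  unplaced kap != set0 ->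
  exists kap' (r : 'I_n), partial_columns kap' f m r r.+1
    /\ (#|unplaced kap'| < #|unplaced kap|)%N.
Proof.
move=> pc /set0Pn[b0]; rewrite inE => kb0.
case: (@arg_maxnP _ b0 (fun b => kap b == inr b) (fun b => f b : nat) kb0) => b /eqP kb bmax.
have pc' : partial_columns kap f m (f b).+1 (f b).+1.
  case: pc => h1 h2 h3 h4 h5 h6 h7 h8 h9 h10; split=> //.
  - by move=> x /h7; rewrite [X in _ && X]ltnNge andbN.
  - by move=> i; rewrite [X in _ && X]ltnNge andbN.
  - by move=> x /eqP/bmax; rewrite ltnS.
exists (recolor kap b m), (f b); split; last exact: unplaced_recolor.
apply: pc_add => //; rewrite kpol_recolor ?kb //; last first.
  by move=> x kx; rewrite (pc_single pc kx).
rewrite big1 ?subr0; first exact: pc_kpol pc.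
by move=> x /eqP/(pc_cur pc); rewrite [X in _ && X]ltnNge andbN.
Qed.

(** Column [m] has a cell already, so the coefficient in [sum_kpol_recolor] is positive. Some
    summand is then nonzero, and its entry extends the column upwards. *)
Lemma pc_step kap f m r l : wt f = w -> (r.+1 < l)%N -> (l <= n)%N ->
  partial_columns kap f m r.+1 l ->
  exists kap', partial_columns kap' f m r l
    /\ (#|unplaced kap'| <= #|unplaced kap|)%N.
Proof.
move=> wf rl ln pc; have rn : (r < n)%N by lia.
have cur_gt x : kap x = inl m -> (Ordinal rn < f x)%N by move=> /(pc_cur pc)/andP[].
have left a x (j : nat) : kap a = inl j -> j != m -> f a = Ordinal rn -> kap x = inl m ->
    exists2 y, kap y = inl j & f y = f x.
  move=> ka njm fa kx; apply: (pc_left pc kx).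
  by rewrite ltn_neqAle njm (pc_le pc ka).
have := sum_kpol_recolor wf (pc_single pc) cur_gt left.
set u := (_ + _)%N => sumE.
have u0 : (0 < u)%N.
  have [|y ky _] := pc_full pc (i := Ordinal (leq_trans rl ln)); first by rewrite /= leqnn.
  by rewrite addn_gt0 orbC; apply/orP; left; apply/card_gt0P; exists y; rewrite inE ky.
have nz : u%:R * kpol kap f != 0.
  by rewrite mulf_neq0 ?(pc_kpol pc) // pnatr_eq0 -lt0n.
have [a] : exists a, [&& kap a == inr a, f a == Ordinal rn & kpol (recolor kap a m) f != 0].
  apply/existsP; apply: contraR nz; rewrite negb_exists => /forallP h.
  rewrite -sumE big1 // => a /andP[ka fa]; have := h a.
  by rewrite ka fa /= negbK => /eqP.
case/and3P => /eqP ka /eqP fa nza; exists (recolor kap a m).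
split; last exact/ltnW/unplaced_recolor.
by apply: pc_add; rewrite ?fa // ltnW.
Qed.

(** Column [m] has reached row [0]; the bounds [n n] express that column [m.+1] is empty. *)
Lemma pc_finish kap f m l : partial_columns kap f m 0 l ->
  partial_columns kap f m.+1 n n.
Proof.
case=> h1 h2 h3 h4 h5 h6 h7 h8 h9 h10; split=> //.
- by move=> x j /h2/leqW.
- move=> x j kx; rewrite ltnS leq_eqVlt => /orP[/eqP->|]; last exact: h5.
  by apply: h8; rewrite /= h9.
- by move=> x /h2; rewrite ltnn.
- by move=> i; rewrite [X in _ && X]ltnNge andbN.
- move=> x j i kx; rewrite ltnS leq_eqVlt => /orP[/eqP e ix|]; last exact: h10 kx.
  rewrite e; apply: h8; rewrite /=; rewrite e in kx.
  by apply: (ltn_trans ix); case/andP: (h7 x kx).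
Qed.

Lemma pc_column kap f m r l : wt f = w -> (r < l)%N -> (l <= n)%N ->
  partial_columns kap f m r l ->
  exists kap', partial_columns kap' f m.+1 n n
    /\ (#|unplaced kap'| <= #|unplaced kap|)%N.
Proof.
move=> wf; elim: r kap => [|r IHr] kap rl ln pc.
  by exists kap; split=> //; apply: pc_finish pc.
have [kap' [pc' le]] := pc_step wf rl ln pc.
have [kap'' [pc'' le']] := IHr kap' (ltnW rl) ln pc'.
by exists kap''; split=> //; apply: leq_trans le.
Qed.

Lemma pc_exists f : wt f = w -> G f != 0 ->
  exists kap m, partial_columns kap f m n n /\ unplaced kap = set0.
Proof.
move=> wf Gf.
have : exists kap m, partial_columns kap f m n n.
  exists inr, 0%N; split=> //.
  - by move=> x y [].
  - by move=> x y [].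
  - rewrite /kpol (bigD1 1%g) /=; last by apply/kstabP => x; rewrite perm1.
    rewrite odd_perm1 mul1r relabel1 big1 ?addr0 // => s /andP[/kstabP h /eqP[]].
    by apply/permP => x; rewrite perm1; case: (h x).
  - by move=> i; rewrite [X in _ && X]ltnNge andbN.
case=> kap [m]; have [N] := ubnP #|unplaced kap|; elim: N => // N IHN in kap m *.
rewrite ltnS => leN pc; have [e|/(pc_start pc)] := eqVneq (unplaced kap) set0.
  by exists kap, m.
case=> kap1 [r [pc1 lt1]].
have [kap2 [pc2 le2]] := pc_column wf (ltnSn r) (ltn_ord r) pc1.
by apply: (IHN kap2 m.+1) => //; apply: leq_ltn_trans le2 (leq_trans lt1 leN).
Qed.

Lemma even_card_aligned f P (i : 'I_n) : aligned f P -> ~~ odd (rowcount f i).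
Proof.
move/alignedP => h; rewrite /rowcount.
rewrite -(cardsID [set x : 'I_n | (x < mate P x)%N]).
suff -> : #|[set x | f x == i] :\: [set x : 'I_n | (x < mate P x)%N]|
   = #|[set x | f x == i] :&: [set x : 'I_n | (x < mate P x)%N]|.
  by rewrite addnn odd_double.
rewrite -(card_imset _ (@mate_inj n P)); apply: eq_card => x.
rewrite !inE; apply/imsetP/andP => [[y]|[fx lt]].
  rewrite !inE -leqNgt => /andP[le fy] ->; rewrite mateK h; split=> //.
  by rewrite ltn_neqAle le andbT (inj_eq val_inj) mate_neq.
exists (mate P x); rewrite ?mateK // !inE mateK h fx andbT -leqNgt ltnW //.
Qed.

Lemma nth_filter_pos (s : seq nat) i : sorted geq s ->
  nth 0%N [seq a <- s | (0 < a)%N] i = nth 0%N s i.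
Proof.
elim: s i => //= a s IHs i path_s.
case: (posnP a) => [a0|apos]; last by case: i => //= i; apply: IHs; apply: path_sorted path_s.
have all0 : all (pred1 0%N) s.
  have := order_path_min (rev_trans leq_trans) path_s.
  by apply: sub_all => b /=; rewrite a0 leqn0.
have -> : [seq b <- s | (0 < b)%N] = [::].
  by apply/eqP; rewrite -size_eq0 size_filter -leqn0 leqNgt -has_count;
    apply/hasPn => b /(allP all0)/eqP->.
case: i => [|i] /=; first by rewrite a0.
have [lt|le] := ltnP i (size s); last by rewrite nth_default.
by have := allP all0 _ (mem_nth 0%N lt) => /= /eqP->.
Qed.

(** When every entry is placed, colours are column numbers and [kpol kap f] equals [dot z (xt C t)]
    for the tableau with rows [f]. Row lengths are even because some matching is aligned with
    [f]. *)
Lemma completeness_min f : wt f = w -> G f != 0 ->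
  exists mu t, [/\ even_partition n mu, is_tableau mu t & dot z (xt C t) != 0].
Proof.
move=> wf Gf; have [kap [m [pc un0]]] := pc_exists wf Gf.
have placed x : exists j, kap x = inl j.
  case kx: (kap x) => [j|y]; first by exists j.
  have : x \in unplaced kap by rewrite inE kx (pc_single pc kx).
  by rewrite un0 inE.
pose col x := if kap x is inl j then j else 0%N.
have kapE x : kap x = inl (col x) by rewrite /col; have [j ->] := placed x.
have col_lt x : (col x < m)%N.
  rewrite ltn_neqAle (pc_le pc (kapE x)) andbT; apply/eqP => e.
  by have := pc_cur pc (x := x); rewrite kapE e => /(_ erefl); rewrite ltnNge andbN.
have col_left x j : (j <= col x)%N -> exists2 y, col y = j & f y = f x.
  rewrite leq_eqVlt => /orP[/eqP->|]; first by exists x.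
  by move/(pc_left pc (kapE x)) => [y ky fy]; exists y => //; rewrite /col ky.
have col_inj x y : col x = col y -> f x = f y -> x = y.
  by move=> e; apply: (pc_inj pc); rewrite !kapE e.
have col_rc x : (col x < rowcount f (f x))%N.
  rewrite -[X in (X <= _)%N](size_iota 0) /rowcount cardE -(size_map col).
  apply: uniq_leq_size (iota_uniq _ _) _ => j; rewrite mem_iota ltnS => /andP[_ /col_left[y <- fy]].
  by apply/mapP; exists y => //; rewrite mem_enum inE fy.
have rc_le i : (rowcount f i <= n)%N.
  by rewrite -[leqRHS]card_ord max_card.
have col_n x : (col x < n)%N by apply: leq_trans (col_rc x) (rc_le _).
pose t : tableau := [ffun x => (f x, Ordinal (col_n x))].
pose s0 := [seq rowcount f i | i <- enum 'I_n].
have nth_s0 (i : 'I_n) : nth 0%N s0 i = rowcount f i.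
  by rewrite (nth_map i) ?size_enum_ord // nth_ord_enum.
have rc_mono (i j : 'I_n) : (i < j)%N -> (rowcount f j <= rowcount f i)%N.
  move=> ij; rewrite /rowcount !cardE -!(size_map col).
  apply: uniq_leq_size => [|c /mapP[x]].
    rewrite map_inj_in_uniq ?enum_uniq // => x y; rewrite !mem_enum !inE => /eqP fx /eqP fy e.
    by apply: col_inj; rewrite ?fx ?fy.
  rewrite mem_enum inE => /eqP fx ->.
  have [|y ky fy] := pc_up pc (i := i) (kapE x) (col_lt x); first by rewrite fx.
  by apply/mapP; exists y; rewrite ?mem_enum ?inE ?fy // /col ky.
have sorted_s0 : sorted geq s0.
  apply/(sortedP 0%N) => i; rewrite size_map size_enum_ord => lt.
  by have := @rc_mono (Ordinal (ltnW lt)) (Ordinal lt) (ltnSn i); rewrite -!nth_s0.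
(* Empty rows come last, so dropping them does not shift the row indices. *)
pose mu := [seq a <- s0 | (0 < a)%N].
have nth_mu (i : 'I_n) : nth 0%N mu i = rowcount f i.
  by rewrite nth_filter_pos // nth_s0.
exists mu, t; split.
- apply/and3P; split.
  + by apply: sorted_filter => //; apply: rev_trans leq_trans.
  + apply/allP => a; rewrite mem_filter => /andP[-> /mapP[i _ ->]] /=.
    have [P al _] : exists2 P, aligned f P & z P != 0.
      apply/exists_inP; apply: contraR Gf; rewrite negb_exists_in => /forall_inP h.
      by apply/eqP/big1 => P /h; rewrite negbK => /eqP.
    exact: even_card_aligned al.
  + rewrite sumnE big_filter big_mkcond /=.
    rewrite (eq_bigr id) => [|a _]; last by case: a.
    rewrite big_map big_enum /=; apply/eqP; rewrite -[RHS]card_ord -sum1_card.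
    rewrite [RHS](partition_big f xpredT) //=; apply: eq_bigr => i _.
    by rewrite sum1dep_card; apply: eq_card => x; rewrite !inE.
- apply/andP; split; last by apply/forallP => x; rewrite ffunE /= nth_mu.
  by apply/injectiveP => x y; rewrite !ffunE => -[e1 e2]; apply: col_inj.
- rewrite dot_xt; have := pc_kpol pc; congr (_ != _).
  apply: eq_big => [s|s _].
    apply/kstabP/colstabP => h x; last by rewrite !kapE; have := h x; rewrite !ffunE => -[->].
    by rewrite !ffunE; apply: val_inj => /=; have := h x; rewrite !kapE => -[].
  by congr (_ * rowsum z (relabel _ s)); apply/ffunP => x; rewrite !ffunE.
Qed.

End HighestWeight.

(** Label each vertex by the smaller end of its edge in [P]; then [P] is the only aligned
    matching. *)
Lemma rowsum_mate (C : numClosedFieldType) n (z : pmatching n -> C) P :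
  exists f, rowsum z f = z P.
Proof.
pose e (x : 'I_n) := if (x < mate P x)%N then x else mate P x.
have eP x y : (e x == e y) = (y == x) || (y == mate P x).
  apply/eqP/orP => [|[]/eqP->//]; rewrite /e.
    by case: ifP; case: ifP => _ _; [move->|move->|move<-|move/mate_inj->];
      rewrite ?mateK eqxx ?orbT; auto.
  rewrite mateK; case: ltngtP => //.
  by move/val_inj/esym/eqP; rewrite (negPf (mate_neq P x)).
exists [ffun x => e x]; rewrite /rowsum (big_pred1 P) // => Q.
apply/alignedP/eqP => [h|-> x]; last by rewrite !ffunE; apply/eqP; rewrite eP mateK eqxx orbT.
apply: eq_mate => x; have /eqP := h x; rewrite !ffunE eq_sym eP (negPf (mate_neq Q x)).
by move/eqP.
Qed.

Theorem xt_complete (C : numClosedFieldType) n (z : pmatching n -> C) :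
  (forall mu t, even_partition n mu -> is_tableau mu t -> dot z (xt C t) = 0) ->
  forall P, z P = 0.
Proof.
move=> h P; apply/eqP; apply: contraT => zP.
have [f0 f0E] := rowsum_mate z P.
have ex : exists w, [exists f, (wt f == w) && (rowsum z f != 0)].
  by exists (wt f0); apply/existsP; exists f0; rewrite eqxx f0E.
case: (ex_minnP ex) => w /existsP[f /andP[/eqP wf nz]] wmin.
have minG g : (wt g < w)%N -> rowsum z g = 0.
  move=> lt; apply/eqP; apply: contraT => nzg.
  have : (w <= wt g)%N by apply: wmin; apply/existsP; exists g; rewrite eqxx.
  by rewrite leqNgt lt.
have [mu [t [mu_e tt /eqP[]]]] := completeness_min minG wf nz.
exact: h mu_e tt.
Qed.

Lemma even_is_partition n mu : even_partition n mu -> is_partition n mu.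
Proof. by case/and3P => s _ e; rewrite /is_partition s e. Qed.

Lemma even_partition_pos n mu : even_partition n mu -> all (leq 1) mu.
Proof. by case/and3P => _ h _; apply: sub_all h => p /andP[]. Qed.

Lemma even_partition_nth n mu i : even_partition n mu -> ~~ odd (nth 0%N mu i).
Proof.
case/and3P => _ /allP h _; have [lt|le] := ltnP i (size mu); last by rewrite nth_default.
by have /andP[] := h _ (mem_nth 0%N lt).
Qed.

(** * Positivity of [xt] at the matching of adjacent cells *)

(** The columns are paired as [2j] and [2j + 1]. *)
Definition flip (c : nat) := if odd c then c.-1 else c.+1.

Lemma flipK : involutive flip.
Proof.
move=> c; rewrite /flip; case oc: (odd c).
  by have -> : odd c.-1 = false; lia.
by rewrite /= oc.
Qed.

Lemma flip_neq c : flip c != c.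
Proof. by rewrite /flip; case: ifP; lia. Qed.

Lemma odd_flip c : odd (flip c) = ~~ odd c.
Proof. by rewrite /flip; case: ifP; lia. Qed.

Lemma flip_lt c m : ~~ odd m -> (c < m)%N -> (flip c < m)%N.
Proof. by rewrite /flip; case: ifP; lia. Qed.

Section Pairing.
Variables (C : numClosedFieldType) (n : nat).
Local Notation tableau := {ffun 'I_n -> 'I_n * 'I_n}.
Implicit Types (P Q : pmatching n) (s : 'S_n) (x y : 'I_n) (t : tableau).

Definition pairing t P := forall x,
  (t (mate P x)).1 = (t x).1 /\ (t (mate P x)).2 = flip (t x).2 :> nat.

Lemma tab_eq mu t x y : is_tableau mu t -> (t x).1 = (t y).1 ->
  (t x).2 = (t y).2 :> nat -> x = y.
Proof.
move=> tt e1 /val_inj e2; apply: (tab_inj tt).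
by rewrite [t x]surjective_pairing [RHS]surjective_pairing e1 e2.
Qed.

Lemma pairing_exists mu t : even_partition n mu -> is_tableau mu t ->
  exists P, pairing t P.
Proof.
move=> mue tt; have pmu := even_is_partition mue.
have ex x : exists y, ((t y).1 == (t x).1) && ((t y).2 == flip (t x).2 :> nat).
  have [y [y1 y2]] := tab_onto pmu tt (flip_lt (even_partition_nth _ mue) (tab_lt tt x)).
  by exists y; rewrite y2 eqxx andbT; apply/eqP/val_inj.
pose h x := xchoose (ex x).
have hP x : (t (h x)).1 = (t x).1 /\ (t (h x)).2 = flip (t x).2 :> nat.
  by have /andP[/eqP ? /eqP] := xchooseP (ex x).
have hK : involutive h.
  move=> x; have [e1 e2] := hP x; have [e3 e4] := hP (h x).
  by apply: (tab_eq tt); rewrite ?e3 ?e4 ?e2 ?flipK.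
have hN x : h x != x.
  apply: contraTneq (flip_neq (t x).2) => e; have [_] := hP x.
  by rewrite e negbK => <-.
have [P PE] := of_mate hK hN; exists P => x; rewrite PE; exact: hP.
Qed.

(** Alignment makes the inverse [r] of [s] commute with [mate P], so [r] acts alike on even and odd
    columns. It is the product of a permutation of the even columns with its conjugate by [mate P],
    hence even. *)
Lemma pairing_sign mu t P s : is_tableau mu t -> pairing t P -> colstab t s ->
  aligned (relabel (tableau_rows t) s) P -> odd_perm s = false.
Proof.
move=> tt tP ts /alignedP al; rewrite -odd_permV; set r := s^-1%g.
have tr := colstabP _ _ (colstabV ts); rewrite -/r in tr.
have rm x : r (mate P x) = mate P (r x).
  apply: (tab_eq tt).
    by have := al x; rewrite !ffunE (tP (r x)).1.
  by rewrite (tP (r x)).2 !tr (tP x).2.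
clearbody r; pose h x := if odd (t x).2 then x else r x.
have h_inj : injective h.
  move=> x y; rewrite /h; case: ifP => ox; case: ifP => oy //.
  - by move=> e; move: oy; rewrite -tr -e ox.
  - by move=> e; move: oy; rewrite -e tr ox.
  - exact: perm_inj.
pose p := perm (@mate_inj n P).
have pV : (p^-1 = p)%g.
  by apply/eqP; rewrite eq_invg_mul; apply/eqP/permP => x; rewrite permM !permE mateK.
have -> : r = (perm h_inj * perm h_inj ^ p)%g.
  apply/permP => x; rewrite permM -[X in (_ ^ p)%g X](permKV p) permJ pV !permE [h x]/h.
  case ox: (odd (t x).2); rewrite /h (tP _).2 odd_flip ?tr ox /= ?mateK //.
  by rewrite -rm mateK.
by rewrite odd_permM odd_permJ addbb.
Qed.

(** No term is negative by [pairing_sign], and the identity contributes [1]. Eigenvalues are later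
    read off at such a matching. *)
Lemma xt_pairing_pos mu t P : is_tableau mu t -> pairing t P -> 0 < xt C t P.
Proof.
move=> tt tP; rewrite /xt /pol (bigD1 1%g) ?colstab1 //= relabel1 odd_perm1 mul1r.
have -> : aligned (tableau_rows t) P.
  by apply/alignedP => x; rewrite !ffunE (tP x).1.
apply: ltr_wpDr; rewrite ?ltr01 //; apply: sumr_ge0 => s /andP[ts _].
case al: (aligned _ P); last by rewrite mulr0.
by rewrite (pairing_sign tt tP ts al) mulr1 ler01.
Qed.

Lemma tab_transitive mu t t' : is_partition n mu -> is_tableau mu t ->
  is_tableau mu t' -> exists g, t' = relabel t g.
Proof.
move=> pmu tt tt'; have ex x : exists y, t y == t' x.
  have [y [y1 y2]] := tab_onto pmu tt (tab_lt tt' x); exists y.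
  by rewrite [t y]surjective_pairing [t' x]surjective_pairing (val_inj y1) (val_inj y2).
pose h x := xchoose (ex x).
have hP x : t (h x) = t' x by apply/eqP/(xchooseP (ex x)).
have h_inj : injective h by move=> x y e; apply: (tab_inj tt'); rewrite -!hP e.
by exists (perm h_inj)^-1%g; apply/ffunP => x; rewrite ffunE invgK permE hP.
Qed.

Lemma tab_relabel mu t g : is_tableau mu t -> is_tableau mu (relabel t g).
Proof.
move=> tt; apply/andP; split.
  apply/injectiveP => x y; rewrite !ffunE => /(tab_inj tt); exact: perm_inj.
by apply/forallP => x; rewrite ffunE (tab_lt tt).
Qed.

Lemma wt_rowcount (f : {ffun 'I_n -> 'I_n}) : wt f = (\sum_(i < n) rowcount f i * i)%N.
Proof.
rewrite /wt (partition_big f xpredT) //=; apply: eq_bigr => i _.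
rewrite (eq_bigr (fun _ => i : nat)) => [|x /eqP->//].
by rewrite sum_nat_const /rowcount; congr (_ * _)%N; apply: eq_card => x; rewrite !inE.
Qed.

Lemma tab_exists mu : is_partition n mu -> exists t, is_tableau mu t.
Proof.
move=> pmu; have /andP[_ /eqP sE] := pmu.
have lt1 (x : 'I_n) : (reshape_index mu x < n)%N.
  apply: (part_size pmu); apply: leq_ltn_trans (reshape_offsetP _); rewrite ?sE //.
have lt2 (x : 'I_n) : (reshape_offset mu x < n)%N.
  apply: leq_trans (part_nth_le pmu (reshape_index mu x)).
  by apply: reshape_offsetP; rewrite sE.
exists [ffun x => (Ordinal (lt1 x), Ordinal (lt2 x))]; apply/andP; split.
  apply/injectiveP => x y; rewrite !ffunE => -[e1 e2]; apply: val_inj => /=.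
  by rewrite -(reshape_indexK mu x) e1 e2 reshape_indexK.
by apply/forallP => x; rewrite ffunE /= reshape_offsetP ?sE.
Qed.

End Pairing.

(** * Invariant kernels act on [xt] by scalars *)

Section Kernel.
Variables (C : numClosedFieldType) (n : nat).
Local Notation tableau := {ffun 'I_n -> 'I_n * 'I_n}.
Implicit Types (P Q : pmatching n) (s : 'S_n) (x y : 'I_n) (t : tableau).
Implicit Types (z : pmatching n -> C) (K : pmatching n -> pmatching n -> C).

Definition pm_invariant K := forall s P Q, K (pm_act P s) (pm_act Q s) = K P Q.

Definition app K z Q : C := \sum_P K Q P * z P.

Lemma app_act K z s Q : pm_invariant K ->
  app K z (pm_act Q s) = app K (fun P => z (pm_act P s)) Q.
Proof.
move=> iK; rewrite /app (reindex_inj (@pm_act_inj n s)).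
by apply: eq_bigr => P _; rewrite iK.
Qed.

Lemma eq_app K z z' Q : z =1 z' -> app K z Q = app K z' Q.
Proof. by move=> h; apply: eq_bigr => P _; rewrite h. Qed.

Lemma appZ K a z Q : app K (fun P => a * z P) Q = a * app K z Q.
Proof. by rewrite /app mulr_sumr; apply: eq_bigr => P _; rewrite mulrCA. Qed.

Lemma app_antisym K t z : pm_invariant K -> antisym t z -> antisym t (app K z).
Proof.
by move=> iK az s Q ts; rewrite app_act // -appZ; apply: eq_app => P; apply: az.
Qed.

Lemma dot_app K z z' : (forall P Q, K P Q = K Q P) ->
  dot (app K z) z' = dot z (app K z').
Proof.
move=> sK; rewrite /dot /app; under eq_bigr do rewrite mulr_suml.
under [RHS]eq_bigr do rewrite mulr_sumr.
rewrite exchange_big; apply: eq_bigr => P _; apply: eq_bigr => Q _.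
by rewrite (sK Q P) mulrCA mulrA.
Qed.

Lemma dot_eq z z' z1 : z =1 z' -> dot z z1 = dot z' z1.
Proof. by move=> h; apply: eq_bigr => P _; rewrite h. Qed.

Lemma dotZl a z z' : dot (fun P => a * z P) z' = a * dot z z'.
Proof. by rewrite /dot mulr_sumr; apply: eq_bigr => P _; rewrite mulrA. Qed.

Lemma dotBl z1 z2 z' : dot (fun P => z1 P - z2 P) z' = dot z1 z' - dot z2 z'.
Proof. by rewrite /dot -sumrB; apply: eq_bigr => P _; rewrite mulrBl. Qed.

(** James's key step for [rowsum z]: one value of it determines the pairings of an antisymmetric [z]
    with all [xt C s] that are not heavier. *)
Lemma antisym_dot_xt mu (t s : tableau) z : is_partition n mu -> is_tableau mu t ->
  antisym t z -> (wt (tableau_rows s) <= wt (tableau_rows t))%N ->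
  dot z (xt C s) = rowsum z (tableau_rows t) * pol (tabcoef C t) s.
Proof.
move=> pmu tt az le; rewrite dot_xt /pol mulr_sumr; apply: eq_bigr => g _.
rewrite (antisymG_tabcoef pmu tt (antisym_rowsum az)) ?wt_relabel //.
by rewrite mulrCA.
Qed.

Lemma pol_tabcoef_neq mu la (t s : tableau) : even_partition n mu -> even_partition n la ->
  is_tableau mu t -> is_tableau la s -> mu <> la -> pol (tabcoef C t) s = 0.
Proof.
move=> mue lae tt ts ne; rewrite /pol big1 // => g _.
rewrite tabcoef_eq0 ?mulr0 // => h _ /(congr1 (@rowcount n)) e; case: ne.
apply: (part_eq (even_is_partition mue) (even_is_partition lae)
  (even_partition_pos mue) (even_partition_pos lae)).
move=> i; rewrite -(rowcount_tab _ (even_is_partition mue) tt).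
rewrite -(rowcount_tab _ (even_is_partition lae) ts).
by have := congr1 (fun h => h i) e; rewrite !rowcount_relabel.
Qed.

(** One tableau is not heavier than the other, and symmetry of [K] lets it take the role of [s] in
    [antisym_dot_xt]. Tabloids of different row lengths then share no coefficient. *)
Lemma xt_orth K mu la (t s : tableau) : pm_invariant K -> (forall P Q, K P Q = K Q P) ->
  even_partition n mu -> even_partition n la ->
  is_tableau mu t -> is_tableau la s -> mu <> la -> dot (app K (xt C t)) (xt C s) = 0.
Proof.
move=> iK sK mue lae tt ts ne.
have [le|/ltnW le] := leqP (wt (tableau_rows s)) (wt (tableau_rows t)).
  rewrite (antisym_dot_xt (even_is_partition mue) tt _ le).
    by rewrite (pol_tabcoef_neq mue lae) ?mulr0.
  exact/app_antisym/xt_antisym.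
rewrite dot_app // dotC (antisym_dot_xt (even_is_partition lae) ts _ le).
  by rewrite (pol_tabcoef_neq lae mue) ?mulr0 // => e; case: ne.
exact/app_antisym/xt_antisym.
Qed.

Definition idK P Q : C := (P == Q)%:R.

Lemma idK_inv : pm_invariant idK.
Proof. by move=> s P Q; rewrite /idK (inj_eq (@pm_act_inj n s)). Qed.

Lemma app_idK z : app idK z =1 z.
Proof.
move=> Q; rewrite /app (bigD1 Q) //= /idK eqxx mul1r big1 ?addr0 // => P nPQ.
by rewrite eq_sym (negPf nPQ) mul0r.
Qed.

Lemma dot_xt_orth mu la (t s : tableau) : even_partition n mu -> even_partition n la ->
  is_tableau mu t -> is_tableau la s -> mu <> la -> dot (xt C t) (xt C s) = 0.
Proof.
move=> mue lae tt ts ne; rewrite -(xt_orth idK_inv _ mue lae tt ts ne).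
  by apply: dot_eq => P; rewrite app_idK.
by move=> P Q; rewrite /idK eq_sym.
Qed.

Lemma wt_tab mu t t' : is_partition n mu -> is_tableau mu t -> is_tableau mu t' ->
  wt (tableau_rows t) = wt (tableau_rows t').
Proof.
move=> pmu tt tt'; rewrite !wt_rowcount; apply: eq_bigr => i _.
by rewrite (rowcount_tab _ pmu tt) (rowcount_tab _ pmu tt').
Qed.

Lemma dot_xt_gt0 mu t : even_partition n mu -> is_tableau mu t ->
  0 < dot (xt C t) (xt C t).
Proof.
move=> mue tt; have [P tP] := pairing_exists mue tt.
have pos := xt_pairing_pos C tt tP.
rewrite /dot (bigD1 P) //=; apply: ltr_wpDr; last by rewrite mulr_gt0.
apply: sumr_ge0 => Q _; rewrite -{2}[xt C t Q]conj_xt; exact: mul_conjC_ge0.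
Qed.

(** [theta] is a ratio of two values of [rowsum], chosen to make [app K (xt C t0) - theta * xt C t0]
    orthogonal to every [xt] of shape [mu]. Other shapes are covered by [xt_orth], so completeness
    gives zero; invariance then reaches all tableaux of the shape. *)
Lemma kernel_scalar K mu : pm_invariant K -> (forall P Q, K P Q = K Q P) ->
  even_partition n mu ->
  exists theta, forall t, is_tableau mu t -> app K (xt C t) =1 (fun P => theta * xt C t P).
Proof.
move=> iK sK mue; have pmu := even_is_partition mue.
have [t0 tt0] := tab_exists pmu.
pose g0 := rowsum (xt C t0) (tableau_rows t0).
have a0 : antisym t0 (xt C t0) by apply: xt_antisym.
have g0nz : g0 != 0.
  have := lt0r_neq0 (dot_xt_gt0 mue tt0); rewrite (antisym_dot_xt pmu tt0 a0) //.
  by rewrite mulf_eq0 negb_or => /andP[].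
pose th := rowsum (app K (xt C t0)) (tableau_rows t0) / g0.
have E0 : app K (xt C t0) =1 (fun P => th * xt C t0 P).
  move=> P; apply/eqP; rewrite -subr_eq0; apply/eqP.
  apply: (@xt_complete C n (fun P => app K (xt C t0) P - th * xt C t0 P)) => la s lae ts.
  rewrite dotBl dotZl; have [e|/eqP ne] := eqVneq mu la; last first.
    by rewrite (xt_orth iK sK mue lae tt0 ts ne) (dot_xt_orth mue lae tt0 ts ne) mulr0 subrr.
  rewrite -e in ts.
  have le : (wt (tableau_rows s) <= wt (tableau_rows t0))%N by rewrite (wt_tab pmu ts tt0).
  rewrite (antisym_dot_xt pmu tt0 (app_antisym iK a0) le).
  rewrite (antisym_dot_xt pmu tt0 a0 le) -/g0 /th mulrA divfK // subrr //.
exists th => t tt; have [g ->] := tab_transitive pmu tt0 tt => P.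
rewrite (@eq_app K _ (fun P => xt C t0 (pm_act P g^-1))); last by move=> Q; rewrite xt_relabel.
by rewrite -app_act // E0 xt_relabel.
Qed.

End Kernel.

Lemma sum_iota m : (2 * \sum_(i <- iota 0 m) i + m = m * m)%N.
Proof.
elim: m => [|m IHm]; first by rewrite big_nil.
by rewrite -[in iota 0 _]addn1 iotaD big_cat /= big_seq1; lia.
Qed.

(** * The Hamiltonian eigenvalue *)

Section Garnir.
Variables (C : numClosedFieldType) (n : nat) (mu : seq nat).
Local Notation filling := {ffun 'I_n -> 'I_n}.
Local Notation tableau := {ffun 'I_n -> 'I_n * 'I_n}.
Variable t : tableau.
Hypotheses (mu_part : is_partition n mu) (t_tab : is_tableau mu t).
Implicit Types (P Q : pmatching n) (s : 'S_n) (x y a b : 'I_n) (c : 'I_n).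

(** Translation by the transposition of [a] and [a'] reverses signs and keeps the constraint
    [s b0 = b], as [b0] lies in another column. *)
Lemma col_eq0 (r : filling) a a' b b0 (G : filling -> C) :
  a != a' -> (t a).2 = (t a').2 -> (t a).2 != (t b0).2 -> r a = r a' ->
  \sum_(s | colstab t s && (s b0 == b)) (-1) ^+ odd_perm s * G (relabel r s) = 0.
Proof.
move=> naa' caa' cab raa'; apply/eqP; rewrite -eqNr -sumrN; apply/eqP.
rewrite [RHS](reindex_inj (mulgI (tperm a a'))) /=; apply: eq_big => s.
  rewrite permM tpermD; last 2 first.
  - by apply: contraNneq cab => ->.
  - by apply: contraNneq cab => <-; rewrite caa'.
  congr (_ && _); have ct := colstab_tperm caa'.
  apply/idP/idP => h; first exact: colstabM.
  by rewrite -[s](mulKg (tperm a a')) tpermV colstabM.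
move=> _; rewrite odd_permM odd_tperm naa' signr_addb expr1 mulN1r mulNr -relabelM.
congr (- (_ * G (relabel _ _))); apply/ffunP => u; rewrite [RHS]ffunE tpermV.
by case: tpermP => [->|->|].
Qed.

(** Group the column permutations by the entry [b0] sent to [b]. Swapping [b0] with [a0] in column
    [c] repeats the row of [b0] there, which gives [0] by [col_eq0], unless [a0] lies in that row
    itself; then the swap does not change the rows. Such an entry exists because column [c] is
    further left. *)
Lemma garnir_pol (G : filling -> C) c b : (c < (t b).2)%N ->
  \sum_(a | (t a).2 == c) pol (fun f => G (relabel f (tperm a b))) t = pol G t.
Proof.
move=> cb; pose W a0 b0 :=
  \sum_(s | colstab t s && (s b0 == b)) (-1) ^+ odd_perm s *
     G (relabel (relabel (tableau_rows t) (tperm a0 b0)) s).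
have -> : \sum_(a | (t a).2 == c) pol (fun f => G (relabel f (tperm a b))) t =
    \sum_(a0 | (t a0).2 == c) \sum_(b0 | (t b0).2 == (t b).2) W a0 b0.
  rewrite /pol exchange_big [RHS]exchange_big /= [LHS](partition_big (fun s : 'S_n => s^-1%g b)
    (fun b0 => (t b0).2 == (t b).2)) /=; last first.
    by move=> s ts; rewrite (colstabP _ _ (colstabV ts)).
  apply: eq_bigr => b0 _; rewrite [RHS]exchange_big /=; apply: eq_big => s.
    by rewrite -[X in _ = _ && (_ == X)](permKV s b) (inj_eq perm_inj) eq_sym.
  case/andP => ts /eqP sb; rewrite (reindex_inj (@perm_inj _ s)) /=.
  apply: eq_big => a0; first by rewrite (colstabP _ _ ts).
  move=> _; have -> : b = s b0 by rewrite -sb permKV.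
  by rewrite !relabelM -tpermJ conjgE !mulgA mulgV mul1g.
rewrite exchange_big /= [RHS](partition_big (fun s : 'S_n => s^-1%g b)
    (fun b0 => (t b0).2 == (t b).2)) /=; last first.
  by move=> s ts; rewrite (colstabP _ _ (colstabV ts)).
apply: eq_bigr => b0 /eqP cb0; rewrite -cb0 in cb.
have [a [ra ca]] := tab_onto mu_part t_tab (ltn_trans cb (tab_lt t_tab b0)).
have ra' : (t a).1 = (t b0).1 by apply: val_inj.
have ca' : (t a).2 = c by apply: val_inj.
have ncb : c != (t b0).2 by apply: contraTneq cb => <-; rewrite ltnn.
rewrite (bigD1 a) ?ca' //= big1 ?addr0.
  apply: eq_big => s; last first.
    move=> _; congr (_ * G (relabel _ s)); apply/ffunP => u.
    by rewrite !ffunE tpermV; case: tpermP => [->|->|//]; rewrite ra'.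
  by rewrite -[X in _ && (_ == X)](permKV s b) (inj_eq perm_inj) eq_sym.
move=> a0 /andP[/eqP ca0 na0]; apply: (@col_eq0 _ a0 a); rewrite ?ca0 ?ca' //.
rewrite !ffunE !tpermV tpermL tpermD ?ra' //.
by apply: contraNneq ncb => ->; rewrite ca'.
Qed.

Lemma xt_tperm P a b : xt C t (pm_act P (tperm a b)) =
  pol (fun f => (aligned (relabel f (tperm a b)) P)%:R) t.
Proof.
apply: eq_pol => f; congr (_%:R); rewrite -[in RHS](pm_actK (tperm a b) P) tpermV.
by rewrite aligned_act.
Qed.

Lemma garnir P c b : (c < (t b).2)%N ->
  \sum_(a | (t a).2 == c) xt C t (pm_act P (tperm a b)) = xt C t P.
Proof.
move=> cb; under eq_bigr do rewrite xt_tperm.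
by rewrite (garnir_pol (fun f => (aligned f P)%:R) cb).
Qed.

Lemma sum_left_columns P b : \sum_(a | ((t a).2 < (t b).2)%N) xt C t (pm_act P (tperm a b))
  = ((t b).2)%:R * xt C t P.
Proof.
rewrite (partition_big (fun a => (t a).2) (fun c => (c < (t b).2)%N)) //=.
rewrite (eq_bigr (fun=> xt C t P)) => [|c cb].
  rewrite sumr_const mulr_natl; congr (_ *+ _).
  rewrite -sum1_card -[RHS]card_ord -sum1_card.
  by rewrite (big_ord_narrow (ltnW (ltn_ord (t b).2))).
rewrite -(garnir P cb); apply: eq_bigl => a.
by apply: andb_idl => /eqP->.
Qed.

Lemma xt_col_tperm P a b : (t a).2 = (t b).2 ->
  xt C t (pm_act P (tperm a b)) = (-1) ^+ (a != b) * xt C t P.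
Proof.
by move=> e; rewrite xt_antisym ?odd_tperm ?colstab_tperm.
Qed.

(** Ordered pairs are counted, including [a = b]: hence twice the content, plus [1], for each
    cell. *)
Definition content_sum : C :=
  (\sum_(x < n) (2 * (t x).2 + 1))%N%:R - (\sum_(x < n) 2 * (t x).1)%N%:R.

Lemma sum_all_tperm P :
  \sum_a \sum_b xt C t (pm_act P (tperm a b)) = content_sum * xt C t P.
Proof.
have col_card b : #|[set a | (t a).2 == (t b).2]| = #|column t (t b).2| by [].
have same b : \sum_(a | (t a).2 == (t b).2) xt C t (pm_act P (tperm a b))
   = (2 - #|column t (t b).2|%:R) * xt C t P.
  rewrite (bigD1 b) //= tperm1 pm_act1.
  rewrite (eq_bigr (fun=> - xt C t P)) => [|a /andP[/eqP e nab]]; last first.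
    by rewrite xt_col_tperm // nab expr1 mulN1r.
  rewrite sumr_const.
  have -> : #|column t (t b).2| = #|[pred a | ((t a).2 == (t b).2) && (a != b)]|.+1.
    rewrite (cardD1 b) inE eqxx add1n; congr _.+1; apply: eq_card => a.
    by rewrite !inE andbC.
  by move: #|_| (xt C t P) => m v; rewrite -[(- v) *+ m]mulr_natl -natr1; ring.
have left : \sum_b \sum_(a | ((t a).2 < (t b).2)%N) xt C t (pm_act P (tperm a b))
    = (\sum_(x < n) (t x).2)%N%:R * xt C t P.
  rewrite natr_sum mulr_suml; apply: eq_bigr => b _; exact: sum_left_columns.
have right : \sum_b \sum_(a | ((t b).2 < (t a).2)%N) xt C t (pm_act P (tperm a b))
    = (\sum_(x < n) (t x).2)%N%:R * xt C t P.
  rewrite -left (exchange_big_dep xpredT) //=; apply: eq_bigr => b _.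
  by apply: eq_bigr => a _; rewrite tpermC.
rewrite exchange_big /=.
have -> : \sum_b \sum_a xt C t (pm_act P (tperm a b)) =
    \sum_b \sum_(a | ((t a).2 < (t b).2)%N) xt C t (pm_act P (tperm a b))
    + \sum_b \sum_(a | ((t b).2 < (t a).2)%N) xt C t (pm_act P (tperm a b))
    + \sum_b \sum_(a | (t a).2 == (t b).2) xt C t (pm_act P (tperm a b)).
  rewrite -!big_split /=; apply: eq_bigr => b _.
  rewrite [LHS](bigID (fun a => ((t a).2 < (t b).2)%N)) /= -addrA; congr (_ + _).
  rewrite [LHS](bigID (fun a => ((t b).2 < (t a).2)%N)) /=; congr (_ + _).
    by apply: eq_bigl => a; case: ltngtP.
  by apply: eq_bigl => a; rewrite -(inj_eq val_inj) /=; case: ltngtP.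
rewrite left right (eq_bigr _ (fun b _ => same b)).
rewrite -mulr_suml -!mulrDl; congr (_ * _); rewrite /content_sum.
(* A column of length [l] contributes [l * l] on the left, the sum of the first [l] odd numbers on
   the right. *)
have cols : (\sum_(b < n) #|column t (t b).2| = \sum_(b < n) (2 * (t b).1 + 1))%N.
  rewrite (partition_big (fun b => (t b).2) xpredT) //= [RHS](partition_big (fun b => (t b).2) xpredT) //=.
  apply: eq_bigr => c _; rewrite (eq_bigr (fun=> #|column t c|)) => [|b /eqP->//].
  have lt := tab_row_lt mu_part t_tab (c := c).
  have e := sum_inj_lt (tab_row_inj t_tab (c := c)) lt.
  have e' : (\sum_(x | (t x).2 == c) (t x).1 = \sum_(i <- iota 0 #|column t c|) i)%N.
    by rewrite -e; apply: eq_bigl => x; rewrite inE.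
  have e'' : #|[pred x | (t x).2 == c]| = #|column t c| by apply: eq_card => x; rewrite !inE.
  by rewrite sum_nat_const big_split /= -big_distrr /= sum1_card e' e'' sum_iota.
rewrite sumrB sumr_const card_ord -natr_sum cols !big_split /=.
rewrite !sum_nat_const card_ord muln0 muln1 !natrD -[2 *+ n]mulr_natr; ring.
Qed.

End Garnir.

Section Hamiltonian.
Variable n : nat.
Implicit Types (P Q : pmatching n) (s : 'S_n) (x y a b : 'I_n) (D S : {set 'I_n}).

Definition mclosed P Q S := [forall (x | x \in S), (mate P x \in S) && (mate Q x \in S)].

Lemma mclosedP P Q S : reflect (forall x, x \in S -> mate P x \in S /\ mate Q x \in S)
  (mclosed P Q S).
Proof.
apply: (iffP forall_inP) => h x /h; first by move/andP.
by case=> -> ->.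
Qed.

(* [D] spans a single cycle of the union of [P] and [Q]. *)
Definition is_cycle P Q D := [&& D != set0, mclosed P Q D &
  [forall S : {set 'I_n}, [&& S \subset D, S != set0 & mclosed P Q S] ==> (S == D)]].

Lemma is_cycleP P Q D : reflect
  [/\ D != set0, mclosed P Q D
    & forall S, S \subset D -> S != set0 -> mclosed P Q S -> S = D]
  (is_cycle P Q D).
Proof.
apply: (iffP and3P) => -[D0 cD h]; split=> //.
  move=> S SD S0 cS; have /forallP/(_ S) := h.
  by rewrite SD S0 cS => /eqP.
by apply/forallP => S; apply/implyP => /and3P[SD S0 cS]; rewrite (h S).
Qed.

Lemma mclosed_sym P Q S : mclosed P Q S = mclosed Q P S.
Proof. by apply/mclosedP/mclosedP => h x /h[]. Qed.

Lemma is_cycle_sym P Q D : is_cycle P Q D = is_cycle Q P D.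
Proof.
by apply/is_cycleP/is_cycleP => -[D0 cD h]; split; rewrite 1?mclosed_sym // => S SD S0 cS;
  apply: h; rewrite // mclosed_sym.
Qed.

Lemma mclosed_act P Q s S : mclosed P Q S -> mclosed (pm_act P s) (pm_act Q s) (s @: S).
Proof.
move/mclosedP => h; apply/mclosedP => _ /imsetP[x /h[xp xq] ->].
by rewrite !mate_act !imset_f.
Qed.

Lemma imset_permK s S : s^-1%g @: (s @: S) = S.
Proof. by rewrite -imset_comp -[RHS]imset_id; apply: eq_imset => x /=; rewrite permK. Qed.

Lemma imset_permKV s S : s @: (s^-1%g @: S) = S.
Proof. by rewrite -{1}[s]invgK imset_permK. Qed.

Lemma is_cycle_act_imp P Q s D :
  is_cycle P Q D -> is_cycle (pm_act P s) (pm_act Q s) (s @: D).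
Proof.
case/is_cycleP => D0 cD h; apply/is_cycleP; split; first by rewrite imset_eq0.
- exact: mclosed_act.
- move=> S SD S0 cS; rewrite -(imset_permKV s S) (h (s^-1%g @: S)) //.
  + by rewrite -(imset_permK s D) imsetS.
  + by rewrite imset_eq0.
  + by have := mclosed_act s^-1%g cS; rewrite !pm_actK.
Qed.

Lemma is_cycle_act P Q s D :
  is_cycle (pm_act P s) (pm_act Q s) (s @: D) = is_cycle P Q D.
Proof.
apply/idP/idP; last exact: is_cycle_act_imp.
by move/(@is_cycle_act_imp _ _ s^-1%g); rewrite !pm_actK imset_permK.
Qed.

Definition cycle_on P D := [set Q | [forall x, (x \notin D) ==> (mate Q x == mate P x)]
  && is_cycle P Q D].

Lemma cycle_onP P D Q : reflect
  ((forall x, x \notin D -> mate Q x = mate P x) /\ is_cycle P Q D) (Q \in cycle_on P D).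
Proof.
rewrite inE; apply: (iffP andP) => -[h hc]; split=> //.
  by move=> x xD; have /forallP/(_ x)/implyP/(_ xD)/eqP := h.
by apply/forallP => x; apply/implyP => /h->.
Qed.

Section Extend.
Variables (P : pmatching n) (D : {set 'I_n}) (a : 'I_n).
Hypotheses (D0 : D != set0) (aD : a \notin D).
Hypothesis PD : forall x, x \in D -> mate P x \in D.
Let b := mate P a.
Let D' := a |: (b |: D).

Let bD : b \notin D.
Proof. by apply: contra aD => /PD; rewrite mateK. Qed.

Let mateb : mate P b = a. Proof. exact: mateK. Qed.

Let PD' x : x \in D' -> mate P x \in D'.
Proof.
rewrite !inE => /or3P[/eqP->|/eqP->|/PD->]; rewrite ?orbT // ?mateb ?eqxx // -/b ?eqxx ?orbT //.
Qed.

(** [Q] contains the edge from [a] to [b]. Swapping [y] and [a] splices this edge into the cycle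
    next to [y]: [b] becomes the partner of [y], and [a] that of [mate Q y]. *)
Lemma cycle_on_extend y Q : y \in D -> Q \in cycle_on P D ->
  pm_act Q (tperm y a) \in cycle_on P D' /\ mate (pm_act Q (tperm y a)) b = y.
Proof.
move=> yD /cycle_onP[offD /is_cycleP[_ /mclosedP cD minD]].
have nya : y != a by apply: contraNneq aD => <-.
have nyb : y != b by apply: contraNneq bD => <-.
have nab : b != a by apply: mate_neq.
have Qa : mate Q a = b by rewrite offD.
have Qb : mate Q b = a by rewrite -Qa mateK.
have mE x : mate (pm_act Q (tperm y a)) x = tperm y a (mate Q (tperm y a x)).
  by rewrite mate_actE tpermV.
have Rb : mate (pm_act Q (tperm y a)) b = y by rewrite mE [tperm y a b]tpermD // 1?eq_sym // Qb tpermR.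
have Ry : mate (pm_act Q (tperm y a)) y = b by apply/(canLR (mateK _))/esym.
have Rin x : x \in D -> x != y -> x != mate Q y -> mate (pm_act Q (tperm y a)) x = mate Q x.
  move=> xD nxy nxQ; rewrite mE [tperm y a x]tpermD 1?eq_sym //; last first.
    by apply: contraNneq aD => <-.
  rewrite tpermD //.
    by apply: contraNneq nxQ => ->; rewrite mateK.
  by apply: contraNneq aD => ->; case: (cD x xD).
have QyD : mate Q y \in D by case: (cD y yD).
have RQy : mate (pm_act Q (tperm y a)) (mate Q y) = a.
  rewrite mE [tperm y a (mate Q y)]tpermD ?mateK ?tpermL // 1?eq_sym ?mate_neq //.
  by apply: contraNneq aD => <-.
have Ra : mate (pm_act Q (tperm y a)) a = mate Q y by apply/(canLR (mateK _))/esym.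
split=> //; apply/cycle_onP; split.
  move=> x; rewrite !inE !negb_or => /and3P[xa xb xD].
  have Qx : mate Q x = mate P x by apply: offD.
  rewrite mE [tperm y a x]tpermD 1?eq_sym //; last by apply: contraNneq xD => ->.
  rewrite tpermD Qx //.
    by apply: contraNneq xD => e; rewrite -(mateK P x) -e PD.
  by apply: contraNneq xb => e; rewrite -(mateK P x) -e.
apply/is_cycleP; split.
- by apply/set0Pn; exists a; rewrite !inE eqxx.
- apply/mclosedP => x xD'; split; first exact: PD'.
  move: xD'; rewrite !inE => /or3P[/eqP->|/eqP->|xD].
  + by rewrite Ra QyD !orbT.
  + by rewrite Rb yD !orbT.
  + have [->|nxy] := eqVneq x y; first by rewrite Ry eqxx orbT.
    have [->|nxQ] := eqVneq x (mate Q y); first by rewrite RQy eqxx.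
    by rewrite Rin //; case: (cD x xD) => _ ->; rewrite !orbT.
- move=> S SD' S0 /mclosedP cS.
  have ab : (a \in S) = (b \in S).
    apply/idP/idP => [/cS[]//|/cS[]]; by rewrite mateb.
  have by_ : (b \in S) = (y \in S).
    by apply/idP/idP => [/cS[_]|/cS[_]]; rewrite ?Rb ?Ry.
  (* The trace on [D] of a set closed for the spliced cycle is closed for the original one. *)
  have SD : S :&: D = D.
    apply: minD; first exact: subsetIr.
      case/set0Pn: S0 => x xS; have := subsetP SD' x xS; rewrite !inE.
      case/or3P => [/eqP e|/eqP e|xD].
      + by apply/set0Pn; exists y; rewrite inE yD -by_ -ab -e xS.
      + by apply/set0Pn; exists y; rewrite inE yD -by_ -e xS.
      + by apply/set0Pn; exists x; rewrite inE xS.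
    apply/mclosedP => x /setIP[xS xD]; have [px rx] := cS x xS.
    have [_ qx] := cD x xD; rewrite !inE px PD //= qx andbT; split=> //.
    have [e|nxy] := eqVneq x y.
      have aS : a \in S by rewrite ab by_ -e.
      by rewrite e -Ra; case: (cS a aS).
    have [e|nxQ] := eqVneq x (mate Q y).
      rewrite e mateK -by_ -ab -RQy -e; exact: rx.
    by rewrite -Rin.
  have DS : D \subset S by rewrite -SD subsetIl.
  have yS := subsetP DS y yD.
  apply/eqP; rewrite eqEsubset SD' /=; apply/subsetP => x; rewrite !inE.
  by case/or3P => [/eqP->|/eqP->|/(subsetP DS)]; rewrite ?ab ?by_.
Qed.

(** Cutting [a] and [b] out again leaves a single cycle: a smaller closed set, enlarged by [a] and
    [b] if it contains [y], would be closed in the spliced cycle. *)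
Lemma cycle_on_restrict y Q : y \in D ->
  pm_act Q (tperm y a) \in cycle_on P D' -> mate (pm_act Q (tperm y a)) b = y ->
  Q \in cycle_on P D.
Proof.
set R := pm_act Q _ => yD /cycle_onP[offD /is_cycleP[_ /mclosedP cD minD]] Rb.
have nya : y != a by apply: contraNneq aD => <-.
have nyb : y != b by apply: contraNneq bD => <-.
have nab : b != a by apply: mate_neq.
have mE x : mate Q x = tperm y a (mate R (tperm y a x)).
  by rewrite /R mate_actE tpermV !tpermK.
have Qb : mate Q b = a by rewrite mE [tperm y a b]tpermD // 1?eq_sym // Rb tpermL.
have Qa : mate Q a = b by apply/(canLR (mateK _))/esym.
have D'P x : x \in D' = [|| x == a, x == b | x \in D] by rewrite !inE.
have offQ x : x \notin D -> mate Q x = mate P x.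
  move=> xD; have [->|xa] := eqVneq x a; first exact: Qa.
  have [->|xb] := eqVneq x b; first by rewrite Qb mateb.
  have Rx : mate R x = mate P x by apply: offD; rewrite D'P !negb_or xa xb.
  rewrite mE [tperm y a x]tpermD 1?eq_sym //; last by apply: contraNneq xD => ->.
  rewrite tpermD Rx //.
    by apply: contraNneq xD => e; rewrite -(mateK P x) -e PD.
  by apply: contraNneq xb => e; rewrite -(mateK P x) -e.
have QD x : x \in D -> mate Q x \in D.
  move=> xD; apply: contraT => h; have e := offQ _ h; rewrite mateK in e.
  by rewrite -(canLR (mateK P) e) PD in h.
apply/cycle_onP; split=> //; apply/is_cycleP; split=> //.
  by apply/mclosedP => x xD; rewrite PD // QD.
move=> S SD S0 /mclosedP cS.
have aS : a \notin S by apply: contra aD; apply: (subsetP SD).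
have bS : b \notin S by apply: contra bD; apply: (subsetP SD).
have RE x : mate R x = tperm y a (mate Q (tperm y a x)).
  by rewrite /R mate_actE tpermV.
have Rx x : x \in S -> x != y -> x != mate Q y -> mate R x = mate Q x.
  move=> xS nxy nxQ; rewrite RE [tperm y a x]tpermD 1?eq_sym //; last first.
    by apply: contraNneq aS => <-.
  rewrite tpermD //.
    by apply: contraNneq nxQ => ->; rewrite mateK.
  by apply: contraNneq aS => ->; case: (cS x xS).
have [yS|yS] := boolP (y \in S); last first.
  have SE : S = D'.
    apply: minD => //; first by apply: subset_trans SD _; rewrite !subsetU ?subxx ?orbT.
    apply/mclosedP => x xS; have [px qx] := cS x xS; split=> //.
    rewrite Rx //; first by apply: contraNneq yS => <-.
    by apply: contraNneq yS => e; rewrite -(mateK Q y) -e; case: (cS x xS).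
  by move: aS; rewrite SE !inE eqxx.
have [PyS QyS] := cS y yS.
have Ra : mate R a = mate Q y.
  rewrite RE tpermR tpermD //; first by rewrite eq_sym mate_neq.
  by apply: contraNneq aS => ->.
have SE : a |: (b |: S) = D'.
  apply: minD; first by rewrite !setUS.
    by apply/set0Pn; exists a; rewrite !inE eqxx.
  apply/mclosedP => x; rewrite in_setU1 in_setU1 => /or3P[/eqP->|/eqP->|xS].
  - by rewrite -/b Ra !inE eqxx QyS !orbT.
  - by rewrite Rb mateb !inE eqxx yS !orbT.
  - have [px qx] := cS x xS; rewrite !inE px !orbT; split=> //.
    have [->|nxy] := eqVneq x y; first by rewrite (canLR (mateK R) (esym Rb)) eqxx orbT.
    have [->|nxQ] := eqVneq x (mate Q y); last by rewrite Rx // qx !orbT.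
    by rewrite (canLR (mateK R) (esym Ra)) eqxx.
apply/eqP; rewrite eqEsubset SD /=; apply/subsetP => x xD.
have : x \in D' by rewrite D'P xD !orbT.
rewrite -SE !inE => /or3P[/eqP e|/eqP e|//]; first by rewrite e (negPf aD) in xD.
by rewrite e (negPf bD) in xD.
Qed.

(** [y] is recovered as the partner of [b], so splicing is a bijection. Iterating it factors the sum
    over cycles into partial sums of transpositions. *)
Lemma sum_cycle_on_extend (C : numClosedFieldType) (F : pmatching n -> C) :
  \sum_(Q in cycle_on P D') F Q =
  \sum_(y in D) \sum_(Q in cycle_on P D) F (pm_act Q (tperm y a)).
Proof.
rewrite (partition_big (fun Q => mate Q b) (fun y => y \in D)) /=.
  apply: eq_bigr => y yD; rewrite (reindex_inj (@pm_act_inj n (tperm y a))) /=.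
  apply: eq_bigl => Q; apply/andP/idP => [[h /eqP]|h].
    exact: cycle_on_restrict.
  by have [-> ->] := cycle_on_extend yD h.
move=> Q /cycle_onP[_ /is_cycleP[_ /mclosedP cD minD]].
have [_ ] := cD b (setU1r _ (setU11 _ _)); rewrite in_setU1 in_setU1.
case/or3P => [/eqP e|/eqP e|//]; last by have := mate_neq Q b; rewrite e eqxx.
(* If [b] were matched with [a], this edge alone would be closed, although the cycle also covers the
   nonempty [D]. *)
have E : a |: [set b] = D'.
  apply: minD; first by rewrite setUS // sub1set setU11.
    by apply/set0Pn; exists a; rewrite !inE eqxx.
  apply/mclosedP => x; rewrite !inE => /orP[]/eqP->.
    by rewrite -/b -e mateK !eqxx !orbT.
  by rewrite mateb e !eqxx.
have /set0Pn[y yD] := D0; have : y \in D' by rewrite !inE yD !orbT.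
rewrite -E !inE => /orP[]/eqP ey; first by rewrite ey (negPf aD) in yD.
by rewrite ey (negPf bD) in yD.
Qed.

End Extend.

Lemma cycle_on_pair P a : cycle_on P [set a; mate P a] = [set P].
Proof.
apply/setP => Q; rewrite in_set1; apply/cycle_onP/eqP => [[off /is_cycleP[_ /mclosedP cD _]]|->].
  apply: eq_mate => x; have [xD|/off //] := boolP (x \in [set a; mate P a]).
  have Qa : mate Q a = mate P a.
    have [_] := cD a (set21 _ _); rewrite !inE => /orP[]/eqP // e.
    by have := mate_neq Q a; rewrite e eqxx.
  by move: xD; rewrite !inE => /orP[]/eqP-> //; rewrite mateK -Qa mateK.
split=> //; apply/is_cycleP; split.
- by apply/set0Pn; exists a; rewrite set21.
- apply/mclosedP => x; rewrite !inE => /orP[]/eqP->; rewrite ?mateK !eqxx ?orbT //.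
- move=> S SD /set0Pn[x xS] /mclosedP cS; apply/eqP; rewrite eqEsubset SD /=.
  have [pxS _] := cS x xS; have := subsetP SD x xS; rewrite !inE => /orP[]/eqP e.
    by rewrite subUset !sub1set -e xS pxS.
  by rewrite subUset !sub1set -e xS -[a](mateK P) -e pxS.
Qed.

(** [y] and [mate Q a] are partners in the swapped matching, so exchanging them fixes it. A function
    antisymmetric under this exchange vanishes there. *)
Lemma mate_act_swap Q y a : pm_act Q (tperm y a) =
  pm_act (pm_act Q (tperm y a)) (tperm y (mate Q a)) \/ y = a \/ y = mate Q a.
Proof.
have [->|nya] := eqVneq y a; first by right; left.
have [->|nyb] := eqVneq y (mate Q a); first by right; right.
left; rewrite pm_actM -{1}(act_tperm_mate Q a) pm_actM; congr pm_act.
have -> : tperm y (mate Q a) = (tperm a (mate Q a) ^ tperm y a)%g.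
  by rewrite tpermJ tpermR tpermD // eq_sym mate_neq.
by rewrite conjgE tpermV !mulgA tperm2 mul1g.
Qed.

End Hamiltonian.

Section CycleEigenvalue.
Variables (C : numClosedFieldType) (n : nat) (mu : seq nat).
Local Notation tableau := {ffun 'I_n -> 'I_n * 'I_n}.
Variable t : tableau.
Hypotheses (mu_even : even_partition n mu) (t_tab : is_tableau mu t).
Implicit Types (P Q : pmatching n) (s : 'S_n) (x y a b : 'I_n).

Let mu_part := even_is_partition mu_even.

Lemma xt_swap_eq0 Q y a : (t y).2 = (t (mate Q a)).2 -> y != a -> y != mate Q a ->
  xt C t (pm_act Q (tperm y a)) = 0.
Proof.
move=> cy nya nyb; case: (mate_act_swap Q y a) => [e|[e|e]]; last 2 first.
- by rewrite e eqxx in nya.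
- by move: nyb; rewrite {1}e eqxx.
apply/eqP; rewrite -eqNr; apply/eqP.
by rewrite [in RHS]e [RHS]xt_antisym ?colstab_tperm // odd_tperm nyb expr1 mulN1r.
Qed.

(* Processing the pairs double column by double column, each from the top. *)
Definition key x := ((t x).2./2 * n + (t x).1)%N.

Definition below k := [set x | (key x < k)%N].

Lemma below_key a y : ~~ odd (t a).2 -> (y \in below (key a)) =
  ((t y).2 < (t a).2)%N
  || (((t y).2 == (t a).2 :> nat) || ((t y).2 == (t a).2.+1 :> nat)) && ((t y).1 < (t a).1)%N.
Proof.
move=> ea; rewrite inE /key.
have := ltn_ord (t y).1; have := ltn_ord (t a).1.
move: (val (t y).1) (val (t a).1) (val (t y).2) (val (t a).2) ea => r r' c c' ea rn r'n.
have [lt|] := ltnP c c'.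
  have : (c./2 < c'./2)%N by lia.
  move: (c./2) (c'./2) => d d' dd; have := leq_mul dd (leqnn n); rewrite mulSn orTb; lia.
move=> le; have [e|ne] := eqVneq c c'; first by rewrite e ltn_add2l.
have [e|ne'] := eqVneq c c'.+1.
  have -> : c./2 = c'./2 by lia.
  by rewrite ltn_add2l.
have : (c'./2 < c./2)%N by lia.
move: (c./2) (c'./2) => d d' dd; have := leq_mul dd (leqnn n); rewrite mulSn; lia.
Qed.

Lemma card_above a (c : 'I_n) : (c < nth 0%N mu (t a).1)%N ->
  #|[set y | ((t y).2 == c) && ((t y).1 < (t a).1)%N]| = (t a).1 :> nat.
Proof.
move=> clt; set A := [set y | _].
rewrite cardE -(size_map (fun y => (t y).1 : nat)) -[RHS](size_iota 0).
apply: perm_size; apply: uniq_perm (iota_uniq _ _) _.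
  rewrite map_inj_in_uniq ?enum_uniq // => x y; rewrite !mem_enum !inE.
  move=> /andP[/eqP cx _] /andP[/eqP cy _] /val_inj e.
  by apply: (tab_eq t_tab); rewrite ?cx ?cy.
move=> i; rewrite mem_iota /= add0n; apply/mapP/idP => [[x]|lt].
  by rewrite mem_enum !inE => /andP[_ lt] ->.
have [|y [y1 y2]] := tab_onto mu_part t_tab (i := i) (j := c).
  by apply: leq_trans clt _; apply: (part_nth mu_part); apply: ltnW.
exists y => //; rewrite mem_enum !inE y1 lt andbT; exact/eqP/val_inj.
Qed.

(** Entries in columns to the left give the column index by the Garnir relations; those above [a] in
    its own column give [-1] each; those above [mate P a] in the next column give [0] by
    [xt_swap_eq0]. *)
Lemma sum_below P Q a : pairing t P -> ~~ odd (t a).2 -> mate Q a = mate P a ->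
  \sum_(y in below (key a)) xt C t (pm_act Q (tperm y a))
  = ((t a).2%:R - (t a).1%:R) * xt C t Q.
Proof.
move=> tP ea Qa; have [rb cb] := tP a.
have cbE : (t (mate P a)).2 = (t a).2.+1 :> nat by rewrite cb /flip (negPf ea).
rewrite (bigID (fun y => ((t y).2 < (t a).2)%N)) /= mulrBl; congr (_ + _).
  rewrite -(sum_left_columns C mu_part t_tab); apply: eq_bigl => y.
  by rewrite below_key //; case: ltnP => //=; rewrite andbF.
rewrite (bigID (fun y => (t y).2 == (t a).2)) /= [X in _ + X]big1 ?addr0; last first.
  move=> y /andP[/andP[]]; rewrite below_key // => + /negPf h ne.
  have -> : ((t y).2 == (t a).2 :> nat) = false by rewrite (inj_eq val_inj) (negPf ne).
  rewrite h /= => /andP[/eqP cy lt].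
  apply: xt_swap_eq0; rewrite ?Qa.
  - by apply: val_inj; rewrite /= cbE.
  - by apply: contraTneq lt => ->; rewrite ltnn.
  - by apply: contraTneq lt => ->; rewrite rb ltnn.
rewrite (eq_bigr (fun=> - xt C t Q)) => [|y /andP[/andP[]]]; last first.
  rewrite below_key // => + /negPf h /eqP cy; rewrite h cy eqxx /= => lt.
  have nya : y != a by apply: contraTneq lt => ->; rewrite ltnn.
  by rewrite xt_col_tperm // nya expr1 mulN1r.
rewrite sumr_const mulNrn mulr_natl; congr (- (_ *+ _)).
rewrite -[RHS](card_above (a := a) (c := (t a).2)); last exact: tab_lt.
apply: eq_card => y; rewrite [LHS]unfold_in /= below_key // [RHS]inE.
have -> : ((t y).2 == (t a).2) = ((t y).2 == (t a).2 :> nat) by rewrite (inj_eq val_inj).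
by case: ltngtP => //= _; rewrite ?andbT ?andbF.
Qed.

(** The corner cell, whose factor would be [0], is left out: its pair starts the cycle and is not
    spliced into anything. *)
Definition pair_content (D : {set 'I_n}) : C :=
  \prod_(x in D | ~~ odd (t x).2 && (0 < (t x).1 + (t x).2)%N)
    ((t x).2%:R - (t x).1%:R).

Lemma key_mate P x : pairing t P -> key (mate P x) = key x.
Proof.
by move=> tP; rewrite /key; have [-> ->] := tP x; congr (_ * _ + _)%N; rewrite /flip; case: ifP;
  lia.
Qed.

Lemma key_eq P x y : pairing t P -> key x = key y -> y = x \/ y = mate P x.
Proof.
move=> tP; rewrite /key => e.
have := ltn_ord (t y).1; have := ltn_ord (t x).1 => lt1 lt2.
have n0 : (0 < n)%N by apply: leq_ltn_trans lt1.
have er : (t x).1 = (t y).1 :> nat.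
  have := congr1 (modn^~ n) e; rewrite !modnMDl !modn_small //.
have ec : (t x).2./2 = (t y).2./2.
  by move/eqP: e; rewrite er eqn_add2r eqn_pmul2r // => /eqP.
have er' : (t y).1 = (t x).1 by apply: val_inj.
have [eo|ne] := eqVneq (odd (t x).2) (odd (t y).2).
  by left; apply: (tab_eq t_tab er'); lia.
right; have [rm cm] := tP x; apply: (tab_eq t_tab); rewrite ?rm ?cm //.
by rewrite /flip; case: ifP; lia.
Qed.

(** Each step adjoins the pair of key [k]. The matchings summed so far still agree with [P] on this
    pair, so [sum_below] gives them all the same factor. *)
Lemma sum_cycle_below P k : pairing t P -> below k != set0 ->
  \sum_(Q in cycle_on P (below k)) xt C t Q = pair_content (below k) * xt C t P.
Proof.
move=> tP; elim: k => [|k IHk].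
  by case/set0Pn => x; rewrite inE.
have [/existsP[a /andP[ea /eqP ka]] _|none] := boolP [exists a, ~~ odd (t a).2 && (key a == k)];
  last first.
  have -> // : below k.+1 = below k.
  apply/setP => x; rewrite !inE ltnS leq_eqVlt; case: eqP => //= kx.
  case/negP: none; apply/existsP.
  have [o|e] := boolP (odd (t x).2); last by exists x; rewrite e kx eqxx.
  exists (mate P x); rewrite (key_mate _ tP) kx eqxx andbT.
  by have [_ ->] := tP x; rewrite odd_flip o.
set b := mate P a; have kb : key b = k by rewrite /b (key_mate _ tP).
have ob : odd (t b).2 by rewrite /b; have [_ ->] := tP a; rewrite odd_flip.
have belowS : below k.+1 = a |: (b |: below k).
  apply/setP => x; rewrite !inE ltnS leq_eqVlt; apply/orP/or3P.
    case=> [/eqP kx|]; last by constructor 3.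
    have [->|->] := key_eq tP (etrans ka (esym kx)); first by constructor 1.
    by constructor 2.
  by case=> [/eqP->|/eqP->|->]; rewrite ?ka ?kb ?eqxx; auto.
have aB : a \notin below k by rewrite inE ka ltnn.
have bB : b \notin below k by rewrite inE kb ltnn.
have nab : a != b by rewrite eq_sym mate_neq.
have contE : pair_content (below k.+1) =
    (if (0 < (t a).1 + (t a).2)%N then (t a).2%:R - (t a).1%:R else 1) * pair_content (below k).
  rewrite /pair_content belowS /=.
  rewrite big_mkcond (bigD1 a) //= [X in _ * X](bigD1 b) 1?eq_sym //=.
  rewrite !inE eqxx ea /=; congr (_ * _); rewrite eqxx orbT ob /= mul1r.
  rewrite [RHS]big_mkcond [RHS](bigD1 a) //= [X in _ = _ * X](bigD1 b) 1?eq_sym //=.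
  rewrite (negPf aB) (negPf bB) !mul1r; apply: eq_bigr => x /andP[xa xb].
  by rewrite !inE (negPf xa) (negPf xb).
(* Nothing precedes the pair only if [a] is the corner cell. *)
have [B0|Bn0] := eqVneq (below k) set0.
  have a0 : ((t a).1 + (t a).2 == 0)%N.
    have pos : (0 < nth 0%N mu 0)%N.
      by apply: leq_trans (part_nth mu_part (leq0n (t a).1)); apply: leq_ltn_trans (tab_lt t_tab a).
    have [o [o1 o2]] := tab_onto mu_part t_tab pos.
    have ko : key o = 0%N by rewrite /key o1 o2.
    have : o \notin below k by rewrite B0 inE.
    rewrite inE ko -leqNgt leqn0 -ka /key addn_eq0 muln_eq0 => /andP[/orP[h|h] /eqP ->].
      by move: ea h; case: (val (t a).2) => [|[]].
    by have := leq_ltn_trans (leq0n a) (ltn_ord a); rewrite lt0n h.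
  have c0 : pair_content set0 = 1.
    by rewrite /pair_content big_pred0 // => x; rewrite in_set0.
  by rewrite contE (eqP a0) /= mul1r B0 c0 mul1r belowS B0 setU0 cycle_on_pair big_set1.
have PD x : x \in below k -> mate P x \in below k by rewrite !inE (key_mate _ tP).
rewrite belowS (sum_cycle_on_extend Bn0 aB PD) exchange_big /= -belowS contE.
have -> : (if (0 < (t a).1 + (t a).2)%N then (t a).2%:R - (t a).1%:R else 1)
    = (t a).2%:R - (t a).1%:R :> C.
  case: ifP => // /negbT; rewrite -eqn0Ngt => a0; case/set0Pn: Bn0 => x.
  rewrite inE -ka /key; move: a0; rewrite addn_eq0 => /andP[/eqP-> /eqP->].
  by rewrite ltn0.
rewrite -mulrA -(IHk Bn0) mulr_sumr; apply: eq_bigr => Q /cycle_onP[off _].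
by rewrite -ka (sum_below tP ea) // off.
Qed.

Definition hamiltonian P Q := is_cycle P Q [set: 'I_n].

Lemma sum_hamiltonian P : (0 < n)%N -> pairing t P ->
  \sum_(Q | hamiltonian P Q) xt C t Q = pair_content [set: 'I_n] * xt C t P.
Proof.
move=> n0 tP; have E : below (n * n) = [set: 'I_n].
  apply/setP => x; rewrite !inE /key.
  have := ltn_ord (t x).1; have := ltn_ord (t x).2.
  move: (val (t x).1) (val (t x).2) => r c cn rn.
  have : (c./2 < n)%N by lia.
  move: (c./2) => d dn; have := leq_mul dn (leqnn n); rewrite mulSn; lia.
rewrite -E -(sum_cycle_below tP).
  apply: eq_bigl => Q; apply/idP/cycle_onP; rewrite E; last by case.
  by split=> // x; rewrite inE.
by rewrite E; apply/set0Pn; exists (Ordinal n0); rewrite inE.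
Qed.

End CycleEigenvalue.

(** * Shapes and restriction to an edge *)

Section Shapes.
Variable n : nat.
Implicit Types (P Q : pmatching n) (s : 'S_n) (x y a b : 'I_n) (D S c : {set 'I_n}).

Definition component P Q x := [set y | connect (union_adj P Q) x y].

Lemma union_adj_sym P Q : connect_sym (union_adj P Q).
Proof.
apply: sym_connect_sym => x y; rewrite !union_adjE.
apply/or3P/or3P => -[/eqP->|/eqP->|/eqP->]; rewrite ?mateK ?eqxx;
  by [constructor 1|constructor 2|constructor 3].
Qed.

Lemma mclosed_connect P Q S x y : mclosed P Q S -> x \in S ->
  connect (union_adj P Q) x y -> y \in S.
Proof.
move=> /mclosedP cS xS /connectP[p]; elim: p x xS => [|z p IHp] x xS /=; first by move=> _ ->.
case/andP => xz; apply: IHp; move: xz; rewrite union_adjE.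
by case/or3P => /eqP-> //; case: (cS x xS).
Qed.

Lemma component_cycle P Q x : is_cycle P Q (component P Q x).
Proof.
apply/is_cycleP; split.
- by apply/set0Pn; exists x; rewrite inE.
- apply/mclosedP => y; rewrite !inE => xy; split; apply: connect_trans xy (connect1 _);
  by rewrite union_adjE eqxx ?orbT.
- move=> S SD /set0Pn[u uS] cS; apply/eqP; rewrite eqEsubset SD /=.
  apply/subsetP => y; rewrite inE => xy; apply: (mclosed_connect cS uS).
  apply: connect_trans xy; rewrite union_adj_sym.
  by have := subsetP SD u uS; rewrite inE.
Qed.

Lemma cycle_component P Q D x : is_cycle P Q D -> x \in D -> D = component P Q x.
Proof.
case/is_cycleP => _ cD minD xD; apply/esym/minD.
- by apply/subsetP => y; rewrite inE; apply: mclosed_connect.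
- by apply/set0Pn; exists x; rewrite inE.
- by case/is_cycleP: (component_cycle P Q x).
Qed.

Lemma union_componentsE P Q : union_components P Q = [set D | is_cycle P Q D].
Proof.
have compE x : [set y in [set: 'I_n] | connect (union_adj P Q) x y] = component P Q x.
  by apply/setP => y; rewrite !inE.
apply/setP => D; rewrite inE; apply/imsetP/idP => [[x _ ->]|cD].
  by rewrite compE component_cycle.
have /is_cycleP[/set0Pn[x xD] _ _] := cD.
by exists x; rewrite ?inE // compE; apply: cycle_component.
Qed.

Lemma shapeP P Q (s : seq nat) : sorted geq s ->
  (Defs.shape P Q == s) = perm_eq [seq #|D| | D : {set 'I_n} <- enum [set D | is_cycle P Q D]] s.
Proof.
move=> ss; rewrite /Defs.shape union_componentsE; set m := [seq _ | _ <- _].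
apply/eqP/idP => [<-|pe]; first by rewrite perm_sym perm_sort.
apply: (@sorted_eq _ geq) => //.
- by move=> y x z /= h1 h2; apply: leq_trans h2 h1.
- by move=> x y h; apply/eqP; rewrite eqn_leq andbC; exact: h.
- by apply: sort_sorted => x y; apply: leq_total.
- by rewrite perm_sort.
Qed.

Lemma shape1 P Q : (0 < n)%N -> (Defs.shape P Q == [:: n]) = hamiltonian P Q.
Proof.
move=> n0; rewrite shapeP // /hamiltonian; apply/idP/idP => [pe|h].
  have : n \in [:: n] by rewrite inE.
  rewrite -(perm_mem pe) => /mapP[D]; rewrite mem_enum inE => cD nD.
  suff <- : D = [set: 'I_n] by [].
  by apply/eqP; rewrite eqEcard subsetT cardsT card_ord -nD leqnn.
have -> : [set D | is_cycle P Q D] = [set [set: 'I_n]].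
  apply/setP => D; rewrite !inE; apply/idP/eqP => [cD|-> //].
  have /is_cycleP[/set0Pn[x xD] _ _] := cD.
  by rewrite (cycle_component cD xD) [RHS](cycle_component h (in_setT x)).
by rewrite enum_set1 /= cardsT card_ord.
Qed.

Definition split_pair a b P Q :=
  [&& mate P a == b, mate Q a == b & is_cycle P Q (~: [set a; b])].

Lemma cycle_pair P Q a : mate P a = mate Q a -> is_cycle P Q [set a; mate P a].
Proof.
move=> e; have := set11 P; rewrite -(cycle_on_pair P a) => /cycle_onP[_ /is_cycleP[D0 cD minD]].
have sub S : S \subset [set a; mate P a] -> mclosed P Q S = mclosed P P S.
  move=> SD; have mE x : x \in S -> mate Q x = mate P x.
    move/(subsetP SD); rewrite !inE => /orP[]/eqP->; first by [].
    by rewrite {1}e !mateK.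
  by apply/mclosedP/mclosedP => h x xS; have [] := h x xS; rewrite mE.
apply/is_cycleP; split=> //; first by rewrite sub.
by move=> S SD S0; rewrite sub //; apply: minD.
Qed.

(** The bound on [n] makes the two parts different, so the component of size [2] is the common edge
    and the other one its complement. *)
Lemma shape2 P Q : (4 < n)%N -> (Defs.shape P Q == [:: n - 2; 2])%N =
  [exists a, exists b, split_pair a b P Q].
Proof.
move=> n4; rewrite shapeP /=; last by rewrite andbT; lia.
apply/idP/existsP => [pe|[a /existsP[b /and3P[/eqP Pa /eqP Qa cD]]]].
  have m2 : 2 \in [:: n - 2; 2]%N by rewrite !inE orbT.
  have m1 : (n - 2)%N \in [:: n - 2; 2]%N by rewrite !inE eqxx.
  rewrite -(perm_mem pe) in m1; rewrite -(perm_mem pe) in m2.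
  case/mapP: m2 => D; rewrite mem_enum inE => cD D2.
  case/mapP: m1 => D'; rewrite mem_enum inE => cD' Dn.
  have nDD : D != D' by apply: contra_eq_neq D2 => ->; lia.
  have dis : [disjoint D & D'].
    apply/pred0P => x /=; apply: contraNF nDD => /andP[xD xD'].
    by rewrite (cycle_component cD xD) [X in _ == X](cycle_component cD' xD').
  have D'E : D' = ~: D.
    apply/eqP; rewrite eqEcard; apply/andP; split.
      by rewrite -disjoints_subset disjoint_sym.
    by have := cardsC D; rewrite card_ord -D2 -Dn; lia.
  have /is_cycleP[/set0Pn[a aD] /mclosedP clD _] := cD.
  have [pD qD] := clD a aD.
  have pE : [set a; mate P a] = D.
    apply/eqP; rewrite eqEcard -D2 cards2 eq_sym mate_neq leqnn andbT.
    by rewrite subUset !sub1set aD pD.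
  exists a; apply/existsP; exists (mate P a); rewrite /split_pair eqxx pE -D'E cD' andbT /=.
  move: qD; rewrite -pE !inE => /orP[]/eqP e; last by rewrite e.
  by have := mate_neq Q a; rewrite e eqxx.
have cab : is_cycle P Q [set a; b] by rewrite -Pa; apply: cycle_pair; rewrite Pa Qa.
have -> : [set D | is_cycle P Q D] = [set (~: [set a; b]); [set a; b]].
  apply/setP => D; rewrite !inE; apply/idP/orP => [cE|[]/eqP-> //].
  have /is_cycleP[/set0Pn[x xD] _ _] := cE.
  have [xab|xab] := boolP (x \in [set a; b]); [right|left].
    by rewrite (cycle_component cE xD) [X in _ == X](cycle_component cab xab).
  have xab' : x \in ~: [set a; b] by rewrite inE.
  by rewrite (cycle_component cE xD) [X in _ == X](cycle_component cD xab').
have ne : ~: [set a; b] != [set a; b].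
  apply/eqP => /setP/(_ a); rewrite !inE eqxx //.
apply: (@perm_trans _ [seq #|D| | D : {set 'I_n} <- [:: ~: [set a; b]; [set a; b]]]).
  apply: perm_map; apply: uniq_perm; rewrite ?enum_uniq //=; first by rewrite inE ne.
  by move=> D; rewrite mem_enum !inE.
have c2 : #|[set a; b]| = 2 by rewrite cards2 -Pa eq_sym mate_neq.
by rewrite /= c2 cardsCs setCK c2 card_ord.
Qed.

Lemma split_pair_act s a b P Q :
  split_pair (s a) (s b) (pm_act P s) (pm_act Q s) = split_pair a b P Q.
Proof.
rewrite /split_pair !mate_act !(inj_eq perm_inj); congr [&& _, _ & _].
rewrite -[RHS](is_cycle_act P Q s); congr is_cycle.
by rewrite -[s @: _]preim_permV preimsetC preim_permV imsetU1 imset_set1.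
Qed.

End Shapes.

(** * Matchings through a fixed edge *)

Section Extension.
Variable m : nat.
Implicit Types (P Q : pmatching m) (R : pmatching m.+2).

Definition wid (i : 'I_m) : 'I_m.+2 := widen_ord (leqW (leqnSn m)) i.
Definition last0 : 'I_m.+2 := Ordinal (ltnW (ltnSn m.+1)).
Definition last1 : 'I_m.+2 := ord_max.

Lemma wid_inj : injective wid.
Proof. by move=> i j /(congr1 val) /= e; apply: val_inj. Qed.

Lemma last01 : last0 != last1.
Proof. by rewrite -(inj_eq val_inj) /= ltn_eqF. Qed.

Lemma wid_last0 i : wid i != last0.
Proof. by rewrite -(inj_eq val_inj) /= ltn_eqF. Qed.

Lemma wid_last1 i : wid i != last1.
Proof. by rewrite -(inj_eq val_inj) /= ltn_eqF // ltnW // ltnS. Qed.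

Lemma wid_case (x : 'I_m.+2) : [\/ exists i, x = wid i, x = last0 | x = last1].
Proof.
have [lt|] := ltnP x m; first by constructor 1; exists (Ordinal lt); apply: val_inj.
rewrite leq_eqVlt => /orP[/eqP e|gt]; first by constructor 2; apply: val_inj.
by constructor 3; apply: val_inj => /=; have := ltn_ord x; lia.
Qed.

Definition extf P (x : 'I_m.+2) : 'I_m.+2 :=
  if insub (x : nat) is Some i then wid (mate P i)
  else if x == last0 then last1 else last0.

Lemma extf_wid P i : extf P (wid i) = wid (mate P i).
Proof. by rewrite /extf /= valK. Qed.

Lemma extf_last0 P : extf P last0 = last1.
Proof. by rewrite /extf insubF ?eqxx //= ltnn. Qed.

Lemma extf_last1 P : extf P last1 = last0.
Proof.
rewrite /extf insubF; last by rewrite ltnNge leqnSn.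
by rewrite [_ == _]eq_sym (negPf last01).
Qed.

Lemma extfK P : involutive (extf P).
Proof.
move=> x; case: (wid_case x) => [[i ->]|->|->]; first by rewrite !extf_wid mateK.
  by rewrite extf_last0 extf_last1.
by rewrite extf_last1 extf_last0.
Qed.

Lemma extf_neq P x : extf P x != x.
Proof.
case: (wid_case x) => [[i ->]|->|->].
- by rewrite extf_wid (inj_eq wid_inj) mate_neq.
- by rewrite extf_last0 eq_sym last01.
- by rewrite extf_last1 last01.
Qed.

Definition ext P : pmatching m.+2 := sval (of_mate (extfK P) (extf_neq P)).

Lemma mate_ext P : mate (ext P) =1 extf P.
Proof. exact: (svalP (of_mate (extfK P) (extf_neq P))). Qed.

Lemma mate_ext_wid P i : mate (ext P) (wid i) = wid (mate P i).
Proof. by rewrite mate_ext extf_wid. Qed.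

Lemma mate_ext_last P : mate (ext P) last0 = last1.
Proof. by rewrite mate_ext extf_last0. Qed.

Lemma ext_inj : injective ext.
Proof.
move=> P Q e; apply: eq_mate => i; apply: wid_inj.
by rewrite -!mate_ext_wid e.
Qed.

Lemma ext_onto R : mate R last0 = last1 -> exists P, R = ext P.
Proof.
move=> R0; have R1 : mate R last1 = last0 by rewrite -R0 mateK.
have ex i : exists j, mate R (wid i) == wid j.
  case: (wid_case (mate R (wid i))) => [[j ->]|e|e]; first by exists j.
    by have := wid_last1 i; rewrite -R0 -e mateK eqxx.
  by have := wid_last0 i; rewrite -R1 -e mateK eqxx.
pose h i := xchoose (ex i).
have hP i : mate R (wid i) = wid (h i) by apply/eqP/(xchooseP (ex i)).
have hK : involutive h by move=> i; apply: wid_inj; rewrite -!hP mateK.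
have hN i : h i != i by rewrite -(inj_eq wid_inj) -hP mate_neq.
have [P PE] := of_mate hK hN; exists P; apply: eq_mate => x.
case: (wid_case x) => [[i ->]|->|->].
- by rewrite mate_ext_wid hP PE.
- by rewrite mate_ext_last.
- by rewrite R1 mate_ext extf_last1.
Qed.

Lemma big_ext (C : numClosedFieldType) (F : pmatching m.+2 -> C) :
  \sum_P F (ext P) = \sum_(R | mate R last0 == last1) F R.
Proof.
rewrite -(big_imset _ (in2W ext_inj)); apply: eq_bigl => R.
apply/imsetP/eqP => [[P _ ->]|/ext_onto[P ->]]; first exact: mate_ext_last.
by exists P.
Qed.

Lemma wid_compl (S : {set 'I_m.+2}) : S \subset ~: [set last0; last1] ->
  wid @: (wid @^-1: S) = S.
Proof.
move/subsetP => sub; apply/setP => x.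
apply/imsetP/idP => [[i]|xS]; first by rewrite inE => + ->.
have := sub x xS; rewrite !inE negb_or => /andP[x0 x1].
case: (wid_case x) => [[i xi]|e|e]; last 2 first.
- by rewrite e eqxx in x0.
- by rewrite e eqxx in x1.
by exists i; rewrite // inE -xi.
Qed.

Lemma is_cycle_ext P Q : is_cycle (ext P) (ext Q) (~: [set last0; last1]) = hamiltonian P Q.
Proof.
have DE : ~: [set last0; last1] = wid @: [set: 'I_m].
  apply/setP => x; rewrite !inE; apply/idP/imsetP => [|[i _ ->]]; last first.
    by rewrite (negPf (wid_last0 i)) (negPf (wid_last1 i)).
  rewrite negb_or; case: (wid_case x) => [[i ->]|->|->]; rewrite ?eqxx ?andbF //.
  by move=> _; exists i.
have cE (A : {set 'I_m}) : mclosed (ext P) (ext Q) (wid @: A) = mclosed P Q A.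
  apply/mclosedP/mclosedP => [h i iA|h _ /imsetP[i /h[h1 h2] ->]].
    have [] := h (wid i) (imset_f _ iA); rewrite !mate_ext_wid !(mem_imset _ _ wid_inj).
    by [].
  by rewrite !mate_ext_wid !(mem_imset _ _ wid_inj).
rewrite DE; apply/is_cycleP/is_cycleP => -[D0 cD minD]; split.
- by rewrite imset_eq0 in D0.
- by rewrite -cE.
- move=> A _ A0 cA; apply: (imset_inj wid_inj); apply: minD.
  + exact: imsetS (subsetT A).
  + by rewrite imset_eq0.
  + by rewrite cE.
- by rewrite imset_eq0.
- by rewrite cE.
- move=> S SD S0 cS; have SE := wid_compl (S := S); rewrite -DE in SD.
  rewrite -(SE SD) in S0 cS *; rewrite (minD (wid @^-1: S)) ?subsetT //.
    by rewrite imset_eq0 in S0.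
  by rewrite -cE.
Qed.

Lemma ext_split_pair P Q : split_pair last0 last1 (ext P) (ext Q) = hamiltonian P Q.
Proof. by rewrite /split_pair !mate_ext_last !eqxx is_cycle_ext. Qed.

Lemma ext_tperm P i j : ext (pm_act P (tperm i j)) = pm_act (ext P) (tperm (wid i) (wid j)).
Proof.
have tw k : tperm (wid i) (wid j) (wid k) = wid (tperm i j k).
  by rewrite -inj_tperm //; apply: wid_inj.
apply: eq_mate => x; rewrite [RHS]mate_actE tpermV.
case: (wid_case x) => [[k ->]|->|->].
- by rewrite tw !mate_ext_wid tw mate_actE tpermV.
- by rewrite mate_ext_last [tperm _ _ last0]tpermD ?wid_last0 // mate_ext_last tpermD ?wid_last1.
- have E A : mate (ext A) last1 = last0 by rewrite mate_ext extf_last1.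
  by rewrite E [tperm _ _ last1]tpermD ?wid_last1 // E tpermD ?wid_last0.
Qed.

End Extension.

Section Orbit.
Variable n : nat.

Definition fix2 (a b : 'I_n) := #|[set g : 'S_n | (g a == a) && (g b == b)]|.

Lemma fix2_gt0 a b : (0 < fix2 a b)%N.
Proof. by apply/card_gt0P; exists 1%g; rewrite inE !perm1 !eqxx. Qed.

Lemma two_transitive (a b c d : 'I_n) : a != b -> c != d ->
  exists g : 'S_n, g a = c /\ g b = d.
Proof.
move=> nab ncd; pose b' := tperm a c b.
have nb'c : b' != c by rewrite /b' -[X in _ != X](tpermL a c) (inj_eq perm_inj) eq_sym.
exists (tperm a c * tperm b' d)%g; rewrite !permM tpermL tpermD // 1?eq_sym //.
by rewrite -/b' tpermL.
Qed.

(** Each ordered pair of distinct points is the value [(g a, g b)] on one coset of the pointwise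
    stabilizer of [a] and [b]. *)
Lemma sum_two_transitive (C : numClosedFieldType) (F : 'I_n -> 'I_n -> C) a b : a != b ->
  \sum_(g : 'S_n) F (g a) (g b) = (fix2 a b)%:R * \sum_c \sum_(d | c != d) F c d.
Proof.
move=> nab; rewrite pair_big_dep /= mulr_sumr.
rewrite (partition_big (fun g : 'S_n => (g a, g b)) (fun p => p.1 != p.2)) /=; last first.
  by move=> g _; rewrite (inj_eq perm_inj).
apply: eq_bigr => -[c d] /= ncd.
rewrite (eq_bigr (fun=> F c d)) => [|g /eqP[-> ->] //].
rewrite sumr_const mulr_natl; congr (_ *+ _).
have [h [ha hb]] := two_transitive nab ncd.
rewrite /fix2 -[RHS](card_imset _ (mulIg h)); apply: eq_card => g; rewrite [LHS]unfold_in /=.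
apply/andP/imsetP => [[/eqP ga /eqP gb]|[g']].
  exists (g * h^-1)%g; last by rewrite mulgKV.
  by rewrite inE !permM ga gb -ha -hb !permK !eqxx.
by rewrite inE => /andP[/eqP ga /eqP gb] ->; rewrite !permM ga gb ha hb !eqxx.
Qed.

End Orbit.

Section Restriction.
Variables (C : numClosedFieldType) (m : nat).
Local Notation n := m.+2.
Implicit Types (P Q : pmatching m) (R : pmatching n) (z : pmatching n -> C).

(** Instead of varying the edge, [z] is translated by [g] and restricted to the last edge. *)
Definition res z (g : 'S_n) : pmatching m -> C := fun P => z (pm_act (ext P) g).

Local Notation l0 := (last0 m).
Local Notation l1 := (last1 m).

(** Transfer of quadratic forms: summed over [g], a form on the restrictions becomes a form on [z]
    whose kernel is a sum over ordered pairs of vertices. *)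
Lemma sum_res (k : 'I_n -> 'I_n -> pmatching n -> pmatching n -> C) z :
  (forall (g : 'S_n) a b R R', k (g a) (g b) (pm_act R g) (pm_act R' g) = k a b R R') ->
  (forall R R', k l0 l1 R R' != 0 -> mate R l0 = l1 /\ mate R' l0 = l1) ->
  \sum_(g : 'S_n) \sum_P \sum_Q k l0 l1 (ext P) (ext Q) * (res z g P * res z g Q) =
  (fix2 l0 l1)%:R * \sum_R \sum_R' (z R * z R') * \sum_a \sum_(b | a != b) k a b R R'.
Proof.
move=> kinv ksupp.
transitivity (\sum_(g : 'S_n) \sum_R \sum_R' k (g l0) (g l1) R R' * (z R * z R')).
  apply: eq_bigr => g _.
  transitivity (\sum_R \sum_R' k l0 l1 R R' * (z (pm_act R g) * z (pm_act R' g))).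
    under eq_bigr do rewrite (big_ext (fun R' => k l0 l1 (ext _) R' * (_ * z (pm_act R' g)))).
    rewrite (big_ext (fun R => \sum_(R' | mate R' l0 == l1)
       k l0 l1 R R' * (z (pm_act R g) * z (pm_act R' g)))).
    have off R R' : ~~ ((mate R l0 == l1) && (mate R' l0 == l1)) -> k l0 l1 R R' = 0.
      by apply: contraNeq => /ksupp[-> ->]; rewrite eqxx.
    rewrite big_mkcond; apply: eq_bigr => R _; case: ifP => R0.
      rewrite big_mkcond; apply: eq_bigr => R' _; case: ifP => // R'0.
      by rewrite off ?mul0r // R'0 andbF.
    by rewrite big1 // => R' _; rewrite off ?mul0r // R0.
  rewrite [RHS](reindex_inj (@pm_act_inj n g)); apply: eq_bigr => R _.
  rewrite [RHS](reindex_inj (@pm_act_inj n g)); apply: eq_bigr => R' _.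
  by rewrite kinv.
rewrite exchange_big mulr_sumr; apply: eq_bigr => R _.
rewrite exchange_big mulr_sumr; apply: eq_bigr => R' _.
rewrite -mulr_suml (sum_two_transitive (fun a b => k a b R R') (last01 m)).
by rewrite -mulrA; congr (_ * _); rewrite mulrC.
Qed.

Definition hamK j (P Q : pmatching j) : C := (hamiltonian P Q)%:R.

Definition twoK (R R' : pmatching n) : C := [exists a, exists b, split_pair a b R R']%:R.

Lemma split_pair_sym a b R R' : split_pair a b R R' = split_pair b a R R'.
Proof.
rewrite /split_pair [[set b; a]]setUC.
have h (S : pmatching n) : (mate S a == b) = (mate S b == a).
  by apply/eqP/eqP => <-; rewrite mateK.
by rewrite !h.
Qed.

(** The common edge is unique because its complement is a cycle of length greater than [2]; it is
    counted in both orders. *)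
Lemma sum_split_pair R R' : (2 < m)%N ->
  \sum_a \sum_(b | a != b) (split_pair a b R R')%:R = 2 * twoK R R' :> C.
Proof.
move=> m2; rewrite /twoK; case: existsP => [[a0 /existsP[b0 sp]]|none]; last first.
  rewrite mulr0 big1 // => a _; rewrite big1 // => b _; case sp: split_pair => //.
  by case: none; exists a; apply/existsP; exists b.
have [/eqP Ra /eqP R'a cD] := and3P sp.
have nab : a0 != b0 by rewrite -Ra eq_sym mate_neq.
have uni a b : split_pair a b R R' = ((a == a0) && (b == b0)) || ((a == b0) && (b == a0)).
  apply/idP/orP => [sp'|[]/andP[/eqP-> /eqP->]]; rewrite // 1?split_pair_sym //.
  have [/eqP Ra' /eqP R'a' cD'] := and3P sp'.
  have nab' : a != b by rewrite -Ra' eq_sym mate_neq.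
  have [ain|aout] := boolP (a \in [set a0; b0]).
    move: ain; rewrite !inE => /orP[]/eqP e; [left|right]; rewrite e eqxx /=.
      by rewrite -Ra' e Ra.
    by rewrite -Ra' e -Ra mateK.
  have cab : is_cycle R R' [set a; b] by rewrite -Ra'; apply: cycle_pair; rewrite Ra' R'a'.
  have aC : a \in ~: [set a0; b0] by rewrite inE.
  have := cycle_component cab (set21 a b); rewrite -(cycle_component cD aC).
  move/(congr1 (fun S : {set _} => #|S|)) => /=; rewrite [#|~: _|]cardsCs setCK !cards2 nab nab' card_ord.
  by clear -m2; lia.
have delta (c : 'I_n) : \sum_b (b == c)%:R = 1 :> C.
  by rewrite (bigD1 c) //= eqxx big1 ?addr0 // => b /negPf->.
have uniC a b : (split_pair a b R R')%:R =
    (a == a0)%:R * (b == b0)%:R + (a == b0)%:R * (b == a0)%:R :> C.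
  rewrite uni; case: (a =P a0) => [->|_]; case: (a0 =P b0) nab => // _ _.
    by rewrite orbF mul0r addr0 mul1r.
  by case: (a == b0); rewrite ?mul0r ?add0r ?mul1r.
rewrite (eq_bigr (fun a => (a == a0)%:R + (a == b0)%:R)) => [|a _].
  by rewrite big_split /= !delta; ring.
rewrite big_mkcond (eq_bigr (fun b => (a == a0)%:R * (b == b0)%:R + (a == b0)%:R * (b == a0)%:R)).
  by rewrite big_split /= -!mulr_sumr !delta !mulr1.
move=> b _; rewrite uniC; case: eqP => //= <-.
have h : ((a == a0) && (a == b0)) = false.
  by case: eqP => //= ->; rewrite (negPf nab).
by move: h; case: (a == a0); case: (a == b0) => //= _; rewrite ?mulr0 ?mul0r addr0.
Qed.

Lemma sum_res_hamiltonian z : (2 < m)%N ->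
  \sum_(g : 'S_n) dot (app (@hamK m) (res z g)) (res z g) =
  (fix2 l0 l1)%:R * (2 * dot (app twoK z) z).
Proof.
move=> m2; pose k a b R R' : C := (split_pair a b R R')%:R.
have kinv (g : 'S_n) a b R R' : k (g a) (g b) (pm_act R g) (pm_act R' g) = k a b R R'.
  by rewrite /k split_pair_act.
have ksupp R R' : k l0 l1 R R' != 0 -> mate R l0 = l1 /\ mate R' l0 = l1.
  by rewrite pnatr_eq0 eqb0 negbK => /and3P[/eqP-> /eqP->].
have e := sum_res z kinv ksupp; transitivity (\sum_(g : 'S_n) \sum_P \sum_Q
    (split_pair l0 l1 (ext P) (ext Q))%:R * (res z g P * res z g Q)).
  apply: eq_bigr => g _; apply: eq_bigr => P _; rewrite /app mulr_suml.
  apply: eq_bigr => Q _; rewrite ext_split_pair /hamK -mulrA; congr (_ * _).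
  by rewrite mulrC.
rewrite e; congr (_ * _); rewrite /dot mulr_sumr; apply: eq_bigr => R _.
rewrite /app mulr_suml mulr_sumr; apply: eq_bigr => R' _.
by rewrite sum_split_pair //; ring.
Qed.

Lemma sum_res_norm z :
  \sum_(g : 'S_n) dot (res z g) (res z g) = (fix2 l0 l1)%:R * (n%:R * dot z z).
Proof.
pose k a b R R' : C := ((mate R a == b) && (R == R'))%:R.
have kinv (g : 'S_n) a b R R' : k (g a) (g b) (pm_act R g) (pm_act R' g) = k a b R R'.
  by rewrite /k mate_act (inj_eq perm_inj) (inj_eq (@pm_act_inj _ g)).
have ksupp R R' : k l0 l1 R R' != 0 -> mate R l0 = l1 /\ mate R' l0 = l1.
  by rewrite pnatr_eq0 eqb0 negbK => /andP[/eqP h /eqP<-].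
have e := sum_res z kinv ksupp; transitivity (\sum_(g : 'S_n) \sum_P \sum_Q
    ((mate (ext P) l0 == l1) && (ext P == ext Q))%:R * (res z g P * res z g Q)).
  apply: eq_bigr => g _; apply: eq_bigr => P _; rewrite (bigD1 P) //= big1 ?addr0.
    by rewrite mate_ext_last !eqxx mul1r.
  by move=> Q nQP; rewrite (inj_eq (@ext_inj m)) [P == Q]eq_sym (negPf nQP) andbF mul0r.
rewrite e; congr (_ * _); rewrite /dot mulr_sumr; apply: eq_bigr => R _.
rewrite (bigD1 R) //= [X in _ + X]big1 ?addr0 => [|R' nR]; last first.
  rewrite big1 ?mulr0 // => a _; rewrite big1 // => b _.
  by rewrite /k [R == R']eq_sym (negPf nR) andbF.
rewrite mulrC; congr (_ * _); rewrite (eq_bigr (fun=> 1)) => [|a _].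
  by rewrite sumr_const card_ord.
rewrite (bigD1 (mate R a)) 1?eq_sym ?mate_neq //= /k !eqxx big1 ?addr0 // => b.
by case/andP => _ nb; rewrite [mate R a == b]eq_sym (negPf nb).
Qed.

(** Ordered pairs with [u = v] included, to agree with [content_sum]. *)
Definition transK j (P Q : pmatching j) : C :=
  \sum_u \sum_v (pm_act P (tperm u v) == Q)%:R.

Lemma app_transK j (z : pmatching j -> C) (P : pmatching j) :
  app (@transK j) z P = \sum_u \sum_v z (pm_act P (tperm u v)).
Proof.
rewrite /app /transK; under eq_bigr do rewrite mulr_suml.
rewrite exchange_big; apply: eq_bigr => u _.
under eq_bigr do rewrite mulr_suml.
rewrite exchange_big; apply: eq_bigr => v _.
rewrite (bigD1 (pm_act P (tperm u v))) //= eqxx mul1r big1 ?addr0 // => Q.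
by rewrite eq_sym => /negPf->; rewrite mul0r.
Qed.

Lemma card_off R u v : (1 < m)%N ->
  #|[set a | [&& a != u, a != v, mate R a != u & mate R a != v]]|
  = (n - 4 + 2 * ((u == v) || (v == mate R u)))%N.
Proof.
move=> m1; have -> : [set a | [&& a != u, a != v, mate R a != u & mate R a != v]]
   = ~: [set u; v; mate R u; mate R v].
  apply/setP => a; rewrite !inE !negb_or -!andbA.
  have h w : (mate R a == w) = (a == mate R w) by apply/eqP/eqP => [<-|->]; rewrite mateK.
  by rewrite !h.
rewrite cardsCs setCK card_ord.
have c2 : #|[set u; mate R u]| = 2 by rewrite cards2 eq_sym mate_neq.
have [->|nuv] := eqVneq u v.
  have -> : [set v; v; mate R v; mate R v] = [set v; mate R v].
    by apply/setP => x; rewrite !inE orbb -orbA orbb.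
  by rewrite cards2 eq_sym mate_neq; clear -m1; lia.
have [->|nvm] := eqVneq v (mate R u).
  have -> : [set u; mate R u; mate R u; mate R (mate R u)] = [set u; mate R u].
    by apply/setP => x; rewrite !inE mateK; case: (x == u); case: (x == mate R u).
  by rewrite c2 orbT; clear -m1; lia.
rewrite !orFb muln0 addn0; congr (_ - _)%N.
have nmm : mate R u != mate R v by rewrite (inj_eq (@mate_inj _ R)).
have num : u != mate R v by apply: contraNneq nvm => ->; rewrite mateK.
rewrite -!setUA !cardsU1 cards1 !inE !negb_or nuv num nmm nvm /=.
by rewrite eq_sym mate_neq eq_sym mate_neq.
Qed.

Lemma big_wid (F : 'I_n -> C) : \sum_i F (wid i) = \sum_(u | (u != l0) && (u != l1)) F u.
Proof.
rewrite -(big_imset _ (in2W (@wid_inj m))); apply: eq_bigl => u.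
apply/imsetP/andP => [[i _ ->]|]; first by rewrite wid_last0 wid_last1.
by case: (wid_case u) => [[i ->]|->|->]; rewrite ?eqxx; [exists i|case|case].
Qed.

(** The pair [(u, v)] is seen from every edge avoiding both points: [n - 4] oriented edges, and two
    more when [u = v] or [v] is the partner of [u]. In these [2 * n] cases the matching is fixed,
    whence the term [4 * n]. *)
Lemma sum_res_trans z : (1 < m)%N ->
  \sum_(g : 'S_n) dot (app (@transK m) (res z g)) (res z g) =
  (fix2 l0 l1)%:R * ((n - 4)%:R * dot (app (@transK n) z) z + (4 * n)%:R * dot z z).
Proof.
move=> m1; pose k (a b : 'I_n) (R R' : pmatching n) : C := \sum_u \sum_v
  [&& mate R a == b, (u != a) && (u != b), (v != a) && (v != b) & pm_act R (tperm u v) == R']%:R.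
have kinv (g : 'S_n) a b R R' : k (g a) (g b) (pm_act R g) (pm_act R' g) = k a b R R'.
  rewrite /k [LHS](reindex_inj (@perm_inj _ g)); apply: eq_bigr => u _.
  rewrite [LHS](reindex_inj (@perm_inj _ g)); apply: eq_bigr => v _.
  rewrite mate_act !(inj_eq perm_inj) -tpermJ pm_actM conjgE !mulgA mulgV mul1g -pm_actM.
  by rewrite (inj_eq (@pm_act_inj _ g)).
have ksupp R R' : k l0 l1 R R' != 0 -> mate R l0 = l1 /\ mate R' l0 = l1.
  move=> nz; have [/existsP[u /existsP[v /and4P[/eqP h1 /andP[u0 u1] /andP[v0 v1] /eqP <-]]]|none] :=
    boolP [exists u, exists v, [&& mate R l0 == l1, (u != l0) && (u != l1),
      (v != l0) && (v != l1) & pm_act R (tperm u v) == R']]; last first.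
    case/eqP: nz; rewrite /k big1 // => u _; rewrite big1 // => v _.
    case h: [&& _, _, _ & _] => //; case/negP: none.
    by apply/existsP; exists u; apply/existsP; exists v.
  by split=> //; rewrite mate_actE tpermV [tperm u v l0]tpermD // h1 tpermD.
have e := sum_res z kinv ksupp; transitivity (\sum_(g : 'S_n) \sum_P \sum_Q
    k l0 l1 (ext P) (ext Q) * (res z g P * res z g Q)).
  apply: eq_bigr => g _; apply: eq_bigr => P _; rewrite /app mulr_suml.
  apply: eq_bigr => Q _; rewrite -mulrA [res z g Q * _]mulrC; congr (_ * _).
  rewrite /transK /k; under eq_bigr => i _.
    under eq_bigr => j _ do rewrite -(inj_eq (@ext_inj m)) ext_tperm.
    rewrite (big_wid (fun v => (pm_act (ext P) (tperm (wid i) v) == ext Q)%:R)).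
    over.
  rewrite (big_wid (fun u => \sum_(v | (v != l0) && (v != l1))
     (pm_act (ext P) (tperm u v) == ext Q)%:R)) big_mkcond.
  apply: eq_bigr => u _; rewrite mate_ext_last eqxx /=; case: ifP => _ /=.
    by rewrite big_mkcond; apply: eq_bigr => v _; case: ifP.
  by rewrite big1.
rewrite e; congr (_ * _).
transitivity (\sum_R \sum_u \sum_v z R * z (pm_act R (tperm u v)) *
   (n - 4 + 2 * ((u == v) || (v == mate R u)))%N%:R).
  apply: eq_bigr => R _.
  transitivity (\sum_R' \sum_u \sum_v (z R * z R') * ((pm_act R (tperm u v) == R')%:R
     * (n - 4 + 2 * ((u == v) || (v == mate R u)))%N%:R)).
    apply: eq_bigr => R' _.
    under [RHS]eq_bigr do rewrite -mulr_sumr.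
    rewrite -mulr_sumr; congr (_ * _).
    transitivity (\sum_a \sum_(b | a != b) \sum_u \sum_v
       ([&& mate R a == b, (u != a) && (u != b), (v != a) && (v != b) & pm_act R (tperm u v) == R']%:R : C)) => //.
    transitivity (\sum_a \sum_u \sum_v
       ([&& (a != u) && (a != v), (mate R a != u) && (mate R a != v) & pm_act R (tperm u v) == R']%:R : C)).
      apply: eq_bigr => a _; rewrite (bigD1 (mate R a)) 1?eq_sym ?mate_neq //=.
      rewrite [X in _ + X]big1 ?addr0 => [|b /andP[_ nb]]; last first.
        by rewrite big1 // => u _; rewrite big1 // => v _; rewrite eq_sym (negPf nb).
      apply: eq_bigr => u _; apply: eq_bigr => v _; rewrite eqxx /=; congr (_%:R).
      rewrite [u == a]eq_sym [v == a]eq_sym [u == _]eq_sym [v == _]eq_sym.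
      by do 5!case: (_ == _).
    rewrite exchange_big; apply: eq_bigr => u _.
    rewrite exchange_big; apply: eq_bigr => v _.
    rewrite -card_off // -sum1_card natr_sum mulr_sumr [RHS]big_mkcond.
    apply: eq_bigr => a _; rewrite inE mulr1.
    by do 5!case: (_ == _).
  rewrite exchange_big; apply: eq_bigr => u _.
  rewrite exchange_big; apply: eq_bigr => v _.
  rewrite (bigD1 (pm_act R (tperm u v))) //= eqxx mul1r big1 ?addr0 // => R'.
  by rewrite eq_sym => /negPf->; rewrite mul0r mulr0.
rewrite {1}/dot mulr_sumr [X in _ + X]mulr_sumr -big_split; apply: eq_bigr => R _ /=.
rewrite app_transK; under eq_bigr => u _ do under eq_bigr => v _ do rewrite natrD mulrDr.
under eq_bigr do rewrite big_split /=.
rewrite big_split /=; congr (_ + _).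
  rewrite mulr_suml mulr_sumr; apply: eq_bigr => u _.
  by rewrite mulr_suml mulr_sumr; apply: eq_bigr => v _; ring.
rewrite (eq_bigr (fun=> 4 * (z R * z R))) => [|u _].
  rewrite sumr_const card_ord -mulr_natl natrM; ring.
rewrite (bigD1 u) //= (bigD1 (mate R u)) 1?mate_neq //= big1 ?addr0 => [|v /andP[nv nmv]].
  rewrite !eqxx orbT tperm1 pm_act1 act_tperm_mate /= muln1; ring.
by rewrite eq_sym (negPf nv) (negPf nmv) muln0 mulr0.
Qed.

End Restriction.

(** * Orthogonal decomposition of functions on matchings *)

Section Decomposition.
Variables (C : numClosedFieldType) (n : nat).
Local Notation tableau := {ffun 'I_n -> 'I_n * 'I_n}.
Implicit Types (P Q : pmatching n) (z : pmatching n -> C) (t : tableau).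

(** Reads the shape off a tableau, so that the finite type of tableaux provides the list of
    shapes. *)
Definition shape_of t : seq nat :=
  [seq a <- [seq rowcount (tableau_rows t) i | i <- enum 'I_n] | (0 < a)%N].

Lemma shape_ofE mu t : even_partition n mu -> is_tableau mu t -> shape_of t = mu.
Proof.
move=> mue tt; have pmu := even_is_partition mue; rewrite /shape_of.
have -> : [seq rowcount (tableau_rows t) i | i <- enum 'I_n] = [seq nth 0%N mu i | i <- iota 0 n].
  rewrite -val_enum_ord -map_comp; apply: eq_map => i /=.
  exact: rowcount_tab pmu tt.
have pos := even_partition_pos mue.
have sz : (size mu <= n)%N.
  rewrite leqNgt; apply/negP => lt.
  have p : (0 < nth 0%N mu n)%N by apply: (allP pos); apply: mem_nth.
  by have := part_size pmu p; rewrite ltnn.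
rewrite -(subnKC sz) iotaD map_cat filter_cat -/(mkseq _ _) mkseq_nth add0n.
rewrite (_ : [seq a <- mu | (0 < a)%N] = mu); last exact/all_filterP.
rewrite (_ : filter _ _ = [::]) ?cats0 //; apply/eqP.
rewrite -size_eq0 size_filter -leqn0 leqNgt -has_count; apply/hasPn => a /mapP[i].
by rewrite mem_iota => /andP[le _] ->; rewrite nth_default.
Qed.

Definition good t := even_partition n (shape_of t) && is_tableau (shape_of t) t.

Definition shapes := undup [seq shape_of t | t <- enum good].

Lemma shapes_even mu : mu \in shapes -> even_partition n mu.
Proof. by rewrite mem_undup => /mapP[t]; rewrite mem_enum => /andP[h _] ->. Qed.

(** A column of the cokernel of the matrix of all [xt] is orthogonal to each of them, hence zero by
    completeness. *)
Lemma span_xt z : exists c : tableau -> C, forall P, z P = \sum_(t | good t) c t * xt C t P.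
Proof.
pose X : 'M[C]_(#|{: tableau}|, #|{: pmatching n}|) :=
  \matrix_(i, j) (if good (enum_val i) then xt C (enum_val i) (enum_val j) else 0).
have fullX : row_full X.
  rewrite -cokermx_eq0; apply/eqP/matrixP => a b; rewrite [RHS]mxE.
  have := @xt_complete C n (fun P => cokermx X (enum_rank P) b) _ (enum_val a).
  rewrite enum_valK; apply=> mu t mue tt.
  have gt : good t by rewrite /good (shape_ofE mue tt) mue.
  have := congr1 (fun M : 'M_(_, _) => M (enum_rank t) b) (mulmx_coker X).
  rewrite [LHS]mxE [RHS]mxE => e; rewrite -[RHS]e dotC /dot.
  rewrite [RHS](reindex enum_rank) /=; last by apply: onW_bij; apply: enum_rank_bij.
  by apply: eq_bigr => P _; rewrite [X _ _]mxE !enum_rankK gt.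
have /submxP[D DE] := submx_full (\row_j z (enum_val j)) fullX.
exists (fun t => D 0 (enum_rank t)) => P.
have := congr1 (fun M : 'M_(_, _) => M 0 (enum_rank P)) DE.
rewrite !mxE enum_rankK => ->; rewrite [RHS]big_mkcond.
rewrite [LHS](reindex enum_rank) /=; last by apply: onW_bij; apply: enum_rank_bij.
by apply: eq_bigr => t _; rewrite mxE !enum_rankK; case: good; rewrite ?mulr0.
Qed.

Lemma span_xt_real z : (forall P, (z P)^* = z P) -> exists2 c : tableau -> C,
  forall t, (c t)^* = c t & forall P, z P = \sum_(t | good t) c t * xt C t P.
Proof.
move=> zr; have [c cE] := span_xt z.
exists (fun t => (c t + (c t)^*) / 2).
  by move=> t; rewrite rmorphM rmorphD /= conjCK fmorphV rmorph_nat addrC.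
move=> P; have e1 := cE P; have := zr P; rewrite {1}e1 rmorph_sum /= => e2.
have e3 : \sum_(t | good t) (c t)^* * xt C t P = z P.
  by rewrite -e2; apply: eq_bigr => t _; rewrite rmorphM /= conj_xt.
have -> : \sum_(t | good t) (c t + (c t)^*) / 2 * xt C t P = (z P + z P) / 2.
  rewrite {1}e1 -e3 -big_split mulr_suml; apply: eq_bigr => t _ /=.
  by rewrite mulrAC mulrDl.
by field.
Qed.

Lemma dot_suml I (r : seq I) (p : pred I) (F : I -> pmatching n -> C) z :
  dot (fun P => \sum_(i <- r | p i) F i P) z = \sum_(i <- r | p i) dot (F i) z.
Proof.
rewrite /dot exchange_big; apply: eq_bigr => P _; by rewrite mulr_suml.
Qed.

Lemma app_sum I (r : seq I) (p : pred I) (F : I -> pmatching n -> C) (K : _ -> _ -> C) Q :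
  app K (fun P => \sum_(i <- r | p i) F i P) Q = \sum_(i <- r | p i) app K (F i) Q.
Proof.
rewrite /app exchange_big; apply: eq_bigr => P _; by rewrite mulr_sumr.
Qed.

(** [q mu] is the squared norm of the component of [z] in the span of the [xt] of shape [mu]. A
    single [q] serves all kernels, which is what relates their eigenvalues. *)
Lemma quad_decomp z : (forall P, (z P)^* = z P) -> exists q : seq nat -> C,
  [/\ forall mu, 0 <= q mu,
      forall (K : _ -> _ -> C) (e : seq nat -> C),
        (forall mu t, even_partition n mu -> is_tableau mu t ->
           app K (xt C t) =1 (fun P => e mu * xt C t P)) ->
        dot (app K z) z = \sum_(mu <- shapes) e mu * q mu
    & forall mu, mu \in shapes ->
        (forall t, is_tableau mu t -> dot z (xt C t) = 0) -> q mu = 0].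
Proof.
move=> zr; have [c cr cE] := span_xt_real zr.
pose y mu P := \sum_(t | good t && (shape_of t == mu)) c t * xt C t P.
have zE P : z P = \sum_(mu <- shapes) y mu P.
  rewrite cE /y; under [RHS]eq_bigr do rewrite big_mkcondr.
  rewrite exchange_big; apply: eq_bigr => t gt /=.
  rewrite (bigD1_seq (shape_of t)) ?undup_uniq //=; last first.
    by rewrite mem_undup map_f // mem_enum.
  by rewrite eqxx big1 ?addr0 // => mu; rewrite eq_sym => /negPf->.
have yr mu P : (y mu P)^* = y mu P.
  by rewrite rmorph_sum; apply: eq_bigr => t _; rewrite rmorphM /= cr conj_xt.
have yorth mu la : mu != la -> dot (y mu) (y la) = 0.
  move=> ne; rewrite dot_suml big1 // => t /andP[/andP[gt1 gt2] /eqP et].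
  rewrite dotC dot_suml big1 // => s /andP[/andP[gs1 gs2] /eqP es].
  rewrite dotZl dotC dotZl (dot_xt_orth C gt1 gs1 gt2 gs2) ?mulr0 //.
  by apply/eqP; rewrite et es.
exists (fun mu => dot (y mu) (y mu)); split.
- move=> mu; apply: sumr_ge0 => P _; rewrite -{2}(yr mu P); exact: mul_conjC_ge0.
- move=> K e h.
  have Ky mu Q : app K (y mu) Q = e mu * y mu Q.
    rewrite app_sum mulr_sumr; apply: eq_bigr => t /andP[/andP[g1 g2] /eqP et].
    by rewrite appZ (h _ _ g1 g2) et mulrCA.
  have Kz Q : app K z Q = \sum_(mu <- shapes) e mu * y mu Q.
    by rewrite (eq_app _ _ zE) app_sum; apply: eq_bigr => mu _; rewrite Ky.
  rewrite (dot_eq _ Kz) dot_suml; apply: eq_big_seq => mu muS.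
  rewrite dotZl; congr (_ * _); rewrite dotC (dot_eq _ zE) dot_suml.
  rewrite (bigD1_seq mu) ?undup_uniq //= big1 ?addr0 // => la ne.
  exact: yorth.
- move=> mu muS h.
  have zy : dot z (y mu) = 0.
    rewrite dotC dot_suml big1 // => t /andP[/andP[g1 g2] /eqP et].
    by rewrite dotZl dotC h ?mulr0 // -et.
  move: zy; rewrite (dot_eq _ zE) dot_suml (bigD1_seq mu) ?undup_uniq //=.
  by rewrite big1 ?addr0 // => la ne; apply: yorth.
Qed.

End Decomposition.

(** * Constraints on the shapes in a restriction *)

Section Branching.
Variables (C : numClosedFieldType) (m : nat).
Local Notation n := m.+2.

Lemma dot_swap0 (u v : pmatching m -> C) (s : 'S_m) :
  (forall P, u (pm_act P s) = - u P) -> (forall P, v (pm_act P s) = v P) -> dot u v = 0.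
Proof.
move=> us vs; apply/eqP; rewrite -eqNr; apply/eqP; rewrite /dot -sumrN.
rewrite [RHS](reindex_inj (@pm_act_inj m s)); apply: eq_bigr => P _.
by rewrite us vs mulNr.
Qed.

Lemma pigeonhole (A : {set 'I_m}) (h : 'I_m -> nat) (k : nat) :
  {in A, forall i, h i < k}%N -> (k < #|A|)%N ->
  exists i j, [/\ i \in A, j \in A, i != j & h i = h j].
Proof.
move=> hk kA; have [/existsP[i /existsP[j /and4P[iA jA nij /eqP e]]]|none] :=
  boolP [exists i, exists j, [&& i \in A, j \in A, i != j & h i == h j]]; first by exists i, j.
have inj : {in A &, injective h}.
  move=> i j iA jA e; apply/eqP; apply: contraNT none => nij.
  by apply/existsP; exists i; apply/existsP; exists j; rewrite iA jA nij e eqxx.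
move: kA; rewrite ltnNge cardE -(size_map h) => /negP[].
rewrite -(size_iota 0 k); apply: uniq_leq_size.
  by rewrite map_inj_in_uniq ?enum_uniq // => i j; rewrite !mem_enum; apply: inj.
by move=> a /mapP[i]; rewrite mem_enum => iA ->; rewrite mem_iota hk.
Qed.

Lemma aligned_tperm k (f : {ffun 'I_k -> 'I_k}) P i j : f i = f j ->
  aligned f (pm_act P (tperm i j)) = aligned f P.
Proof.
move=> e; rewrite -[RHS](aligned_act _ _ (tperm i j)); congr aligned.
by apply/ffunP => x; rewrite [RHS]ffunE tpermV; case: tpermP => [->|->|].
Qed.

Variables (mu ka : seq nat) (t : {ffun 'I_n -> 'I_n * 'I_n}) (s : {ffun 'I_m -> 'I_m * 'I_m}).
Hypotheses (mu_even : even_partition n mu) (ka_even : even_partition m ka).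
Hypotheses (t_tab : is_tableau mu t) (s_tab : is_tableau ka s).

Lemma part0_le k la (u : {ffun 'I_k -> 'I_k * 'I_k}) x : even_partition k la -> is_tableau la u ->
  ((u x).2 < nth 0 la 0)%N.
Proof.
by move=> lae ut; apply: leq_trans (tab_lt ut x) (part_nth (even_is_partition lae) (leq0n _)).
Qed.

(** Two positions in the first row of [ka] share a column of [t], as [t] has too few columns. Their
    swap preserves alignment and negates [xt C t]. *)
Lemma branch_le : (0 < m)%N -> (nth 0 mu 0 < nth 0 ka 0)%N ->
  dot (fun P => xt C t (ext P)) (xt C s) = 0.
Proof.
move=> m0 lt; rewrite dot_xt /pol big1 // => g _; set f := relabel _ _.
pose A := [set i | f i == Ordinal m0].
have cA : #|A| = nth 0%N ka 0.
  rewrite -/(rowcount f (Ordinal m0)) rowcount_relabel.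
  by rewrite (rowcount_tab _ (even_is_partition ka_even) s_tab).
have hk : {in A, forall i, (t (wid i)).2 < nth 0 mu 0}%N by move=> i _; apply: part0_le t_tab.
have [|i [j [iA jA nij e]]] := pigeonhole hk; first by rewrite cA.
have fij : f i = f j by move: iA jA; rewrite !inE => /eqP-> /eqP->.
rewrite -[rowsum _ _](_ : dot (fun P => xt C t (ext P)) (fun P => (aligned f P)%:R) = _).
  rewrite (@dot_swap0 _ _ (tperm i j)) ?mulr0 // => P; last by rewrite aligned_tperm.
  rewrite ext_tperm xt_col_tperm; last exact: val_inj.
  by rewrite (inj_eq (@wid_inj m)) nij expr1 mulN1r.
rewrite /dot /rowsum [RHS]big_mkcond; apply: eq_bigr => P _.
by case: aligned; rewrite ?mulr1 ?mulr0.
Qed.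

(** The dual cancellation: the swap negates [xt C s] and preserves an aligned indicator occurring in
    [xt C t]. *)
Lemma branch_rows :
  (forall g, exists i j, [/\ i != j, (s i).2 = (s j).2
     & relabel (tableau_rows t) g (wid i) = relabel (tableau_rows t) g (wid j)]) ->
  dot (fun P => xt C t (ext P)) (xt C s) = 0.
Proof.
move=> h; rewrite {1}/xt /pol dot_suml big1 // => g _; rewrite dotZl.
have [i [j [nij sij fij]]] := h g.
have sw : dot (xt C s) (fun P => (aligned (relabel (tableau_rows t) g) (ext P))%:R) = 0.
  apply: (@dot_swap0 _ _ (tperm i j)) => P.
    by rewrite xt_col_tperm // nij expr1 mulN1r.
  by rewrite ext_tperm aligned_tperm.
by rewrite dotC sw mulr0.
Qed.

(** Without the two ends of the edge, the first row of [t] still has more entries than [s] has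
    columns. *)
Lemma branch_ge : (nth 0 ka 0 + 2 < nth 0 mu 0)%N ->
  dot (fun P => xt C t (ext P)) (xt C s) = 0.
Proof.
move=> lt; apply: branch_rows => g; set f := relabel _ _.
pose A := [set i | f (wid i) == ord0].
have cA : (nth 0%N mu 0 <= #|A| + 2)%N.
  have := rowcount_tab ord0 (even_is_partition mu_even) t_tab.
  rewrite -(rowcount_relabel _ g) -/f /= => <-.
  rewrite /rowcount -(card_imset A (@wid_inj m)) -[2%N](_ : #|[set last0 m; last1 m]| = 2);
    last first.
    by rewrite cards2 last01.
  apply: leq_trans (leq_card_setU _ _); apply: subset_leq_card.
  apply/subsetP => x; rewrite !inE => fx; case: (wid_case x) fx => [[i ->]|->|->] fx.
  - by rewrite imset_f // inE.
  - by rewrite eqxx orbT.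
  - by rewrite eqxx !orbT.
have hk : {in A, forall i, (s i).2 < nth 0 ka 0}%N by move=> i _; apply: part0_le s_tab.
have [|i [j [iA jA nij e]]] := pigeonhole hk.
  by rewrite -(ltn_add2r 2); apply: leq_trans cA.
exists i, j; split=> //; first exact: val_inj.
by move: iA jA; rewrite !inE => /eqP-> /eqP->.
Qed.

Lemma tab_row_size k la (u : {ffun 'I_k -> 'I_k * 'I_k}) x : is_tableau la u ->
  ((u x).1 < size la)%N.
Proof.
move=> ut; rewrite ltnNge; apply/negP => le.
by have := tab_lt ut x; rewrite nth_default.
Qed.

(** The first column of [s] has more entries than [t] has rows. *)
Lemma branch_size : (size mu < size ka)%N ->
  dot (fun P => xt C t (ext P)) (xt C s) = 0.
Proof.
move=> lt; apply: branch_rows => g; set f := relabel _ _.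
pose A := [set i | (s i).2 == 0%N :> nat].
have cA : (size ka <= #|A|)%N.
  rewrite -[leqLHS](size_iota 0) cardE -(size_map (fun i => (s i).1 : nat)).
  apply: uniq_leq_size (iota_uniq _ _) _ => r; rewrite mem_iota /= => rk.
  have p : (0 < nth 0%N ka r)%N by apply: (allP (even_partition_pos ka_even)); apply: mem_nth.
  have [x [x1 x2]] := tab_onto (even_is_partition ka_even) s_tab p.
  by apply/mapP; exists x => //; rewrite mem_enum inE x2.
have hk : {in A, forall i, f (wid i) < size mu}%N.
  by move=> i _; rewrite !ffunE; apply: tab_row_size t_tab.
have [|i [j [iA jA nij e]]] := pigeonhole hk; first exact: leq_trans cA.
exists i, j; split=> //; last exact: val_inj.
by apply: val_inj => /=; move: iA jA; rewrite !inE => /eqP-> /eqP->.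
Qed.

End Branching.

(** * Contents of half diagrams *)

Fixpoint row_content (i p : nat) : int :=
  if p is p'.+1 then row_content i p' * (if (i + p' == 0)%N then 1 else (2 * p')%:Z - i%:Z)
  else 1.

(* [content_prod 0 nu] is the product of [2j - i] over the cells of [nu] other
   than the first one, rows being numbered from [0]. *)
Fixpoint content_prod (i : nat) (nu : seq nat) : int :=
  if nu is p :: nu' then row_content i p * content_prod i.+1 nu' else 1.

(** Each summand is the sum of [2 c + 1 - 2 i] over the [2 p] cells in row [i] of the full
    diagram. *)
Fixpoint trans_content (i : nat) (nu : seq nat) : int :=
  if nu is p :: nu' then 4 * (p%:Z * p%:Z - i%:Z * p%:Z) + trans_content i.+1 nu' else 0.

Definition halves (mu : seq nat) := [seq p./2 | p <- mu].

Section BigTableau.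
Variables (n : nat) (mu : seq nat) (t : {ffun 'I_n -> 'I_n * 'I_n}).
Hypotheses (mu_even : even_partition n mu) (t_tab : is_tableau mu t).

Let mu_part := even_is_partition mu_even.

Lemma big_tab (R : Type) (idx : R) (op : Monoid.com_law idx) (F : nat -> nat -> R) :
  \big[op/idx]_(x < n) F (t x).1 (t x).2 =
  \big[op/idx]_(i <- iota 0 (size mu)) \big[op/idx]_(c <- iota 0 (nth 0%N mu i)) F i c.
Proof.
have sz : (size mu <= n)%N.
  rewrite leqNgt; apply/negP => lt.
  have p : (0 < nth 0%N mu n)%N.
    by apply: (allP (even_partition_pos mu_even)); apply: mem_nth.
  by have := part_size mu_part p; rewrite ltnn.
transitivity (\big[op/idx]_(i <- iota 0 n) \big[op/idx]_(c <- iota 0 (nth 0%N mu i)) F i c).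
  rewrite (partition_big (fun x => (t x).1) xpredT) //=.
  rewrite -[in RHS](subn0 n) -[iota 0 _]/(index_iota 0 n) big_mkord.
  apply: eq_bigr => i _; rewrite (eq_bigr (fun x => F i (t x).2)) => [|x /eqP->//].
  have pe : perm_eq [seq (t x).2 : nat | x <- enum [set x | (t x).1 == i]] (iota 0 (nth 0%N mu i)).
    apply: uniq_perm (iota_uniq _ _) _.
      rewrite map_inj_in_uniq ?enum_uniq // => x y; rewrite !mem_enum !inE.
      by move=> /eqP xi /eqP yi /val_inj e; apply: (tab_eq t_tab); rewrite ?xi ?yi ?e.
    move=> j; rewrite mem_iota /= add0n; apply/mapP/idP => [[x]|].
      by rewrite mem_enum inE => /eqP <- ->; apply: tab_lt.
    case/(tab_onto mu_part t_tab) => x [x1 x2]; exists x => //.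
    by rewrite mem_enum inE; apply/eqP/val_inj.
  rewrite -(perm_big _ pe) big_map big_enum /=.
  by apply: eq_bigl => x; rewrite inE.
rewrite -{1}(subnKC sz) iotaD big_cat /= add0n [X in op _ X]big1_seq ?Monoid.mulm1 //.
by move=> i /andP[_]; rewrite mem_iota => /andP[le _]; rewrite nth_default // big_nil.
Qed.

Lemma halvesK p : p \in mu -> (p./2).*2 = p.
Proof.
case/and3P: mu_even => _ /allP h _ /h/andP[_ /even_halfK]; exact.
Qed.

Lemma big_iota_rows (R : Type) (idx : R) (op : Monoid.com_law idx) (G : nat -> nat -> R) a s :
  \big[op/idx]_(i <- iota 0 (size s)) G (a + i)%N (nth 0%N s i)
  = foldr (fun ip r => op (G ip.1 ip.2) r) idx (zip (iota a (size s)) s).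
Proof.
elim: s a => [|p s IHs] a /=; first by rewrite big_nil.
rewrite big_cons addn0 -[1%N]addn0 iotaDl big_map /=; congr (op _ _).
by rewrite -IHs; apply: eq_bigr => i _; rewrite addnS.
Qed.

Variable C : numClosedFieldType.

Lemma pair_contentE : pair_content C t [set: 'I_n] = (content_prod 0 (halves mu))%:~R.
Proof.
rewrite /pair_content big_mkcond /=.
pose F (r c : nat) : C := if ~~ odd c && (0 < r + c)%N then c%:R - r%:R else 1.
rewrite (eq_bigr (fun x : 'I_n => F (t x).1 (t x).2)) => [|x _]; last by rewrite inE.
rewrite (big_tab _ F).
have rowE r p : \prod_(c <- iota 0 p.*2) F r c = (row_content r p)%:~R.
  elim: p => [|p IHp]; first by rewrite big_nil.
  rewrite doubleS -addn2 iotaD big_cat IHp /= !big_cons big_nil mulr1 rmorphM /=.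
  congr (_ * _); rewrite {2}/F add0n /= odd_double /= mulr1 /F odd_double /=.
  rewrite lt0n !addn_eq0 double_eq0; case: (_ && _) => //=.
  by rewrite rmorphB /= -!pmulrn mul2n.
have e : \prod_(i <- iota 0 (size mu)) \prod_(c <- iota 0 (nth 0%N mu i)) F i c
   = \prod_(i <- iota 0 (size mu)) (row_content (0 + i)%N (nth 0%N mu i)./2)%:~R :> C.
  apply: eq_big_seq => i; rewrite mem_iota add0n => /andP[_ lt].
  by rewrite -rowE halvesK // mem_nth.
rewrite e (big_iota_rows _ (fun i p => (row_content i p./2)%:~R : C)).
elim: {e}mu 0%N => [|p s IHs] a //=.
by rewrite IHs rmorphM.
Qed.

Lemma content_sumE : content_sum C t = (trans_content 0 (halves mu))%:~R.
Proof.
pose F (r c : nat) : C := (2 * c + 1)%N%:R - (2 * r)%N%:R.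
have -> : content_sum C t = \sum_(x < n) F (t x).1 (t x).2.
  by rewrite /content_sum !natr_sum -sumrB.
rewrite (big_tab _ F).
have rowE r p : \sum_(c <- iota 0 p.*2) F r c = (4 * (p%:Z * p%:Z - r%:Z * p%:Z))%:~R.
  have h q : \sum_(c <- iota 0 q) F r c = (q * q)%N%:R - (2 * r * q)%N%:R.
    elim: q => [|q IHq]; first by rewrite big_nil !muln0 subrr.
    by rewrite -addn1 iotaD big_cat IHq /= big_seq1 /F; ring.
  by rewrite h -!mul2n; ring.
have e : \sum_(i <- iota 0 (size mu)) \sum_(c <- iota 0 (nth 0%N mu i)) F i c
   = \sum_(i <- iota 0 (size mu))
      (4 * ((nth 0%N mu i)./2%:Z * (nth 0%N mu i)./2%:Z - (0 + i)%N%:Z * (nth 0%N mu i)./2%:Z))%:~R :> C.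
  apply: eq_big_seq => i; rewrite mem_iota add0n => /andP[_ lt].
  by rewrite -rowE halvesK // mem_nth.
rewrite e (big_iota_rows _ (fun i p => (4 * (p./2%:Z * p./2%:Z - i%:Z * p./2%:Z))%:~R : C)).
have H s a : foldr (fun ip r => (4 * (ip.2./2%:Z * ip.2./2%:Z - ip.1%:Z * ip.2./2%:Z))%:~R + r)
    0 (zip (iota a (size s)) s) = (trans_content a (halves s))%:~R :> C.
  by elim: s a => [|p s IHs] a //=; rewrite IHs rmorphD.
exact: H.
Qed.

End BigTableau.

Section Eigenvalues.
Variable C : numClosedFieldType.

Lemma hamK_inv n : pm_invariant (@hamK C n).
Proof.
move=> s P Q; rewrite /hamK /hamiltonian -(is_cycle_act P Q s).
by rewrite (_ : s @: [set: 'I_n] = [set: 'I_n]) //; apply/setP => x; rewrite inE; apply/imsetP;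
  exists (s^-1%g x); rewrite ?permKV ?inE.
Qed.

Lemma hamK_sym n (P Q : pmatching n) : hamK C P Q = hamK C Q P.
Proof. by rewrite /hamK /hamiltonian is_cycle_sym. Qed.

(** A scalar exists by [kernel_scalar]. It is read off at a pairing, where the sum is known and [xt]
    is nonzero. *)
Lemma hamK_eigen n mu (t : {ffun 'I_n -> 'I_n * 'I_n}) : (0 < n)%N ->
  even_partition n mu -> is_tableau mu t ->
  app (@hamK C n) (xt C t) =1 (fun P => (content_prod 0 (halves mu))%:~R * xt C t P).
Proof.
move=> n0 mue tt; have [th thE] := kernel_scalar (@hamK_inv n) (@hamK_sym n) mue.
have [P tP] := pairing_exists mue tt.
have e : app (@hamK C n) (xt C t) P = (content_prod 0 (halves mu))%:~R * xt C t P.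
  rewrite -(pair_contentE mue tt C) -(sum_hamiltonian C mue tt n0 tP) /app [RHS]big_mkcond.
  by apply: eq_bigr => Q _; rewrite /hamK; case: hamiltonian; rewrite ?mul1r ?mul0r.
move=> Q; rewrite (thE t tt); congr (_ * _).
apply: (mulIf (lt0r_neq0 (xt_pairing_pos C tt tP))).
by rewrite -(thE t tt) e.
Qed.

Lemma transK_eigen n mu (t : {ffun 'I_n -> 'I_n * 'I_n}) :
  even_partition n mu -> is_tableau mu t ->
  app (@transK C n) (xt C t) =1 (fun P => (trans_content 0 (halves mu))%:~R * xt C t P).
Proof.
move=> mue tt P; rewrite app_transK (sum_all_tperm C (even_is_partition mue) tt).
by rewrite (content_sumE mue tt C).
Qed.

Lemma twoK_inv m : pm_invariant (@twoK C m).
Proof.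
move=> s P Q.
have e : [exists a, exists b, split_pair a b (pm_act P s) (pm_act Q s)]
  = [exists a, exists b, split_pair a b P Q].
  apply/existsP/existsP => -[a /existsP[b sp]].
    exists (s^-1%g a); apply/existsP; exists (s^-1%g b).
    by rewrite -(split_pair_act s) !permKV.
  by exists (s a); apply/existsP; exists (s b); rewrite split_pair_act.
exact: (congr1 (fun b : bool => b%:R) e).
Qed.

Lemma twoK_sym m (P Q : pmatching m.+2) : twoK C P Q = twoK C Q P.
Proof.
have e : [exists a, exists b, split_pair a b P Q] = [exists a, exists b, split_pair a b Q P].
  apply: eq_existsb => a; apply: eq_existsb => b.
  by rewrite /split_pair is_cycle_sym andbCA.
exact: (congr1 (fun b : bool => b%:R) e).
Qed.

(* The weights [p] come from restricting to the stabilizer of an edge; summing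
   all transpositions determines the mean content they give. *)
Lemma twoK_average m mu : (2 < m)%N -> even_partition m.+2 mu ->
  exists (theta : C) (p : seq nat -> C),
  [/\ forall t, is_tableau mu t -> app (@twoK C m) (xt C t) =1 (fun P => theta * xt C t P),
      forall ka, 0 <= p ka,
      forall ka, ka \in shapes m -> p ka != 0 ->
        [/\ nth 0 ka 0 <= nth 0 mu 0, nth 0 mu 0 <= nth 0 ka 0 + 2 & size ka <= size mu]%N
    & [/\ \sum_(ka <- shapes m) p ka = 1,
        2 * theta = m.+2%:R * \sum_(ka <- shapes m) (content_prod 0 (halves ka))%:~R * p ka
      & m.+2%:R * (\sum_(ka <- shapes m) (trans_content 0 (halves ka))%:~R * p ka)
        = (m.+2 - 4)%:R * (trans_content 0 (halves mu))%:~R + (4 * m.+2)%:R]].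
Proof.
move=> m2 mue; have pmu := even_is_partition mue.
have [theta thE] := kernel_scalar (@twoK_inv m) (@twoK_sym m) mue.
have [t tt] := tab_exists pmu; set z := xt C t.
have rr (g : 'S_m.+2) P : (res z g P)^* = res z g P by apply: conj_xt.
have /fin_all_exists[q qP] g := quad_decomp (rr g).
(* Total squared norm of all restrictions, by [sum_res_norm]; dividing by it normalizes the
   weights. *)
pose N := (fix2 (last0 m) (last1 m))%:R * (m.+2%:R * dot z z).
have Npos : 0 < N.
  by rewrite mulr_gt0 ?mulr_gt0 ?ltr0n ?fix2_gt0 // (dot_xt_gt0 C mue tt).
have Nnz := lt0r_neq0 Npos.
pose S ka := \sum_g q g ka.
have sumE (K : pmatching m -> pmatching m -> C) (e : seq nat -> C) :
    (forall mu t, even_partition m mu -> is_tableau mu t ->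
       app K (xt C t) =1 (fun P => e mu * xt C t P)) ->
    \sum_g dot (app K (res z g)) (res z g) = N * \sum_(ka <- shapes m) e ka * (S ka / N).
  move=> h; rewrite (eq_bigr (fun g => \sum_(ka <- shapes m) e ka * q g ka)); last first.
    by move=> g _; case: (qP g) => _ + _; apply.
  rewrite exchange_big mulr_sumr; apply: eq_bigr => ka _.
  by rewrite mulrCA [N * _]mulrC divfK // /S mulr_sumr.
exists theta, (fun ka => S ka / N); split=> //.
- move=> ka; rewrite mulr_ge0 ?invr_ge0 ?(ltW Npos) // sumr_ge0 // => g _.
  by case: (qP g) => + _ _; apply.
- move=> ka kaS nz; have kae := shapes_even kaS.
  have resE (g : 'S_m.+2) s : dot (res z g) (xt C s) =
      dot (fun P => xt C (relabel t g^-1%g) (ext P)) (xt C s).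
    by apply: dot_eq => P; rewrite xt_relabel invgK.
  have tt' (g : 'S_m.+2) : is_tableau mu (relabel t g^-1%g) by apply: tab_relabel.
  (* A shape orthogonal to all restrictions has weight zero, so each violated inequality contradicts
     a branching lemma. *)
  have zero : (forall g s, is_tableau ka s -> dot (res z g) (xt C s) = 0) -> False.
    move=> h; case/eqP: nz; rewrite /S big1 ?mul0r // => g _.
    by case: (qP g) => _ _; apply=> // s; apply: h.
  have m0 : (0 < m)%N by apply: ltn_trans m2.
  split; rewrite leqNgt; apply/negP => lt; apply: zero => g s ss; rewrite resE.
  + exact: (branch_le C mue kae (tt' g) ss m0 lt).
  + exact: (branch_ge C mue kae (tt' g) ss lt).
  + exact: (branch_size C kae (tt' g) ss lt).
- have e1 : \sum_g dot (res z g) (res z g) = N * \sum_(ka <- shapes m) 1 * (S ka / N).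
    rewrite -(sumE (@idK C m) (fun=> 1)); last by move=> ? ? ? ? P; rewrite app_idK mul1r.
    by apply: eq_bigr => g _; apply/esym/dot_eq/app_idK.
  have m0 : (0 < m)%N by apply: ltn_trans m2.
  have e2 := sumE (@hamK C m) (fun ka => (content_prod 0 (halves ka))%:~R)
    (fun ka s kae ss => hamK_eigen m0 kae ss).
  have e3 := sumE (@transK C m) (fun ka => (trans_content 0 (halves ka))%:~R)
    (fun ka s kae ss => transK_eigen kae ss).
  have dz : dot z z != 0 by apply: lt0r_neq0; apply: dot_xt_gt0 mue tt.
  have fz : (fix2 (last0 m) (last1 m))%:R != 0 :> C by rewrite pnatr_eq0 -lt0n fix2_gt0.
  split.
  + move: e1; rewrite sum_res_norm -/N -[LHS]mulr1 => /(mulfI Nnz) ->.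
    by apply: eq_bigr => ka _; rewrite mul1r.
  + move: e2; rewrite (sum_res_hamiltonian z m2) (dot_eq _ (thE t tt)) dotZl /N -!mulrA.
    move/(mulfI fz); rewrite [2 * (theta * _)]mulrA [_ * (dot z z * _)]mulrCA.
    by rewrite [LHS]mulrC => /(mulfI dz).
  + move: e3; rewrite (sum_res_trans z (ltnW m2)) (dot_eq _ (transK_eigen mue tt)) dotZl.
    rewrite /N -!mulrA => /(mulfI fz); rewrite !mulrA -mulrDl [_ * dot z z * _]mulrAC.
    by move/(mulIf dz) => <-.
Qed.

End Eigenvalues.

(** * Estimates of the eigenvalues *)

Definition is_part (n : nat) (h : seq nat) := [&& sorted geq h, all (leq 1) h & sumn h == n].

(** An exhaustive list for checks by computation; the fuel bounds the number of parts. *)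
Fixpoint parts (fuel n mx : nat) : seq (seq nat) :=
  if n == 0%N then [:: [::]] else
  if fuel is fuel'.+1 then
    flatten [seq [seq p :: l | l <- parts fuel' (n - p) p] | p <- iota 1 (minn n mx)]
  else [::].

Lemma mem_parts fuel n mx h : (n <= fuel)%N -> is_part n h -> (nth 0%N h 0 <= mx)%N ->
  h \in parts fuel n mx.
Proof.
elim: fuel n mx h => [|fuel IH] n mx [|p h] nf /and3P[/= sh ph /eqP e] hm.
- by rewrite -e.
- by move: ph => /andP[p0 _]; lia.
- by rewrite -e.
move: ph => /andP[p0 ph].
have -> : (n == 0%N) = false by lia.
apply/flattenP; exists [seq p :: l | l <- parts fuel (n - p) p].
  by apply: map_f; rewrite mem_iota; lia.
apply: map_f; apply: IH; first lia.
  by apply/and3P; split; [apply: path_sorted sh|exact: ph|lia].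
by case: h sh {ph e} => [|q h] //= /andP[].
Qed.

Lemma content_prod_rcons a h v :
  content_prod a (rcons h v) = content_prod a h * row_content (a + size h) v.
Proof.
elim: h a => [|p h IHh] a /=; first by rewrite addn0 mulr1 mul1r.
by rewrite IHh mulrA addSnnS.
Qed.

Lemma row_content0 p : row_content 0 p.+1 = (double_factorial (2 * p))%:Z.
Proof.
elim: p => [|p IHp]; first by [].
rewrite -[LHS]/(row_content 0 p.+1 * ((2 * p.+1)%:Z - 0%:Z)) IHp subr0.
by rewrite mulnS -[RHS]/((2 * p).+2 * double_factorial (2 * p))%N%:Z PoszM mulrC.
Qed.

Lemma double_factorialS p : double_factorial (2 * p.+1) = ((2 * p + 2) * double_factorial (2 * p))%N.
Proof. by rewrite mulnS addn2. Qed.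

Lemma double_factorial_gt0 p : (0 < double_factorial (2 * p))%N.
Proof. by elim: p => // p IHp; rewrite double_factorialS muln_gt0 IHp addn2. Qed.

Lemma size_part n h : is_part n h -> (size h <= n)%N.
Proof.
case/and3P => _ /allP ph /eqP <-; elim: h ph => //= p h IHh ph.
rewrite -add1n leq_add ?ph ?mem_head // IHh // => q qh.
by apply: ph; rewrite inE qh orbT.
Qed.

(* Removing the corner of the last row divides [content_prod] by a factor that
   is small compared with the step of the double factorial. *)
Lemma remove_corner n h : is_part n.+1 h -> (1 < size h)%N ->
  exists g c, [/\ is_part n g, nth 0%N g 0 = nth 0%N h 0,
    (`|content_prod 0 h| = `|content_prod 0 g| * c)%N
    & (c <= maxn (2 * nth 0%N h 0 - 2) n)%N].
Proof.
case/lastP: h => // h v hp; rewrite size_rcons ltnS => h0.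
have szn : (size h <= n)%N by have := size_part hp; rewrite size_rcons.
have /and3P[sh ph /eqP e] := hp.
move: e; rewrite sumn_rcons => e.
move: ph; rewrite all_rcons => /andP[v0 ph].
have vle : (v <= nth 0%N (rcons h v) 0)%N.
  have := @sorted_geq_nth (rcons h v) 0 (size h) sh (leq0n _).
  by rewrite nth_rcons ltnn eqxx.
have sh' : sorted geq h by move: sh; rewrite -cats1 => /cat_sorted2[].
case: v v0 e vle sh hp => // -[|v] _ e vle sh hp.
  exists h, (size h); split.
  - by apply/and3P; split=> //; lia.
  - by rewrite nth_rcons h0.
  - rewrite content_prod_rcons add0n abszM; congr (_ * _)%N.
    rewrite /= mul1r addn0 muln0 sub0r; case: eqP => [s0|_]; first by rewrite s0 in h0.
    by rewrite abszN.
  - by rewrite leq_max szn orbT.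
exists (rcons h v.+1), `|(2 * v.+1)%:Z - (size h)%:Z|%N; split.
- apply/and3P; split; last by rewrite sumn_rcons; lia.
    case: h {h0 szn ph hp vle e} sh' sh => [|w h] //= _.
    by rewrite !rcons_path => /andP[-> /=]; lia.
  by rewrite all_rcons ph.
- by rewrite !nth_rcons h0.
- have rE : row_content (size h) v.+2 =
    row_content (size h) v.+1 * ((2 * v.+1)%:Z - (size h)%:Z).
    rewrite -[LHS]/(row_content (size h) v.+1 *
      (if (size h + v.+1 == 0)%N then 1 else (2 * v.+1)%:Z - (size h)%:Z)).
    by rewrite addnS.
  by rewrite !content_prod_rcons add0n rE mulrA abszM.
- by move: vle szn; lia.
Qed.

Lemma part_top n h : is_part n h -> (nth 0%N h 0 <= n)%N.
Proof. by case: h => [|p h] //= /and3P[_ _ /eqP/= <-]; apply: leq_addr. Qed.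

Lemma part_cons n p h : is_part n (p :: h) -> is_part (n - p) h.
Proof.
case/and3P => /= sh /andP[p0 ph] /eqP e; apply/and3P; split=> //; last lia.
exact: path_sorted sh.
Qed.

Lemma part_cases n h r : (r <= 3)%N -> is_part (n + r) h -> nth 0%N h 0 = n -> (0 < n)%N ->
  exists g, h = n :: g /\ g \in parts 3 r r.
Proof.
move=> r3 hp hn n0; case: h hp hn => [|p g] hp /= hn; first by rewrite -hn in n0.
rewrite hn in hp *; exists g; split=> //; have gp := part_cons hp.
rewrite addKn in gp; apply: mem_parts r3 gp (part_top gp).
Qed.

(* Induction on [q] from a computed base case: either the first row has length
   [q.+1] and the rest is one of the finitely many partitions of [r], or
   removing a corner leads to [q.-1]. *)
Lemma content_prod_bound a b c r q0 : (r <= 3)%N -> (r <= q0.+1)%N -> (a * c <= b)%N ->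
  all (fun g => `|content_prod 1 g| <= c)%N (parts 3 r r) ->
  all (fun h => a * `|content_prod 0 h| <= b * double_factorial (2 * q0))%N
    (parts (q0.+1 + r) (q0.+1 + r) q0.+1) ->
  forall q h, (q0 <= q)%N -> is_part (q.+1 + r) h -> (nth 0%N h 0 <= q.+1)%N ->
  (a * `|content_prod 0 h| <= b * double_factorial (2 * q))%N.
Proof.
move=> r3 rq ac /allP cr base; elim=> [|q IHq] h q0q hp h0.
  by move: q0q base; rewrite leqn0 => /eqP-> /allP; apply; apply: mem_parts.
have [e|ne] := eqVneq q0 q.+1.
  by move: base; rewrite e => /allP; apply; apply: mem_parts.
have qq : (q0 <= q)%N by lia.
move: h0; rewrite leq_eqVlt => /orP[/eqP h0|h0].
  have [//|g [-> /cr gc]] := part_cases r3 hp h0.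
  rewrite -[content_prod 0 _]/(row_content 0 q.+2 * content_prod 1 g) abszM row_content0.
  by rewrite mulnCA [leqRHS]mulnC leq_mul // (leq_trans _ ac) // leq_mul.
rewrite addSn in hp; have sz : (1 < size h)%N.
  case: h hp h0 => [|p [|p' h]] // /and3P[_ _ /eqP e] //= h0.
  by move: e => /=; lia.
have [g [d [gp g0 -> dle]]] := remove_corner hp sz.
have := IHq g qq gp; rewrite g0 => /(_ h0) le; rewrite double_factorialS mulnA mulnCA [leqLHS]mulnC.
(* The corner factor is at most [2 * q + 2], the step of the double factorial; here [r <= q0.+1]
   enters. *)
by apply: leq_mul le; apply: leq_trans dle _; rewrite geq_max; lia.
Qed.

(** For [q = 3] the column of six cells gives [5! = 120], which is [5 / 2] times [6!! = 48]. The
    second [2] bounds the products of the two partitions of [2] below a first row. *)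
Lemma content_prod_small q h : (3 <= q)%N -> is_part (q.+1 + 2) h -> (nth 0%N h 0 <= q.+1)%N ->
  (2 * `|content_prod 0 h| <= 5 * double_factorial (2 * q))%N.
Proof. by apply: (@content_prod_bound 2 5 2); vm_compute. Qed.

(** For [q = 4] the column of eight cells gives [7! = 5040], between [13] and [14] times
    [8!! = 384]. The [6] comes from three single cells below a first row. *)
Lemma content_prod_big q h : (4 <= q)%N -> is_part (q.+1 + 3) h -> (nth 0%N h 0 <= q.+1)%N ->
  (`|content_prod 0 h| <= 14 * double_factorial (2 * q))%N.
Proof. by rewrite -[absz _]mul1n; apply: (@content_prod_bound 1 14 6); vm_compute. Qed.

(** The factor [14] would fail here: the column of seven cells gives [6! = 720 = 15 * 48]. That
    extreme is positive, while the negative one is [-288 = -6 * 48], at [[4,1,1,1]]; hence separate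
    bounds. *)
Lemma content_prod7 h : is_part 7 h -> (nth 0%N h 0 <= 4)%N ->
  - 288 <= content_prod 0 h <= 720.
Proof.
move=> hp h0.
have /allP : all (fun h => - 288 <= content_prod 0 h <= 720) (parts 7 7 4) by vm_compute.
by apply; apply: mem_parts.
Qed.

Section Halves.
Variables (k : nat) (mu : seq nat).
Hypothesis mu_even : even_partition (2 * k) mu.

Lemma halves_double : mu = [seq p.*2 | p <- halves mu].
Proof.
rewrite /halves -map_comp map_id_in // => p pm /=.
exact: (halvesK mu_even).
Qed.

Lemma halves_part : is_part k (halves mu).
Proof.
have /and3P[smu /allP pos /eqP e] := mu_even; apply/and3P; split.
- by apply: homo_sorted smu => x y /= xy; apply: half_leq.
- apply/allP => q /mapP[p pm ->]; have /andP[p0 _] := pos p pm.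
  by have := halvesK mu_even pm; lia.
- apply/eqP/double_inj; rewrite -mul2n -[in RHS]mul2n -e halves_double.
  elim: (halves mu) => //= p h IHh; rewrite doubleK mulnDr IHh -mul2n.
  by congr (_ + sumn _)%N.
Qed.

Lemma nth_halves i : nth 0%N (halves mu) i = (nth 0%N mu i)./2.
Proof.
have [lt|le] := ltnP i (size mu); first by rewrite (nth_map 0%N).
by rewrite !nth_default // size_map.
Qed.

Lemma nth_even i : nth 0%N mu i = (nth 0%N (halves mu) i).*2.
Proof.
by rewrite nth_halves even_halfK // (even_partition_nth _ mu_even).
Qed.

End Halves.

Section Numerics.
Variables (C : numClosedFieldType) (j : nat).

(** With [k = j + 4], the first rows treated exactly have [j + 1] to [j + 4] cells, and [(2j)!!]
    divides all their products. *)
Definition dfj : C := (double_factorial (2 * j))%:R.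
Local Notation f := dfj.
Local Notation J := (j%:R : C).

Lemma dfj_gt0 : 0 < f.
Proof. by rewrite ltr0n double_factorial_gt0. Qed.

Lemma rc1 : (row_content 0 j.+1)%:~R = f.
Proof. by rewrite row_content0 -pmulrn. Qed.

Lemma rc2 : (row_content 0 j.+2)%:~R = (2 * J + 2) * f.
Proof. by rewrite row_content0 -pmulrn double_factorialS /dfj; ring. Qed.

Lemma rc3 : (row_content 0 j.+3)%:~R = (2 * J + 4) * (2 * J + 2) * f.
Proof. by rewrite row_content0 -pmulrn !double_factorialS /dfj; ring. Qed.

Lemma rc4 : (row_content 0 j.+4)%:~R = (2 * J + 6) * (2 * J + 4) * (2 * J + 2) * f.
Proof. by rewrite row_content0 -pmulrn !double_factorialS /dfj; ring. Qed.

Lemma cp_cons p g : (content_prod 0 (p :: g))%:~R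
  = (row_content 0 p)%:~R * (content_prod 1 g)%:~R :> C.
Proof. by rewrite -rmorphM. Qed.

(** Pushes the weights forward to an explicit short list, where sums can be expanded. *)
Lemma sum_support (L : seq (seq nat)) (p : seq nat -> C) (l : seq (seq nat)) :
  uniq l -> (forall ka, ka \in L -> p ka != 0 -> halves ka \in l) ->
  (forall ka, 0 <= p ka) ->
  exists2 P : seq nat -> C, forall g, 0 <= P g &
    forall F : seq nat -> C, \sum_(ka <- L) F (halves ka) * p ka = \sum_(g <- l) F g * P g.
Proof.
move=> ul sup p0; exists (fun g => \sum_(ka <- L | halves ka == g) p ka).
  by move=> g; apply: sumr_ge0.
move=> F; under [RHS]eq_bigr do rewrite mulr_sumr big_mkcond.
rewrite exchange_big /=; apply: eq_big_seq => ka kaL.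
have [->|nz] := eqVneq (p ka) 0.
  by rewrite mulr0 big1 // => g _; case: eqP; rewrite ?mulr0.
rewrite (bigD1_seq (halves ka)) ?sup //= eqxx big1 ?addr0 // => g.
by rewrite eq_sym => /negPf->.
Qed.

Lemma part_head_cases (g : seq nat) n r : (r <= 3)%N -> is_part (n.+1 + r) g ->
  nth 0%N g 0 = n.+1 -> g \in [seq n.+1 :: l | l <- parts 3 r r].
Proof.
move=> r3 gp g0; have [//|l [-> lp]] := part_cases r3 gp g0.
exact: map_f.
Qed.

End Numerics.

(** * The combined eigenvalue in terms of weights *)

Section Theta.
Variables (C : numClosedFieldType) (j : nat).
Hypothesis j3 : (3 <= j)%N.
Local Notation f := (dfj C j).
Local Notation J := (j%:R : C).
Local Notation k := j.+4.

Variables (h : seq nat) (L : seq (seq nat)) (p : seq nat -> C).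
Hypothesis L_part : forall ka, ka \in L -> is_part j.+3 (halves ka).
Hypothesis p_ge0 : forall ka, 0 <= p ka.
Hypothesis p_supp : forall ka, ka \in L -> p ka != 0 ->
  [/\ nth 0 (halves ka) 0 <= nth 0 h 0, nth 0 h 0 <= (nth 0 (halves ka) 0).+1
    & size (halves ka) <= size h]%N.
Hypothesis p_sum : \sum_(ka <- L) p ka = 1.
Let S := \sum_(ka <- L) (content_prod 0 (halves ka))%:~R * p ka.
Hypothesis p_trans : (2 * J + 8) * (\sum_(ka <- L) (trans_content 0 (halves ka))%:~R * p ka)
  = (2 * J + 4) * (trans_content 0 h)%:~R + 4 * (2 * J + 8).

(** The eigenvalue sought is [(J + 4) * X / W], where [J + 4] is [k] and [W] is [3 * (2k - 4)!!]. *)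
Let X := (content_prod 0 h)%:~R + (2 * J + 2) * S.
Let W := 3 * ((2 * J + 4) * (2 * J + 2) * f).

Let p_sum' : \sum_(ka <- L) 1 * p ka = 1.
Proof. by rewrite -[RHS]p_sum; apply: eq_bigr => ka _; rewrite mul1r. Qed.

Let supp_cases ka : ka \in L -> p ka != 0 -> (j.+1 < nth 0 h 0)%N ->
  halves ka \in [seq j.+1 :: l | l <- parts 3 2 2] ++ [seq j.+2 :: l | l <- parts 3 1 1]
     ++ [seq j.+3 :: l | l <- parts 3 0 0].
Proof.
move=> kaL nz h0; have [le ge _] := p_supp kaL nz; have gp := L_part kaL.
have gt := part_top gp; rewrite !mem_cat.
have [e|ne] := eqVneq (nth 0%N (halves ka) 0) j.+1.
  by rewrite part_head_cases ?addn2.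
have [e'|ne'] := eqVneq (nth 0%N (halves ka) 0) j.+2.
  by rewrite (@part_head_cases _ _ 1) ?addn1 ?orbT.
by rewrite (@part_head_cases _ _ 0) ?addn0 ?orbT //; clear -gt ne ne' ge h0; lia.
Qed.

Let supp_subset (l : seq (seq nat)) : (j.+1 < nth 0 h 0)%N ->
  (forall g, is_part j.+3 g -> nth 0 g 0 <= nth 0 h 0 -> nth 0 h 0 <= (nth 0 g 0).+1 ->
    size g <= size h -> g \in [:: [:: j.+1; 1; 1]; [:: j.+1; 2]; [:: j.+2; 1];
      [:: j.+3]] -> g \in l)%N ->
  forall ka, ka \in L -> p ka != 0 -> halves ka \in l.
Proof.
move=> h0 hl ka kaL nz; have [le ge sz] := p_supp kaL nz.
by apply: hl => //; [apply: L_part|apply: supp_cases].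
Qed.

Lemma theta_top : h = [:: k] -> (J + 4) * X = ((J + 4) * (4 * J + 8) / 3) * W.
Proof.
move=> hE; pose l := [:: [:: j.+3]].
have sup : forall ka, ka \in L -> p ka != 0 -> halves ka \in l.
  apply: supp_subset; rewrite hE /=; first by clear; lia.
  move=> g _ _ ge sz; rewrite !inE.
  by case/or4P => /eqP e; rewrite e /= ?eqxx ?orbT // in ge sz *; clear -ge sz; lia.
have [P P0 PE] := sum_support (erefl : uniq l) sup p_ge0.
have := PE (fun=> 1); rewrite /= p_sum' big_seq1 mul1r => P1.
rewrite /X /S (PE (fun g => (content_prod 0 g)%:~R)) big_seq1 -P1 hE !cp_cons (rc3 C j) (rc4 C j) /W.
by rewrite /=; field.
Qed.

(** Deduces one equation from another with multiplier [c]. In the cases with two weights, [c] is the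
    ratio of the coefficients of [p1] in the goal and in the mean content equation. *)
Let lin_comb (a b c x y : C) : x = y -> a - b = c * (x - y) -> a = b.
Proof. by move=> -> e; apply/eqP; rewrite -subr_eq0 e subrr mulr0. Qed.

Lemma theta_second : h = [:: j.+3; 1]%N -> (J + 4) * X = - W.
Proof.
move=> hE; pose l := [:: [:: j.+3]; [:: j.+2; 1]%N].
have sup : forall ka, ka \in L -> p ka != 0 -> halves ka \in l.
  apply: supp_subset; rewrite hE /=; first by clear; lia.
  move=> g _ _ ge _; rewrite !inE.
  by case/or4P => /eqP e; rewrite e /= ?eqxx ?orbT // in ge *; clear -ge; lia.
have ul : uniq l by rewrite /l /= inE eqseq_cons andbF.
have [P P0 PE] := sum_support ul sup p_ge0.
have := PE (fun=> 1); rewrite /= p_sum' !big_cons big_nil !mul1r addr0 => P1.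
have := p_trans; rewrite (PE (fun g => (trans_content 0 g)%:~R)) !big_cons big_nil addr0 hE.
rewrite /X /S (PE (fun g => (content_prod 0 g)%:~R)) hE !big_cons big_nil addr0 !cp_cons (rc2 C j) (rc3 C j).
move: (P [:: j.+3]) (P [:: j.+2; 1]%N) P1 => p1 p2 P1.
have -> : p2 = 1 - p1 by rewrite P1; ring.
rewrite /W /= => T.
apply: (lin_comb (c := (2 * J + 2) ^+ 2 * f / 8) T).
by field.
Qed.

Lemma theta_third : h = [:: j.+2; 2]%N -> (J + 4) * X = - W.
Proof.
move=> hE; pose l := [:: [:: j.+2; 1]%N; [:: j.+1; 2]%N].
have sup : forall ka, ka \in L -> p ka != 0 -> halves ka \in l.
  apply: supp_subset; rewrite hE /=; first by clear; lia.
  move=> g _ le ge sz; rewrite !inE.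
  by case/or4P => /eqP e; rewrite e /= ?eqxx ?orbT // in le ge sz *; clear -le ge sz; lia.
have ul : uniq l by rewrite /l /= inE eqseq_cons andbF.
have [P P0 PE] := sum_support ul sup p_ge0.
have := PE (fun=> 1); rewrite /= p_sum' !big_cons big_nil !mul1r addr0 => P1.
have := p_trans; rewrite (PE (fun g => (trans_content 0 g)%:~R)) !big_cons big_nil addr0 hE.
rewrite /X /S (PE (fun g => (content_prod 0 g)%:~R)) hE !big_cons big_nil addr0 !cp_cons (rc1 C j) (rc2 C j).
move: (P [:: j.+2; 1]%N) (P [:: j.+1; 2]%N) P1 => p1 p2 P1.
have -> : p2 = 1 - p1 by rewrite P1; ring.
rewrite /W /= => T.
apply: (lin_comb (c := - ((2 * J + 2) * f / 8)) T).
by field.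
Qed.

Lemma theta_fourth : h = [:: j.+2; 1; 1]%N -> - W < (J + 4) * X /\ X <= 4 * (2 * J + 2) * f.
Proof.
move=> hE; pose l := [:: [:: j.+2; 1]%N; [:: j.+1; 2]%N; [:: j.+1; 1; 1]%N].
have sup : forall ka, ka \in L -> p ka != 0 -> halves ka \in l.
  apply: supp_subset; rewrite hE /=; first by clear; lia.
  move=> g _ le ge sz; rewrite !inE.
  by case/or4P => /eqP e; rewrite e /= ?eqxx ?orbT // in le ge sz *; clear -le ge sz; lia.
have ul : uniq l by rewrite /l /= !inE !eqseq_cons !andbF.
have [P P0 PE] := sum_support ul sup p_ge0.
have := PE (fun=> 1); rewrite /= p_sum' !big_cons big_nil !mul1r addr0 => P1.
have := p_trans; rewrite (PE (fun g => (trans_content 0 g)%:~R)) !big_cons big_nil addr0 hE.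
rewrite /X /S (PE (fun g => (content_prod 0 g)%:~R)) hE !big_cons big_nil addr0 !cp_cons (rc1 C j) (rc2 C j).
move: (P0 [:: j.+2; 1]%N) (P0 [:: j.+1; 2]%N) (P0 [:: j.+1; 1; 1]%N).
move: (P [:: j.+2; 1]%N) (P [:: j.+1; 2]%N) (P [:: j.+1; 1; 1]%N) P1 => p1 p2 p3 P1 p10 p20 p30.
rewrite /W /= => T.
have p3E : p3 = 1 - p1 - p2 by rewrite P1; ring.
have f0 := dfj_gt0 C j.
have np (a b : nat) : 0 < a%:R * J + b.+1%:R :> C by rewrite ltr_wpDl ?mulr_ge0.
have pos2 : 0 < 2 * J + 2 := np 2 1.
have pos4 : 0 < 2 * J + 4 := np 2 3.
have posk : 0 < J + 4 by rewrite -[J]mul1r; apply: (np 1 3).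
(* [Y] is [X] divided by [(2 * J + 2) * f]. *)
pose Y := 2 - (2 * J + 2) * p1 - p2 + 2 * p3.
have Ypos : 0 < (J + 4) * Y + 3 * (2 * J + 4).
  rewrite -(pmulr_rgt0 _ pos4).
  (* Adding a multiple of the mean content equation removes the negative coefficients of [p1] and
     [p2]. *)
  have -> : (2 * J + 4) * ((J + 4) * Y + 3 * (2 * J + 4)) =
     (6 * J ^+ 2 + 32 * J + 44) + ((2 * J + 4) * (J + 4) * (p1 + p3)
     + 2 * (2 * J + 4) * (J + 4) * p3 + (2 * J + 2) * (3 * (J + 4) * p2)).
    apply: (lin_comb (c := - ((2 * J + 2) / 8)) T); rewrite /Y p3E.
    by field.
  apply: ltr_wpDr.
    have [h2 h4 hk] := And3 (ltW pos2) (ltW pos4) (ltW posk).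
    have h13 : 0 <= p1 + p3 by apply: addr_ge0.
    by do 2?apply: addr_ge0; do 3?apply: mulr_ge0.
  by rewrite -addrA ltr_wpDl ?np // mulr_ge0 // exprn_ge0.
have Yle : Y <= 4.
  rewrite -subr_ge0 (_ : 4 - Y = (2 * J + 4) * p1 + 3 * p2); last by rewrite /Y p3E; ring.
  by rewrite addr_ge0 // mulr_ge0 // ltW.
set X' := (X in X <= _).
have -> : X' = (2 * J + 2) * f * Y by rewrite /X' /Y; ring.
split; last by rewrite [leRHS](_ : _ = (2 * J + 2) * f * 4) ?ler_pM2l ?mulr_gt0 //; ring.
rewrite -subr_gt0 opprK.
rewrite [X in 0 < X](_ : _ = (2 * J + 2) * f * ((J + 4) * Y + 3 * (2 * J + 4)));
  last by rewrite /Y; ring.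
by rewrite !mulr_gt0.
Qed.

(* Crude estimate: with first row at most [k - 3] only the sizes of the
   products matter. *)
Lemma theta_generic (N : nat) : (nth 0 h 0 <= j.+1)%N ->
  ((j + 4) * (N + 5 * j + 5) < 12 * (j + 2) * (j + 1))%N ->
  - (N * double_factorial (2 * j))%N%:Z <= content_prod 0 h ->
  content_prod 0 h <= (15 * double_factorial (2 * j))%N%:Z ->
  - W < (J + 4) * X /\ X <= (20 + 5 * J) * f.
Proof.
move=> h0 Nle Dlo Dhi; have f0 := dfj_gt0 C j.
(* [2 * S] is twice a weighted mean of products, each bounded by [content_prod_small]. *)
have Slo : `|2 * S| <= 5 * f.
  rewrite /S mulr_sumr; apply: le_trans (ler_norm_sum _ _ _) _.
  have -> : 5 * f = \sum_(ka <- L) 5 * f * p ka by rewrite -mulr_sumr p_sum mulr1.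
  rewrite big_seq [leRHS]big_seq.
  apply: ler_sum => ka kaL; have [->|nz] := eqVneq (p ka) 0; first by rewrite !mulr0 normr0.
  rewrite mulrA normrM (ger0_norm (p_ge0 ka)); apply: ler_wpM2r; first exact: p_ge0.
  have [le _ _] := p_supp kaL nz; have gp := L_part kaL.
  have := @content_prod_small j (halves ka) j3; rewrite addn2 => /(_ gp (leq_trans le h0)).
  rewrite -(ler_nat C) !natrM -/(dfj C j).
  by rewrite normrM normr_nat natr_absz intr_norm.
have Sreal : 2 * S \is Num.real.
  rewrite realM ?realn // /S rpred_sum // => ka _.
  by rewrite realM ?realz ?ger0_real.
move: Slo; rewrite real_ler_norml // => /andP[Slo Shi].
have X2 : X = (content_prod 0 h)%:~R + (J + 1) * (2 * S) by rewrite /X; ring.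
have J1 : 0 <= J + 1 by rewrite addr_ge0.
have Dlo' : - (N%:R * f) <= (content_prod 0 h)%:~R.
  move: Dlo; rewrite -(ler_int C) rmorphN /= => le; apply: le_trans le.
  by rewrite -pmulrn natrM.
have Dhi' : (content_prod 0 h)%:~R <= 15 * f.
  move: Dhi; rewrite -(ler_int C) => le; apply: le_trans le _.
  by rewrite -pmulrn natrM.
have Xlo : - ((N + 5 * j + 5)%N%:R * f) <= X.
  rewrite X2 (_ : - _ = - (N%:R * f) + (J + 1) * (- (5 * f))); last by ring.
  by apply: lerD => //; apply: ler_wpM2l.
split; last first.
  rewrite X2 (_ : (20 + 5 * J) * f = 15 * f + (J + 1) * (5 * f)); last by ring.
  by apply: lerD => //; apply: ler_wpM2l.
have posk : 0 < J + 4 by rewrite ltr_wpDl.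
(* The hypothesis relating [N] and [j] is exactly this comparison, as [W] is
   [12 * (j + 2) * (j + 1) * f]. *)
apply: lt_le_trans (_ : (J + 4) * - ((N + 5 * j + 5)%N%:R * f) <= _); last by rewrite ler_pM2l.
rewrite mulrN ltrN2 mulrA (_ : W = (12 * (j + 2) * (j + 1))%N%:R * f); last by rewrite /W; ring.
by rewrite ltr_pM2r // -natrD -natrM ltr_nat.
Qed.

End Theta.

(** * Eigenvalues of the weighted matrix *)

Definition bhat_kernel (C : numClosedFieldType) (n k : nat) (P Q : pmatching n) : C :=
  k%:R / (3 * double_factorial (2 * k - 4))%:R * (Defs.shape P Q == [:: n])%:R
  + (2 * k - 6)%:R / (3 * double_factorial (2 * k - 4))%:R
    * (Defs.shape P Q == [:: n - 2; 2]%N)%:R.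

Definition valency (C : numClosedFieldType) (k : nat) : C :=
  ((2 * k - 1) * (2 * k - 3))%:R / 3%:R - 1.

Section BhatEigenvalue.
Variables (C : numClosedFieldType) (j m : nat).
Hypotheses (j3 : (3 <= j)%N) (mE : m.+2 = (2 * j.+4)%N).
Local Notation f := (dfj C j).
Local Notation J := (j%:R : C).
Local Notation k := j.+4.

Lemma bhat_kernelE (P Q : pmatching m.+2) : bhat_kernel C k P Q =
  (J + 4) / (3 * ((2 * J + 4) * (2 * J + 2) * f)) * hamK C P Q
  + (2 * J + 2) / (3 * ((2 * J + 4) * (2 * J + 2) * f)) * twoK C P Q.
Proof.
rewrite /bhat_kernel shape1 // shape2; last by clear -mE; lia.
have -> : (2 * k - 4 = 2 * j.+2)%N by lia.
have -> : (2 * k - 6 = 2 * j + 2)%N by lia.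
rewrite /hamK /twoK !double_factorialS.
have -> : (3 * ((2 * j.+1 + 2) * ((2 * j + 2) * double_factorial (2 * j))))%N%:R
   = 3 * ((2 * J + 4) * (2 * J + 2) * f) by rewrite /dfj; ring.
by congr (_ / _ * _ + _ / _ * _); ring.
Qed.

Lemma bhat_kernel_inv : pm_invariant (@bhat_kernel C m.+2 k).
Proof. by move=> s P Q; rewrite !bhat_kernelE hamK_inv twoK_inv. Qed.

Lemma bhat_kernel_sym (P Q : pmatching m.+2) : bhat_kernel C k P Q = bhat_kernel C k Q P.
Proof. by rewrite !bhat_kernelE hamK_sym twoK_sym. Qed.

Lemma valencyE : valency C k = (J + 4) * (4 * J + 8) / 3.
Proof.
rewrite /valency (_ : 2 * k - 1 = 2 * j + 7)%N; last by clear; lia.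
rewrite (_ : 2 * k - 3 = 2 * j + 5)%N; last by clear; lia.
by field.
Qed.

Lemma bhat_eigen mu : even_partition m.+2 mu -> exists theta : C,
  (forall t, is_tableau mu t ->
     app (@bhat_kernel C m.+2 k) (xt C t) =1 (fun P => theta * xt C t P)) /\
  [\/ mu = [:: 2 * k]%N /\ theta = valency C k,
      (mu = [:: 2 * k - 2; 2]%N \/ mu = [:: 2 * k - 4; 4]%N) /\ theta = -1
    | [/\ mu <> [:: 2 * k]%N, mu <> [:: 2 * k - 2; 2]%N, mu <> [:: 2 * k - 4; 4]%N
        & -1 < theta < valency C k]].
Proof.
move=> mue; have m2 : (2 < m)%N by clear -mE; lia.
have [th2 [p [th2E p0 psupp [psum pth ptr]]]] := twoK_average C m2 mue.
pose h := halves mu; pose X := (content_prod 0 h)%:~R + (2 * J + 2) *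
  \sum_(ka <- shapes m) (content_prod 0 (halves ka))%:~R * p ka.
pose W := 3 * ((2 * J + 4) * (2 * J + 2) * f).
have f0 := dfj_gt0 C j.
have W0 : 0 < W by rewrite !mulr_gt0 ?ltr_wpDl ?mulr_ge0.
have Wn := lt0r_neq0 W0.
have mue' : even_partition (2 * k) mu by rewrite -mE.
have hp : is_part k h := halves_part mue'.
have mE' : m = (2 * j.+3)%N by clear -mE; lia.
have Lp ka : ka \in shapes m -> is_part j.+3 (halves ka).
  by move/shapes_even; rewrite mE' => /halves_part.
have nE : m.+2%:R = 2 * J + 8 :> C by rewrite mE; ring.
have th2S : th2 = (J + 4) * \sum_(ka <- shapes m) (content_prod 0 (halves ka))%:~R * p ka.
  have n2 : 2 != 0 :> C by rewrite pnatr_eq0.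
  by apply: (mulfI n2); rewrite pth nE; ring.
exists ((J + 4) * X / W); split.
  move=> t tt P; rewrite /app.
  have e1 := hamK_eigen C (ltn0Sn m.+1) mue tt P; have e2 := th2E t tt P.
  have -> : \sum_Q bhat_kernel C k P Q * xt C t Q =
     (J + 4) / W * app (@hamK C m.+2) (xt C t) P + (2 * J + 2) / W * app (@twoK C m) (xt C t) P.
    rewrite /app !mulr_sumr -big_split; apply: eq_bigr => Q _ /=.
    by rewrite bhat_kernelE -/W mulrDl !mulrA.
  by rewrite e1 e2 th2S /X -/h; field.
have sup ka : ka \in shapes m -> p ka != 0 ->
  [/\ nth 0 (halves ka) 0 <= nth 0 h 0, nth 0 h 0 <= (nth 0 (halves ka) 0).+1
    & size (halves ka) <= size h]%N.
  move=> kaS nz; have [le ge sz] := psupp ka kaS nz.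
  have kae : even_partition (2 * j.+3) ka by rewrite -mE' shapes_even.
  rewrite (nth_even mue') (nth_even kae) -/h in le ge.
  by rewrite !size_map; split=> //; clear -le ge; lia.
have tr : (2 * J + 8) * (\sum_(ka <- shapes m) (trans_content 0 (halves ka))%:~R * p ka)
  = (2 * J + 4) * (trans_content 0 h)%:~R + 4 * (2 * J + 8).
  rewrite -nE ptr; congr (_ * _ + _); last by rewrite natrM.
  by rewrite mE (_ : 2 * k - 4 = 2 * j + 4)%N; [ring|lia].
have dE := valencyE.
have muE a : h = a -> mu = [seq q.*2 | q <- a] by move=> <-; apply: halves_double mue'.
have neq a : h <> a -> mu <> [seq q.*2 | q <- a].
  move=> ne e; apply: ne; rewrite /h e /halves -map_comp map_id_in // => q _ /=.
  exact: doubleK.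
have E1 : [:: 2 * k]%N = [seq q.*2 | q <- [:: k]] by rewrite /= -mul2n.
have E2 : [:: 2 * k - 2; 2]%N = [seq q.*2 | q <- [:: j.+3; 1]%N].
  by congr [:: _; _]; rewrite -mul2n; lia.
have E3 : [:: 2 * k - 4; 4]%N = [seq q.*2 | q <- [:: j.+2; 2]%N].
  by congr [:: _; _]; rewrite -mul2n; lia.
have top := part_top hp.
have [h0|h0] := leqP (nth 0%N h 0) j.+1.
  constructor 3; split.
  1-3: by rewrite ?E1 ?E2 ?E3; apply: neq => e; rewrite e /= in h0; clear -h0; lia.
  have [lo hi] : - W < (J + 4) * X /\ X <= (20 + 5 * J) * f.
    (* [k >= 8] uses the uniform bound, [k = 7] the computed range. *)
    have [j4|j4] := ltnP 3 j.
      have := @content_prod_big j h j4; rewrite addn3 => /(_ hp h0) le.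
      apply: (@theta_generic C j j3 h (shapes m) p Lp p0 sup psum 14) => //.
      + by clear -j4; nia.
      + by move: le; move: (content_prod 0 h) (double_factorial _) => D F; clear; lia.
      + by move: le; move: (content_prod 0 h) (double_factorial _) => D F; clear; lia.
    have j3E : j = 3%N by clear -j3 j4; lia.
    have h7 : is_part 7 h by move: hp; rewrite j3E.
    have h4 : (nth 0%N h 0 <= 4)%N by move: h0; rewrite j3E.
    have /andP[lo hi] := content_prod7 h7 h4.
    have F : double_factorial (2 * j) = 48%N by rewrite j3E.
    apply: (@theta_generic C j j3 h (shapes m) p Lp p0 sup psum 6) => //.
    + by rewrite j3E.
    + by rewrite F.
    + by rewrite F.
  rewrite ltr_pdivlMr // mulN1r lo /= ltr_pdivrMr // dE.
  have posk : 0 < J + 4 by rewrite ltr_wpDl.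
  rewrite -!mulrA ltr_pM2l //; apply: le_lt_trans hi _.
  rewrite -subr_gt0 (_ : _ - _ = ((4 * J + 8) * (2 * J + 4) * (2 * J + 2) - (20 + 5 * J)) * f);
    last first.
    by rewrite /W; field.
  rewrite mulr_gt0 // (_ : _ - _ = (16 * J ^+ 3 + 80 * J ^+ 2) + (123 * J + 44)); last by ring.
  by rewrite ltr_wpDl ?addr_ge0 ?mulr_ge0 ?exprn_ge0 // ltr_wpDl ?mulr_ge0.
have [hE|[hE|[hE|hE]]] : h = [:: k] \/ h = [:: j.+3; 1]%N \/ h = [:: j.+2; 2]%N
    \/ h = [:: j.+2; 1; 1]%N.
  have [e|ne] := eqVneq (nth 0%N h 0) k.
    have := @part_head_cases h j.+3 0 isT; rewrite addn0 => /(_ hp e).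
    by rewrite /= inE => /eqP; left.
  have [e'|ne'] := eqVneq (nth 0%N h 0) j.+3.
    have := @part_head_cases h j.+2 1 isT; rewrite addn1 => /(_ hp e').
    by rewrite /= inE => /eqP; right; left.
  have e'' : nth 0%N h 0 = j.+2 by clear -ne ne' top h0; lia.
  have := @part_head_cases h j.+1 2 isT; rewrite addn2 => /(_ hp e'').
  by rewrite /= !inE => /orP[]/eqP; right; right; [right|left].
- constructor 1; split; first by rewrite E1; apply: muE.
  rewrite (@theta_top C j h (shapes m) p Lp p0 sup psum hE) mulfK // dE; by [].
- constructor 2; split; first by left; rewrite E2; apply: muE.
  by rewrite (@theta_second C j h (shapes m) p Lp p0 sup psum tr hE) mulNr divff.
- constructor 2; split; first by right; rewrite E3; apply: muE.
  by rewrite (@theta_third C j h (shapes m) p Lp p0 sup psum tr hE) mulNr divff.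
- constructor 3; split.
  1-3: by rewrite ?E1 ?E2 ?E3; apply: neq; rewrite hE.
  have [lo hi] := @theta_fourth C j h (shapes m) p Lp p0 sup psum tr hE.
  rewrite ltr_pdivlMr // mulN1r lo /= ltr_pdivrMr // dE.
  have posk : 0 < J + 4 by rewrite ltr_wpDl.
  rewrite -!mulrA ltr_pM2l //; apply: le_lt_trans hi _.
  rewrite -subr_gt0 (_ : _ - _ = ((4 * J + 8) * (2 * J + 4) - 4) * (2 * J + 2) * f); last first.
    by rewrite /W; field.
  rewrite !mulr_gt0 //; last by rewrite ltr_wpDl ?mulr_ge0.
  rewrite (_ : _ - _ = (8 * J ^+ 2 + 32 * J) + 28); last by ring.
  by rewrite ltr_wpDl ?addr_ge0 ?mulr_ge0 ?exprn_ge0.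
Qed.

End BhatEigenvalue.

(** * Specht modules *)

Section PermutationRow.
Variables (C : fieldType) (aT : finGroupType) (T : finType) (to : {action aT &-> T}).

Lemma row_permutation_mx (v : 'rV[C]_#|T|) g x :
  (v *m permutation_repr C to g) 0 (enum_rank x) = v 0 (enum_rank (to x g^-1%g)).
Proof.
rewrite mxE (bigD1 (enum_rank (to x g^-1%g))) //= mxE !enum_rankK actKV eqxx mulr1.
rewrite big1 ?addr0 // => i ni; rewrite mxE enum_rankK; case: eqP => [e|_]; last by rewrite mulr0.
by case/eqP: ni; rewrite -e actK enum_valK.
Qed.

End PermutationRow.

Section Constituents.
Variables (C : numClosedFieldType) (n : nat).
Local Notation filling := {ffun 'I_n -> 'I_n}.
Local Notation tableau := {ffun 'I_n -> 'I_n * 'I_n}.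
Implicit Types (P Q : pmatching n) (g : 'S_n) (t s : tableau).

Definition fn (v : 'rV[C]_#|{: pmatching n}|) P : C := v 0 (enum_rank P).

Definition kernel_mx (K : pmatching n -> pmatching n -> C) : 'M[C]_#|{: pmatching n}| :=
  \matrix_(i, j) K (enum_val i) (enum_val j).

Lemma fn_inj v v' : fn v =1 fn v' -> v = v'.
Proof. by move=> h; apply/rowP => i; have := h (enum_val i); rewrite /fn enum_valK. Qed.

Lemma fn_kernel K v P : (forall P Q, K P Q = K Q P) -> fn (v *m kernel_mx K) P = app K (fn v) P.
Proof.
move=> sK; rewrite /fn mxE /app (reindex enum_rank) /=; last by apply: onW_bij;
  apply: enum_rank_bij.
by apply: eq_bigr => Q _; rewrite mxE !enum_rankK sK mulrC.
Qed.

Lemma fn_repr v g P : fn (v *m matching_repr C n g) P = fn v (pm_act P g^-1).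
Proof. exact: (row_permutation_mx (pm_action n)). Qed.

Lemma fn_sum I (r : seq I) (p : pred I) (F : I -> 'rV[C]_#|{: pmatching n}|) P :
  fn (\sum_(i <- r | p i) F i) P = \sum_(i <- r | p i) fn (F i) P.
Proof. by rewrite /fn summxE. Qed.

Lemma fnZ a v P : fn (a *: v) P = a * fn v P.
Proof. by rewrite /fn mxE. Qed.

Lemma polytabloidE t (f : filling) : polytabloid C t 0 (enum_rank f) = tabcoef C t f.
Proof.
rewrite /polytabloid summxE; apply: eq_bigr => g _.
by rewrite !mxE eqxx /= (inj_eq enum_rank_inj) eq_sym.
Qed.

Lemma tabcoef_supp t (f : filling) : tabcoef C t f != 0 ->
  exists2 g, colstab t g & f = relabel (tableau_rows t) g.
Proof.
move=> nz; have [/existsP[g /andP[tg /eqP e]]|none] :=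
  boolP [exists g, colstab t g && (f == relabel (tableau_rows t) g)]; first by exists g.
case/eqP: nz; apply: tabcoef_eq0 => g tg e; case/negP: none.
by apply/existsP; exists g; rewrite tg e eqxx.
Qed.

Lemma polytabloid_colstab t g : colstab t g ->
  polytabloid C t *m tabloid_repr C n g = (-1) ^+ odd_perm g *: polytabloid C t.
Proof.
move=> tg; apply/rowP => i; rewrite -(enum_valK i) (row_permutation_mx (relabel_action n _)).
rewrite mxE !polytabloidE /tabcoef -pol_act //; apply: eq_pol => f /=.
congr (_%:R); rewrite -[in RHS](inj_eq (act_inj (relabel_action n _) g^-1%g)) /=.
by rewrite relabelM mulgV relabel1.
Qed.

Lemma specht_span mu (v : 'rV[C]_#|{: filling}|) : (v <= specht_mx C n mu)%MS ->
  exists c : tableau -> C, v = \sum_(t | is_tableau mu t) c t *: polytabloid C t.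
Proof.
case/sub_sumsmxP => u ->.
have ex t : exists a, u t *m <<polytabloid C t>>%MS == a *: polytabloid C t.
  have : (u t *m <<polytabloid C t>> <= polytabloid C t)%MS.
    by apply: submx_trans (submxMl _ _) _; rewrite genmxE.
  by case/sub_rVP => a ->; exists a.
by exists (fun t => xchoose (ex t)); apply: eq_bigr => t _; apply/eqP/(xchooseP (ex t)).
Qed.

Lemma polytabloid_specht mu t : is_tableau mu t -> (polytabloid C t <= specht_mx C n mu)%MS.
Proof. by move=> tt; apply: (sumsmx_sup t) => //; rewrite genmxE. Qed.

(** The antisymmetrized polytabloid is antisymmetric for [s] and supported in weight at most that of
    [s], so James's key step reduces it to its value at the rows of [s]. This value is [0] because
    the row lengths differ. *)
Lemma polytabloid_kill mu la t s : even_partition n mu -> even_partition n la ->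
  is_tableau mu t -> is_tableau la s -> mu <> la ->
  (wt (tableau_rows t) <= wt (tableau_rows s))%N ->
  \sum_(g | colstab s g) (-1) ^+ odd_perm g *: (polytabloid C t *m tabloid_repr C n g) = 0.
Proof.
move=> mue lae tt ts ne le.
pose H f := \sum_(g | colstab s g) (-1) ^+ odd_perm g * tabcoef C t (relabel f g^-1%g).
suff H0 f : H f = 0.
  apply/rowP => i; rewrite -(enum_valK i) [RHS]mxE -[RHS](H0 (enum_val i)) summxE.
  apply: eq_bigr => g _; rewrite mxE (row_permutation_mx (relabel_action n _)).
  by rewrite polytabloidE.
have Hanti : antisymG s H.
  move=> g f' sg; rewrite /H mulr_sumr (reindex_inj (mulIg g)) /=.
  apply: eq_big => [g'|g' _]; first by rewrite colstabMr.
  rewrite mulrA -signr_addb odd_permM addbC relabelM invMg mulgA mulgV mul1g.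
  by [].
have [wf|wf] := leqP (wt f) (wt (tableau_rows s)); last first.
  rewrite /H big1 // => g _; apply/eqP; rewrite mulf_eq0; apply/orP; right.
  apply: contraT => /tabcoef_supp[g' _ /(congr1 (@wt n))]; rewrite !wt_relabel => e.
  by move: wf; rewrite e ltnNge le.
rewrite (antisymG_tabcoef (even_is_partition lae) ts Hanti wf) (_ : H _ = 0) ?mul0r //.
rewrite /H big1 // => g _; apply/eqP; rewrite mulf_eq0; apply/orP; right.
apply: contraT => /tabcoef_supp[g' _ /(congr1 (@rowcount n)) e]; case: ne.
apply: (part_eq (even_is_partition mue) (even_is_partition lae)
  (even_partition_pos mue) (even_partition_pos lae)).
move=> i; rewrite -(rowcount_tab _ (even_is_partition mue) tt).
rewrite -(rowcount_tab _ (even_is_partition lae) ts).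
by have := congr1 (fun h => h i) e; rewrite !rowcount_relabel.
Qed.

(** Polytabloids are carried into [U] by the isomorphism [iota]. If [t] is heavier than [s], the
    image is antisymmetric for [t] and [antisym_dot_xt] applies. Otherwise the column
    antisymmetrizer of [s] kills it, whereas in the pairing with [xt C s] it acts as multiplication
    by the order of the column stabilizer. *)
Lemma constituent_orth mu la U u s : even_partition n mu -> even_partition n la ->
  is_tableau la s -> mu <> la -> is_constituent mu U -> (u <= U)%MS ->
  dot (fn u) (xt C s) = 0.
Proof.
move=> mue lae ts ne [modU /mx_rsim_sym[B eqn freeB homB]] uU.
pose iota (v : 'rV[C]_#|{: filling}|) := val_submod (in_submod (specht_mx C n mu) v *m B).
have iota_sum I (r : seq I) (p : pred I) F :
    iota (\sum_(i <- r | p i) F i) = \sum_(i <- r | p i) iota (F i).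
  by rewrite /iota !linear_sum /= mulmx_suml linear_sum.
have iotaZ a v : iota (a *: v) = a *: iota v.
  by rewrite /iota linearZ /= -scalemxAl linearZ.
have iotaJ v g : (v <= specht_mx C n mu)%MS ->
    iota (v *m tabloid_repr C n g) = iota v *m matching_repr C n g.
  move=> vS; rewrite /iota (in_submodJ (specht_mxmodule C n mu) _ vS) -mulmxA.
  rewrite [submod_mx _ g *m B](homB g (in_setT g)) mulmxA.
  by rewrite (val_submodJ modU) ?inE.
have [v vS ->] : exists2 v, (v <= specht_mx C n mu)%MS & u = iota v.
  have fullB : row_full B by move: freeB; rewrite /row_full /row_free => /eqP->; rewrite eqn.
  have /submxP[x xE] := submx_full (in_submod U u) fullB.
  exists (val_submod x); first exact: val_submodP.
  by rewrite /iota val_submodK -xE in_submodK.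
have [c ->] := specht_span vS.
rewrite iota_sum (_ : dot _ _ = \sum_(t | is_tableau mu t) c t * dot (fn (iota (polytabloid C t))) (xt C s)).
  rewrite big1 // => t tt; apply/eqP; rewrite mulf_eq0; apply/orP; right; apply/eqP.
  have eS := polytabloid_specht tt.
  have [le|lt] := leqP (wt (tableau_rows t)) (wt (tableau_rows s)); last first.
    have az : antisym t (fn (iota (polytabloid C t))).
      move=> g P tg; rewrite -[in LHS](invgK g) -fn_repr -iotaJ //.
      by rewrite polytabloid_colstab ?colstabV // odd_permV iotaZ fnZ.
    rewrite (antisym_dot_xt (even_is_partition mue) tt az (ltnW lt)).
    by rewrite (pol_tabcoef_neq C mue lae tt ts ne) mulr0.
  have := polytabloid_kill mue lae tt ts ne le.
  move/(congr1 (fun v => dot (fn (iota v)) (xt C s))).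
  rewrite iota_sum (_ : dot _ _ = \sum_(g | colstab s g) dot (fn (iota (polytabloid C t))) (xt C s)).
    rewrite sumr_const (_ : iota 0 = 0); last by rewrite /iota !linear0 mul0mx linear0.
    rewrite [RHS](_ : _ = 0); last by rewrite /dot big1 // => P _; rewrite /fn mxE mul0r.
    move/eqP; rewrite mulrn_eq0 => /orP[/eqP c0|/eqP //].
    have : 1%g \in [pred g | colstab s g] by rewrite inE colstab1.
    by rewrite (card0_eq c0).
  under dot_eq do rewrite fn_sum.
  rewrite dot_suml; apply: eq_bigr => g sg; rewrite iotaZ.
  transitivity (dot (fun P => (-1) ^+ odd_perm g * fn (iota (polytabloid C t)) (pm_act P g^-1)) (xt C s)).
    by apply: dot_eq => P; rewrite fnZ iotaJ // fn_repr.
  rewrite dotZl {1}/dot (reindex_inj (@pm_act_inj n g)) /= mulr_sumr.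
  apply: eq_bigr => P _; rewrite pm_actK xt_antisym //.
  have ee : (-1) ^+ odd_perm g * (-1) ^+ odd_perm g = 1 :> C by rewrite -signr_addb addbb.
  by rewrite [LHS]mulrCA [_ * (_ * xt C s P)]mulrA ee mul1r.
under dot_eq do rewrite fn_sum.
rewrite dot_suml; apply: eq_bigr => t _; rewrite iotaZ.
by rewrite -dotZl; apply: dot_eq => P; rewrite fnZ.
Qed.

(** The equivariant map from tabloids to functions on matchings that takes polytabloids to the
    [xt]. *)
Definition aligned_mx : 'M[C]_(#|{: filling}|, #|{: pmatching n}|) :=
  \matrix_(i, j) (aligned (enum_val i) (enum_val j))%:R.

Lemma fn_aligned_mx t : fn (polytabloid C t *m aligned_mx) =1 xt C t.
Proof.
move=> P; rewrite /polytabloid mulmx_suml fn_sum; apply: eq_bigr => g _.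
rewrite -scalemxAl fnZ; congr (_ * _).
by rewrite /fn -rowE !mxE !enum_rankK.
Qed.

Lemma aligned_mxJ g : tabloid_repr C n g *m aligned_mx = aligned_mx *m matching_repr C n g.
Proof.
apply/row_matrixP => i; rewrite !row_mul; apply: fn_inj => P; rewrite fn_repr.
rewrite /fn mxE (bigD1 (enum_rank (relabel (enum_val i) g))) //= !mxE !enum_rankK eqxx mul1r.
rewrite big1 ?addr0 => [|l nl]; last first.
  rewrite !mxE; case: eqP => [e|_]; rewrite ?mul0r //.
  by case/eqP: nl; rewrite [relabel _ _]e enum_valK.
by rewrite -{1}(pm_actKV g P) aligned_act.
Qed.

Section Existence.
Variable mu : seq nat.
Hypothesis mu_even : even_partition n mu.
Local Notation S := (specht_mx C n mu).

(** By [key], the form on the images of polytabloids is a nonzero multiple [ga] of the standard one.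
    A vector of the kernel is thus orthogonal to all polytabloids, which are real, hence to its own
    conjugate, and so vanishes. *)
Lemma aligned_mx_inj (v : 'rV[C]_#|{: filling}|) : (v <= S)%MS -> v *m aligned_mx = 0 -> v = 0.
Proof.
have pmu := even_is_partition mu_even; have [t0 tt0] := tab_exists pmu.
pose ga := rowsum (xt C t0) (tableau_rows t0).
have gaE t : is_tableau mu t -> rowsum (xt C t) (tableau_rows t) = ga.
  move=> tt; have [g ->] := tab_transitive pmu tt0 tt.
  rewrite rows_relabel rowsum_act; apply: eq_bigr => P _.
  by rewrite xt_relabel pm_actK.
pose e t : 'rV[C]_#|{: filling}| := polytabloid C t.
pose pair (x y : 'rV[C]_#|{: filling}|) : C := \sum_f x 0 (enum_rank f) * y 0 (enum_rank f).
have pairE x t : pair x (e t) = pol (fun f => x 0 (enum_rank f)) t.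
  rewrite /pair /pol; under eq_bigr => f _ do rewrite polytabloidE /tabcoef /pol mulr_sumr.
  rewrite exchange_big; apply: eq_bigr => g _.
  rewrite (bigD1 (relabel (tableau_rows t) g)) //= eqxx mulr1 mulrC big1 ?addr0 // => f nf.
  by rewrite eq_sym (negPf nf) !mulr0.
have key t s : is_tableau mu t -> is_tableau mu s -> dot (xt C t) (xt C s) = ga * pair (e t) (e s).
  move=> tt ts; rewrite pairE (antisym_dot_xt pmu tt (@xt_antisym C n t)); last first.
    by rewrite (wt_tab pmu ts tt).
  by rewrite gaE //; congr (_ * _); apply: eq_pol => f; rewrite polytabloidE.
have ga0 : ga != 0.
  by have := lt0r_neq0 (dot_xt_gt0 C mu_even tt0); rewrite key // mulf_eq0 negb_or => /andP[].
move=> vS v0; have [c vE] := specht_span vS.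
have vt s : is_tableau mu s -> pair v (e s) = 0.
  move=> ts; apply: (mulfI ga0); rewrite mulr0.
  have z0 : dot (fn (v *m aligned_mx)) (xt C s) = 0.
    by rewrite v0 /dot big1 // => P _; rewrite /fn mxE mul0r.
  rewrite -z0 vE mulmx_suml.
  transitivity (\sum_(t | is_tableau mu t) c t * (ga * pair (e t) (e s))).
    rewrite /pair mulr_sumr; under [RHS]eq_bigr => t _ do rewrite !mulr_sumr.
    rewrite [RHS]exchange_big; apply: eq_bigr => f _.
    rewrite summxE mulrCA [RHS](eq_bigr (fun t => ((c t *: polytabloid C t) 0 (enum_rank f)) * (ga * e s 0 (enum_rank f)))).
      by rewrite -mulr_suml.
    by move=> t _; rewrite mxE /e; ring.
  under [RHS]dot_eq do rewrite fn_sum.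
  rewrite dot_suml; apply: eq_bigr => t tt; rewrite -key // -dotZl.
  by apply: dot_eq => P; rewrite -scalemxAl fnZ fn_aligned_mx.
have vv : \sum_f v 0 (enum_rank f) * (v 0 (enum_rank f))^* = 0.
  transitivity (\sum_(s | is_tableau mu s) (c s)^* * pair v (e s)); last first.
    by rewrite big1 // => s ts; rewrite vt ?mulr0.
  rewrite /pair; under [RHS]eq_bigr => s _ do rewrite mulr_sumr.
  rewrite [RHS]exchange_big; apply: eq_bigr => f _.
  rewrite {2}vE summxE rmorph_sum mulr_sumr; apply: eq_bigr => s _.
  rewrite mxE rmorphM /= /e polytabloidE (_ : (tabcoef C s f)^* = tabcoef C s f); first by ring.
  rewrite /tabcoef /pol rmorph_sum; apply: eq_bigr => g _.
  by rewrite rmorphM rmorph_sign rmorph_nat.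
apply/rowP => i; rewrite -(enum_valK i) mxE; apply/eqP.
rewrite -normr_eq0 -sqrf_eq0 normCK; apply/eqP.
move: vv => /eqP; rewrite psumr_eq0 => [/allP h|f _]; last exact: mul_conjC_ge0.
by apply/eqP; apply: (h (enum_val i)); rewrite mem_index_enum.
Qed.

Definition matching_module : 'M[C]_#|{: pmatching n}| := <<S *m aligned_mx>>%MS.

Lemma matching_module_mod : mxmodule (matching_repr C n) matching_module.
Proof.
apply/mxmoduleP => g _; rewrite (eqmxMr _ (genmxE _)) genmxE -mulmxA -aligned_mxJ mulmxA.
apply: submxMr; have /mxmoduleP := specht_mxmodule C n mu; exact.
Qed.

Lemma matching_module_constituent : is_constituent mu matching_module.
Proof.
exists matching_module_mod; apply: mx_rsim_sym.
have rkE : \rank S = \rank matching_module.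
  rewrite genmxE -(mxrank_mul_ker S aligned_mx) (_ : (S :&: kermx aligned_mx)%MS = 0) ?mxrank0 ?addn0 //.
  apply/eqP/rowV0P => v; rewrite sub_capmx => /andP[vS /sub_kermxP].
  exact: aligned_mx_inj.
pose B := in_submod matching_module (val_submod (1%:M : 'M_(\rank S)) *m aligned_mx).
have sub W : (W <= S)%MS -> (W *m aligned_mx <= matching_module)%MS.
  by move=> WS; rewrite genmxE submxMr.
have BE W : W *m B = in_submod matching_module (val_submod (W : 'M_(_, \rank S)) *m aligned_mx).
  by rewrite /B in_submodE [RHS]in_submodE (val_submodE W) !mulmxA.
apply: (MxReprSim (B := B)) => //.
  rewrite -kermx_eq0; apply/rowV0P => v /sub_kermxP; rewrite BE => e.
  apply/eqP; rewrite -val_submod_eq0; apply/eqP; apply: aligned_mx_inj; first exact: val_submodP.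
  by rewrite -(in_submodK (sub _ _ (val_submodP v))) e linear0.
move=> g gG; rewrite BE.
rewrite -[specht_repr C n mu g]mul1mx (val_submodJ (specht_mxmodule C n mu)) //.
rewrite -mulmxA aligned_mxJ mulmxA (in_submodJ matching_module_mod) //.
apply: sub; exact: val_submodP.
Qed.

End Existence.

(** Pair the difference of the two sides with every [xt]: shapes other than [mu] vanish by
    [constituent_orth], and for [mu] symmetry moves the kernel onto [xt]. *)
Lemma constituent_eigen (K : pmatching n -> pmatching n -> C) mu theta U :
  pm_invariant K -> (forall P Q, K P Q = K Q P) -> even_partition n mu ->
  (forall t, is_tableau mu t -> app K (xt C t) =1 (fun P => theta * xt C t P)) ->
  is_constituent mu U -> U *m kernel_mx K = theta *: U.
Proof.
move=> iK sK mue thE cU; apply/row_matrixP => i; rewrite row_mul linearZ /=.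
set u := row i U; have uU : (u <= U)%MS by apply: row_sub.
apply: fn_inj => P; apply/eqP; rewrite -subr_eq0; apply/eqP.
apply: (@xt_complete C n (fun P => fn (u *m kernel_mx K) P - fn (theta *: u) P)) => la s lae ts.
have [th' th'E] := kernel_scalar iK sK lae.
rewrite dotBl (dot_eq _ (fun P => fn_kernel u P sK)) dot_app // dotC (dot_eq _ (th'E s ts)) dotZl.
rewrite (dot_eq _ (fnZ theta u)) dotZl [dot (xt C s) _]dotC.
have [e|/eqP ne] := eqVneq mu la; last by rewrite (constituent_orth mue lae ts ne cU uU) !mulr0 subrr.
rewrite -e in ts; have [P0 tP0] := pairing_exists mue ts.
have -> : th' = theta; last by rewrite subrr.
apply: (mulIf (lt0r_neq0 (xt_pairing_pos C ts tP0))).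
by rewrite -thE // -th'E // -e.
Qed.

End Constituents.

(** * Row sums, least eigenvalue and modules *)

Lemma bhat_main (C : numClosedFieldType) (n k : nat) : n = (2 * k)%N -> (7 <= k)%N ->
  let B := kernel_mx (@bhat_kernel C n k) in
  let d := valency C k in
  [/\ forall i, \sum_j B i j = d,
      least_eigenvalue B (-1)
    & forall mu : seq nat, even_partition n mu ->
      exists theta : C,
        [/\ module_eigenvalue B mu theta,
            theta = -1 <-> mu = [:: 2 * k - 2; 2]%N \/ mu = [:: 2 * k - 4; 4]%N
          & mu <> [:: 2 * k]%N -> mu <> [:: 2 * k - 2; 2]%N ->
            mu <> [:: 2 * k - 4; 4]%N -> -1 < theta < d]].
Proof.
move=> nE k7; case: n nE => [|[|m]] nE B d; [lia|lia|].
have [j kE] : exists j, k = j.+4 by exists (k - 4)%N; lia.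
have j3 : (3 <= j)%N by lia.
rewrite kE in nE; subst k.
have iK := bhat_kernel_inv C j3 nE; have sK := bhat_kernel_sym C j3 nE.
have spec := bhat_eigen C j3 nE.
have d0 : 0 < d by rewrite /d valencyE mulr_gt0 ?mulr_gt0 ?ltr_wpDl ?mulr_ge0 ?invr_gt0.
have d1 : -1 < d by apply: lt_trans d0; rewrite oppr_lt0 ltr01.
have even1 : even_partition m.+2 [:: 2 * j.+4]%N.
  by rewrite /even_partition /= nE; clear; lia.
have even2 : even_partition m.+2 [:: 2 * j.+4 - 2; 2]%N.
  by rewrite /even_partition /= nE; clear; lia.
split.
- move=> i; have [theta [thE sp]] := spec _ even1.
  have th : theta = d.
    by case: sp => [[_ ->]|[[e|e] _]|[ne _ _ _]] //; case: ne.
  have [t tt] := tab_exists (even_is_partition even1).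
  (* For a single row the column stabilizer is trivial and [xt] is constant, so its eigenvalue is
     the row sum. *)
  have one P : xt C t P = 1.
    rewrite /xt /pol (bigD1 1%g) ?colstab1 //= relabel1 odd_perm1 mul1r.
    have row0 x : (t x).1 = 0%N :> nat.
      by have := tab_row_size x tt; rewrite /=; case: (val _).
    rewrite (_ : aligned _ P); last first.
      by apply/alignedP => x; rewrite !ffunE; apply: val_inj; rewrite /= !row0.
    rewrite big1 ?addr0 // => s /andP[/colstabP ts /eqP[]].
    apply/permP => x; rewrite perm1; apply: (tab_eq tt); last by rewrite ts.
    by apply: val_inj; rewrite /= !row0.
  have := thE t tt (enum_val i); rewrite one mulr1 th => <-.
  rewrite /app [RHS](reindex (fun l : 'I_#|{: pmatching m.+2}| => enum_val l)) /=;
    last by apply: onW_bij; apply: enum_val_bij.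
  by apply: eq_bigr => l _; rewrite one mulr1 /B /kernel_mx mxE.
- split.
    have [theta [thE sp]] := spec _ even2.
    have th : theta = -1.
      by case: sp => [[e _]|[_ ->]|[_ ne _ _]] //; case: ne.
    have [t tt] := tab_exists (even_is_partition even2).
    have [P tP] := pairing_exists even2 tt; have pos := xt_pairing_pos C tt tP.
    pose v : 'rV[C]_#|{: pmatching m.+2}| := \row_i xt C t (enum_val i).
    have vE Q : fn v Q = xt C t Q by rewrite /fn mxE enum_rankK.
    apply/eigenvalueP; exists v; last first.
      by apply: contraTneq pos => v0; rewrite -vE v0 /fn mxE ltxx.
    apply: fn_inj => Q; rewrite fn_kernel // fnZ (eq_app _ _ vE) vE thE // th //.
  move=> b /eigenvalueP[v vB v0].
  (* An eigenvector pairs nontrivially with some [xt]; by symmetry of the kernel, [b] is then the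
     eigenvalue belonging to that shape. *)
  have [mu [t [mue tt nz]]] : exists mu t,
      [/\ even_partition m.+2 mu, is_tableau mu t & dot (fn v) (xt C t) != 0].
    have [P vP] : exists P, fn v P != 0.
      apply/existsP; apply: contraR v0; rewrite negb_exists => /forallP h.
      apply/eqP/fn_inj => P; rewrite [RHS]mxE; apply/eqP; have := h P; by rewrite negbK.
    have [f fE] := rowsum_mate (fn v) P.
    have ex : exists w, [exists f, (wt f == w) && (rowsum (fn v) f != 0)].
      by exists (wt f); apply/existsP; exists f; rewrite eqxx fE.
    case: (ex_minnP ex) => w /existsP[g /andP[/eqP wg nzg]] wmin.
    apply: (completeness_min _ wg nzg) => f' lt; apply/eqP; apply: contraT => nzf.
    have : (w <= wt f')%N by apply: wmin; apply/existsP; exists f'; rewrite eqxx.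
    by rewrite leqNgt lt.
  have [theta [thE sp]] := spec _ mue.
  have -> : b = theta.
    apply: (mulIf nz); rewrite -dotZl.
    rewrite (dot_eq _ (fun P => esym (fnZ b v P))) -vB.
    rewrite (dot_eq _ (fun P => fn_kernel v P sK)) dot_app // dotC (dot_eq _ (thE t tt)) dotZl.
    by rewrite dotC.
  by case: sp => [[_ ->]|[_ ->]|[_ _ _ /andP[/ltW ? _]]] //; apply: ltW.
- move=> mu mue; have [theta [thE sp]] := spec _ mue; exists theta; split.
  + split; first by exists (matching_module C m.+2 mu); apply: matching_module_constituent.
    by move=> U; apply: constituent_eigen.
  + case: sp => [[-> ->]|[e ->]|[_ n2 n3 /andP[lt _]]].
    * split=> [e|[]//]; first by move: d1; rewrite /d e ltxx.
    * by split=> _.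
    * by split=> [e|[]//]; move: lt; rewrite e ltxx.
  + by case: sp => [[-> _]|[[->|->] _]|[_ _ _ ->]].
Qed.

Theorem theorem3p3 (C : numClosedFieldType) (k : nat) (hk : (7 <= k)%N) :
  let B := Bhat2 C k in
  let d : C := ((2 * k - 1) * (2 * k - 3))%:R / 3%:R - 1 in
  [/\ forall i, \sum_j B i j = d,
      least_eigenvalue B (-1)
    & forall mu : seq nat, even_partition (2 * k) mu ->
      exists theta : C,
        [/\ module_eigenvalue B mu theta,
            theta = -1 <->
              mu = [:: (2 * k - 2)%N; 2%N] \/ mu = [:: (2 * k - 4)%N; 4%N]
          & mu <> [:: (2 * k)%N] -> mu <> [:: (2 * k - 2)%N; 2%N] ->
            mu <> [:: (2 * k - 4)%N; 4%N] -> -1 < theta < d]].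
Proof.
have -> : Bhat2 C k = kernel_mx (@bhat_kernel C (2 * k) k).
  by apply/matrixP => i j; rewrite !mxE.
exact: bhat_main.
Qed.
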